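(* Suppose $\Omega=B_1(0)\subset\mathbb{R}^2$ and let $u_0$ be a positive constant. Define $$h(u_0):=\min\left\{\pi,\ \inf_{R_0\in(0,1)}\left(\frac{4\pi u_0^2}{\frac{1-R_0^2}{2}+R_0^2\log(R_0)}+\pi(1-R_0^2)\right)\right\}.$$ In case that $h(u_0)<\pi$, the infimum over $R_0\in(0,1)$ in this definition is attained, and for each $R\in(0,1)$ that realizes this infimum the function $$u(x)=u_0\begin{cases}\dfrac{\log R\,|x|^2-R^2\log R}{R^2-1-2R^2\log R} & 0\leq|x|\leq R,\\[2ex] \dfrac{-|x|^2+R^2-2R^2\log R+R^2\log|x|+|x|^2\log|x|}{R^2-1-2R^2\log R} & R<|x|<1\end{cases}$$ is a minimizer of $\mathcal{E}$ in $\mathcal{A}(u_0)$ with energy $\mathcal{E}(u)=h(u_0)$. In case that $h(u_0)=\pi$, a minimizer of $\mathcal{E}$ in $\mathcal{A}(u_0)$ is given by a constant.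
   Context: $B_1(0)$ is the open unit disc in $\mathbb{R}^2$. $\mathcal{A}(u_0):=\{u\in W^{2,2}(\Omega): u-u_0\in W^{1,2}_0(\Omega)\}$ and, for $u\in\mathcal{A}(u_0)$, $\mathcal{E}(u):=\int_\Omega(\Delta u)^2\,dx+|\{x\in\Omega:u(x)>0\}|$, where $|\cdot|$ is Lebesgue measure. A minimizer is a $u\in\mathcal{A}(u_0)$ with $\mathcal{E}(u)=\inf_{w\in\mathcal{A}(u_0)}\mathcal{E}(w)$. $\log$ is the natural logarithm. *)

(* Defs.v *)
From HB Require Import structures.
From mathcomp Require Import all_boot all_order all_algebra.
From mathcomp Require Import all_classical all_reals all_analysis.
Set Implicit Arguments.
Unset Strict Implicit.
Unset Printing Implicit Defensive.
Import Order.TTheory GRing.Theory Num.Theory.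
Import numFieldNormedType.Exports.
Local Open Scope classical_set_scope.
Local Open Scope ring_scope.

(* The plane is the product R * R. Its library norm is the sup norm, which    *)
(* induces the usual topology; the Euclidean norm is enorm. The sigma-algebra *)
(* is the Borel one: every Lebesgue-measurable function has a Borel           *)
(* representative, so the a.e.-classes are the usual ones.                    *)

(* R * R also has a default measurable structure, with the same measurable    *)
(* sets; lebesgue_measure lives on measurableTypeR R.                         *)
Definition borel_plane (R : realType) : measurableType _ :=
  (measurableTypeR R * measurableTypeR R)%type.

Definition lebesgue2 (R : realType) :
    {measure set (borel_plane R) -> \bar R} :=
  (@lebesgue_measure R \x @lebesgue_measure R)%E.
Arguments lebesgue2 {R}.

Definition enorm (R : realType) (x : R * R) : R :=
  Num.sqrt (x.1 ^+ 2 + x.2 ^+ 2).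

Definition unit_disc (R : realType) : set (R * R) := [set x | enorm x < 1].

Definition basis_vec (R : realType) (i : 'I_2) : R * R :=
  if i == ord0 then (1, 0) else (0, 1).

(* partials [:: i1; ...; ik] f is d_i1 (... (d_ik f)). *)
Definition partials (R : realType) (s : seq 'I_2) (f : R * R -> R) : R * R -> R :=
  foldr (fun i g x => 'D_(basis_vec R i) g x) f s.

Definition smooth (R : realType) (f : R * R -> R) : Prop :=
  forall s : seq 'I_2, continuous (partials s f) /\
    forall (i : 'I_2) (x : R * R), derivable (partials s f) x (basis_vec R i).

Definition support_closure (R : realType) (f : R * R -> R) : set (R * R) :=
  closure [set x | f x != 0].

(* C_c^oo(Omega), functions being extended by 0 outside Omega. *)
Definition test_function (R : realType) (Omega : set (R * R))
    (phi : R * R -> R) : Prop :=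
  [/\ smooth phi, compact (support_closure phi) &
      support_closure phi `<=` Omega].

Definition loc_integrable (R : realType) (Omega : set (R * R))
    (u : R * R -> R) : Prop :=
  measurable_fun (Omega : set (borel_plane R)) u /\
  forall K : set (R * R), compact K -> K `<=` Omega ->
    lebesgue2.-integrable K (EFin \o u).

Definition square_integrable (R : realType) (Omega : set (R * R))
    (u : R * R -> R) : Prop :=
  measurable_fun (Omega : set (borel_plane R)) u /\
  (\int[lebesgue2]_(x in Omega) (u x ^+ 2)%:E < +oo)%E.

Definition is_weak_derivative (R : realType) (Omega : set (R * R))
    (s : seq 'I_2) (u v : R * R -> R) : Prop :=
  [/\ loc_integrable Omega u, loc_integrable Omega v &
      forall phi : R * R -> R, test_function Omega phi ->
        \int[lebesgue2]_(x in Omega) (u x * partials s phi x) =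
        (-1) ^+ size s * \int[lebesgue2]_(x in Omega) (v x * phi x)].

(* A chosen representative; weak derivatives are unique a.e. on Omega, and    *)
(* the default value 0 is only reached when there is no weak derivative.      *)
Definition weak_derivative (R : realType) (Omega : set (R * R))
    (s : seq 'I_2) (u : R * R -> R) : R * R -> R :=
  xget (cst 0) [set v | is_weak_derivative Omega s u v].

Definition weak_laplacian (R : realType) (Omega : set (R * R))
    (u : R * R -> R) (x : R * R) : R :=
  \sum_(i < 2) weak_derivative Omega [:: i; i] u x.

(* W^{k,2}(Omega) *)
Definition sobolev (R : realType) (k : nat) (Omega : set (R * R))
    (u : R * R -> R) : Prop :=
  square_integrable Omega u /\
  forall s : seq 'I_2, (size s <= k)%N ->
    exists2 v, is_weak_derivative Omega s u v & square_integrable Omega v.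

(* W^{1,2}_0(Omega): the closure of C_c^oo(Omega) in W^{1,2}(Omega). *)
Definition sobolev0 (R : realType) (Omega : set (R * R))
    (w : R * R -> R) : Prop :=
  sobolev 1 Omega w /\
  exists phi : nat -> R * R -> R,
    (forall n, test_function Omega (phi n)) /\
    (\int[lebesgue2]_(x in Omega)
       ((phi n x - w x) ^+ 2 +
        \sum_(i < 2) (partials [:: i] (phi n) x -
                      weak_derivative Omega [:: i] w x) ^+ 2)%:E)%E
      @[n --> \oo] --> 0%E.

Definition admissible (R : realType) (Omega : set (R * R))
    (g : R * R -> R) : set (R * R -> R) :=
  [set u | sobolev 2 Omega u /\ sobolev0 Omega (fun x => u x - g x)].

Definition energy (R : realType) (Omega : set (R * R))
    (u : R * R -> R) : \bar R :=
  (\int[lebesgue2]_(x in Omega) (weak_laplacian Omega u x ^+ 2)%:E +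
   lebesgue2 [set x | Omega x /\ (0 < u x)%R])%E.

Definition minimizer (R : realType) (Omega : set (R * R))
    (g u : R * R -> R) : Prop :=
  admissible Omega g u /\
  energy Omega u = ereal_inf [set energy Omega w | w in admissible Omega g].

Definition radial_energy (R : realType) (u0 r : R) : R :=
  4 * pi * u0 ^+ 2 / ((1 - r ^+ 2) / 2 + r ^+ 2 * ln r) + pi * (1 - r ^+ 2).

Definition inf_radial_energy (R : realType) (u0 : R) : R :=
  inf [set radial_energy u0 r | r in `]0, 1[].

Definition h (R : realType) (u0 : R) : R :=
  Num.min pi (inf_radial_energy u0).

Definition radial_candidate (R : realType) (u0 r : R) (x : R * R) : R :=
  u0 * (if enorm x <= r then
          (ln r * enorm x ^+ 2 - r ^+ 2 * ln r) /
          (r ^+ 2 - 1 - 2 * r ^+ 2 * ln r)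
        else
          (- enorm x ^+ 2 + r ^+ 2 - 2 * r ^+ 2 * ln r +
           r ^+ 2 * ln (enorm x) + enorm x ^+ 2 * ln (enorm x)) /
          (r ^+ 2 - 1 - 2 * r ^+ 2 * ln r)).

(* Main.v *)
Require Import Defs.
From HB Require Import structures.
From mathcomp Require Import all_boot all_order all_algebra.
From mathcomp Require Import all_classical all_reals all_analysis.
From mathcomp Require Import measurable_realfun.
From mathcomp Require Import ring lra.
Set Implicit Arguments.
Unset Strict Implicit.
Unset Printing Implicit Defensive.
Import Order.TTheory GRing.Theory Num.Theory.
Import numFieldNormedType.Exports.
Local Open Scope classical_set_scope.
Local Open Scope ring_scope.

(* Lower bound. Let w be admissible, v = u0 - w and f = Delta w, so that v is in W^{1,2}_0 and
   int f psi = int grad v . grad psi. Let m(s) = |{v >= s}| and let F(s) be log(pi / m(s)) / (4 pi) up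
   to the level u0, constant above it. On a thin band {s < v < s'}, Cauchy-Schwarz and the sharp
   Sobolev inequality 4 pi int g^2 <= (int |grad g|)^2 give int F'(v) |grad v|^2 >= s' - s, hence
   u0 <= int f F(v). Comparing areas of level sets, int F(v)^2 is at most
   ((1 - r^2) / 2 + r^2 log r) / (4 pi), where pi r^2 = |{w <= 0}|, and Cauchy-Schwarz yields
   int f^2 + |{w > 0}| >= radial_energy u0 r. As v is only a Sobolev function, this is carried out
   with smooth approximations of F and a real induction on the level s; no rearrangement is needed.

   Upper bound. The candidate is a C^2 function of |x|^2, so its weak derivatives are the classical
   ones, and integration in the variable |x|^2 computes its energy. The infimum is attained because
   radial_energy u0 r exceeds pi for r close to 0 or 1. *)

(** The logarithm is dictated by the equality case: if the superlevel sets of v are centered discs,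
    F(v) is the Green function of the disc with pole at 0, truncated, and for the candidate Delta u
    is a multiple of it, so Cauchy-Schwarz loses nothing. On a band of area b with area M above it,
    a function H(v) climbing by d satisfies, up to small errors, 4 pi d^2 M <= (int H' |grad v|)^2
    <= b d / (s' - s) int H' |grad v|^2; the increment d = b / (4 pi M) is the one that makes the
    last integral at least s' - s. Two obstacles shape the argument. The distribution function m may
    jump, since v can be constant on sets of positive area; bands are therefore open intervals of
    levels, whose area tends to 0 as they shrink towards an end, and the value of F on a plateau is
    accounted for separately. Moreover the gradient estimate holds only for test functions near v,
    at a distance depending on the bands already used. One parameter k absorbs these losses: F is
    completed for fixed k, then the test functions converge to v, and k tends to 0 last. *)

(** * Directional derivatives and smoothness classes *)

Section DirectionalSmoothness.
Variable R : realType.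

(** Only the restriction to a line matters, so directional derivatives inherit one-variable rules,
    in particular the chain rule, without any total differential of f. *)
Lemma is_derive_line (V : normedModType R) (f : V -> R) (x v : V) (a : R) :
  is_derive x v f a <-> is_derive (0 : R) 1 (fun t : R => f (t *: v + x)) a.
Proof.
have E : (fun h : R => h^-1 *: (((fun t : R => f (t *: v + x)) \o shift 0) (h *: 1) - f (0 *: v + x)))
   = (fun h : R => h^-1 *: ((f \o shift x) (h *: v) - f x)).
  by apply/funext => h /=; rewrite scale0r add0r addr0 /GRing.scale/= mulr1.
split=> -[df dv]; split.
- by rewrite /derivable E.
- by rewrite /derive E.
- by move: df; rewrite /derivable E.
- by move: dv; rewrite /derive E.
Qed.

Lemma is_derive_comp_line (V : normedModType R) (F : R -> R) (f : V -> R)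
    (x v : V) (a b : R) :
  is_derive (f x) 1 F a -> is_derive x v f b ->
  is_derive x v (F \o f) (a * b).
Proof.
move=> dF /is_derive_line df; apply/is_derive_line.
have -> : (fun t : R => (F \o f) (t *: v + x)) = F \o (fun t : R => f (t *: v + x)) by [].
by apply: is_derive1_comp; rewrite scale0r add0r.
Qed.

(** C^k through the existence of directional derivatives along the family [e], in a form closed
    under products and composition by induction on k. One definition serves the line ([e] constantly
    1, indexed by [unit]) and the plane ([e] being [basis_vec]). *)
Fixpoint Cn (V : normedModType R) (I : Type) (e : I -> V) (k : nat) (f : V -> R) : Prop :=
  continuous f /\
  (if k is k'.+1 then
     forall i, exists2 g, (forall x, is_derive x (e i) f (g x)) & Cn e k' g
   else True).

Section Cn.
Variables (V : normedModType R) (I : Type) (e : I -> V).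
Implicit Types (f g : V -> R) (k : nat).

Lemma Cn_continuous k f : Cn e k f -> continuous f.
Proof. by case: k => [|k] []. Qed.

Lemma CnS k f : Cn e k.+1 f -> Cn e k f.
Proof.
elim: k f => [|k IH] f; first by case.
move=> [cf df]; split=> // i; have [g fg Cg] := df i.
by exists g => //; exact: IH.
Qed.

Lemma Cn_cst k (c : R) : Cn e k (cst c).
Proof.
elim: k c => [|k IH] c; (split; first by move=> x; exact: cvg_cst) => //.
by move=> i; exists (cst 0) => // x; exact: is_derive_cst.
Qed.

Lemma CnD k f g : Cn e k f -> Cn e k g -> Cn e k (fun x => f x + g x).
Proof.
elim: k f g => [|k IH] f g [cf df] [cg dg].
  by split=> // x; apply: cvgD; [exact: cf|exact: cg].
split=> [x|i]; first by apply: cvgD; [exact: cf|exact: cg].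
have [f' ff' Cf'] := df i; have [g' gg' Cg'] := dg i.
exists (fun x => f' x + g' x); last exact: IH.
by move=> x; exact: is_deriveD.
Qed.

Lemma CnM k f g : Cn e k f -> Cn e k g -> Cn e k (fun x => f x * g x).
Proof.
elim: k f g => [|k IH] f g /[dup] Cf [cf df] /[dup] Cg [cg dg].
  by split=> // x; apply: cvgM; [exact: cf|exact: cg].
split=> [x|i]; first by apply: cvgM; [exact: cf|exact: cg].
have [f' ff' Cf'] := df i; have [g' gg' Cg'] := dg i.
exists (fun x => f x * g' x + g x * f' x).
  by move=> x; exact: is_deriveM.
by apply: CnD; apply: IH => //; exact: CnS.
Qed.

Lemma CnZ k c f : Cn e k f -> Cn e k (fun x => c * f x).
Proof. by move=> Cf; apply: CnM => //; exact: Cn_cst. Qed.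

Lemma CnN k f : Cn e k f -> Cn e k (fun x => - f x).
Proof.
move=> Cf; rewrite (_ : (fun x => _) = (fun x => -1 * f x)); first exact: CnZ.
by apply/funext => x; rewrite mulN1r.
Qed.

Lemma CnB k f g : Cn e k f -> Cn e k g -> Cn e k (fun x => f x - g x).
Proof. by move=> Cf Cg; apply: CnD => //; exact: CnN. Qed.

Lemma Cn_comp k (F : R -> R) f :
  Cn (fun _ : unit => 1 : R) k F -> Cn e k f -> Cn e k (F \o f).
Proof.
elim: k F f => [|k IH] F f [cF dF] /[dup] Cf [cf df].
  by split=> // x; apply: (continuous_comp (cf x)); exact: cF.
split=> [x|i]; first by apply: (continuous_comp (cf x)); exact: cF.
have [F' FF' CF'] := dF tt; have [f' ff' Cf'] := df i.
exists (fun x => (F' \o f) x * f' x).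
  by move=> x; exact: (is_derive_comp_line (FF' _) (ff' _)).
by apply: CnM => //; apply: IH => //; exact: CnS.
Qed.

End Cn.

Definition smooth1 (f : R -> R) := forall k, Cn (fun _ : unit => 1 : R) k f.

Lemma smooth1_derive (f g : R -> R) :
  smooth1 f -> (forall x : R, is_derive x 1 f (g x)) -> smooth1 g.
Proof.
move=> Sf fg k; have [_ /(_ tt) [g' fg']] := Sf k.+1.
suff -> : g' = g by [].
apply/funext => x; have [_ <-] := fg' x; exact: (@derive_val _ _ _ _ _ _ _ (fg x)).
Qed.

Lemma smooth1_id : smooth1 id.
Proof.
case=> [|k]; (split; first by move=> x; exact: cvg_id) => //.
by move=> _; exists (cst 1); [move=> x; exact: is_derive_id|exact: Cn_cst].
Qed.

Lemma smooth1_primitive (f g : R -> R) :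
  (forall x : R, is_derive x 1 f (g x)) -> smooth1 g -> smooth1 f.
Proof.
move=> fg Sg.
have cf : continuous f.
  move=> x; apply: differentiable_continuous; apply/derivable1_diffP.
  exact: (@ex_derive _ _ _ _ _ _ _ (fg x)).
by case=> [|k]; split=> // _; exists g.
Qed.

Lemma is_derive_fst (x : R * R) (i : 'I_2) :
  is_derive x (basis_vec R i) fst (basis_vec R i).1.
Proof.
apply/is_derive_line => /=.
rewrite (_ : (fun t : R => _) = (fun t : R => (basis_vec R i).1 * t + x.1)).
  apply: is_derive_eq; rewrite ?addr0 //.
  by rewrite ?scaler0 ?addr0 ?add0r /GRing.scale/= ?mulr1 ?mulr0 ?addr0 ?add0r.
by apply/funext => t; rewrite /GRing.scale/= mulrC.
Qed.

Lemma is_derive_snd (x : R * R) (i : 'I_2) :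
  is_derive x (basis_vec R i) snd (basis_vec R i).2.
Proof.
apply/is_derive_line => /=.
rewrite (_ : (fun t : R => _) = (fun t : R => (basis_vec R i).2 * t + x.2)).
  apply: is_derive_eq; rewrite ?addr0 //.
  by rewrite ?scaler0 ?addr0 ?add0r /GRing.scale/= ?mulr1 ?mulr0 ?addr0 ?add0r.
by apply/funext => t; rewrite /GRing.scale/= mulrC.
Qed.

Lemma Cn_coord1 k : Cn (@basis_vec R) k (fst : R * R -> R).
Proof.
have cc : continuous (fst : R * R -> R) by move=> x; exact: cvg_fst.
case: k => [|k]; split=> // i.
exists (cst (basis_vec R i).1); last exact: Cn_cst.
by move=> x; exact: is_derive_fst.
Qed.

Lemma Cn_coord2 k : Cn (@basis_vec R) k (snd : R * R -> R).
Proof.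
have cc : continuous (snd : R * R -> R) by move=> x; exact: cvg_snd.
case: k => [|k]; split=> // i.
exists (cst (basis_vec R i).2); last exact: Cn_cst.
by move=> x; exact: is_derive_snd.
Qed.

(** Transfers the closure properties of [Cn] to [smooth], whose definition by iterated partials does
    not lend itself to an induction for products. *)
Lemma smoothP (f : R * R -> R) : smooth f <-> forall k, Cn (@basis_vec R) k f.
Proof.
split=> [Sf k|Cf s].
  elim: k f Sf => [|k IH] f Sf; split=> //; try by have [] := Sf [::].
  move=> i; exists (partials [:: i] f).
    by move=> x; apply: derivableP; have [_] := Sf [::]; exact.
  (* [partials] applies the last index of the list first, hence [rcons]. *)
  apply: IH => s; have := Sf (rcons s i).
  by rewrite /partials -cats1 foldr_cat.
have : forall k, Cn (@basis_vec R) k (partials s f).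
  elim: s => [|i s IH] //= k; have [_ /(_ i) [g fg Cg]] := IH k.+1.
  suff -> : (fun x => 'D_(basis_vec R i) (foldr (fun i g x => 'D_(basis_vec R i) g x) f s) x) = g by [].
  by apply/funext => x; exact: (@derive_val _ _ _ _ _ _ _ (fg x)).
move=> {}Cf; split; first exact: (Cn_continuous (Cf 0%N)).
move=> i x; have [_ /(_ i) [g fg _]] := Cf 1%N.
exact: (@ex_derive _ _ _ _ _ _ _ (fg x)).
Qed.

End DirectionalSmoothness.

(** * Smooth steps on the line *)

Section RealSmooth.
Variable R : realType.
Implicit Types f g : R -> R.

Lemma is_derive_continuous f g : (forall x : R, is_derive x 1 f (g x)) -> continuous f.
Proof.
move=> fg x; apply: differentiable_continuous; apply/derivable1_diffP.
exact: (@ex_derive _ _ _ _ _ _ _ (fg x)).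
Qed.

Lemma derive_mean_value f g (a b : R) : a <= b ->
  (forall x : R, is_derive x 1 f (g x)) ->
  exists2 c : R, a <= c <= b & f b - f a = g c * (b - a).
Proof.
move=> ab fg.
have [c] := @MVT_segment R f g a b ab (fun x _ => fg x)
  (continuous_subspaceT (is_derive_continuous fg)).
by rewrite in_itv /= => cab E; exists c.
Qed.

Lemma derive_ge0_nondecreasing f g :
  (forall x : R, is_derive x 1 f (g x)) -> (forall x, 0 <= g x) ->
  forall a b, a <= b -> f a <= f b.
Proof.
move=> fg g0 a b ab; have [c _ E] := derive_mean_value ab fg.
by rewrite -subr_ge0 E mulr_ge0 // subr_ge0.
Qed.

Lemma derive_bounded_lipschitz f g C :
  (forall x : R, is_derive x 1 f (g x)) -> (forall x, `|g x| <= C) ->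
  forall a b, `|f a - f b| <= C * `|a - b|.
Proof.
move=> fg gC a b; wlog ab : a b / b <= a => [hw|].
  by case: (leP b a) => [|/ltW] /hw //; rewrite distrC [X in _ -> _ <= _ * X]distrC.
have [c _ ->] := derive_mean_value ab fg.
by rewrite normrM ler_wpM2r.
Qed.

Lemma is_derive0_square f (C : R) :
  f 0 = 0 -> (forall x, `|f x| <= C * x ^+ 2) -> is_derive (0 : R) 1 f 0.
Proof.
move=> f0 fC.
have cv : (fun h : R => h^-1 *: ((f \o shift 0) (h *: 1) - f 0)) @ 0^' --> (0 : R).
  apply: (@cvg_to_0_linear _ _ C 1); first exact: ltr01.
  move=> h /andP[h0 _] /=.
  rewrite addr0 /GRing.scale/= mulr1 f0 subr0 normrM normfV.
  rewrite mulrC ler_pdivrMr //.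
  by rewrite -mulrA -normrM -expr2 (ger0_norm (sqr_ge0 h)); exact: fC.
split; first by apply/cvg_ex; exists 0.
by apply: cvg_lim.
Qed.

Lemma is_derive_exprn n (x : R) :
  is_derive x 1 (fun y : R => y ^+ n) (n%:R * x ^+ n.-1).
Proof.
apply: DeriveDef; first exact: exprn_derivable.
by rewrite exp_derive /GRing.scale/= mulr1.
Qed.

(** The weights x^-k make the family stable under differentiation up to linear combinations, so all
    members are proved smooth by one induction on the order. *)
Definition flat_exp (k : nat) (x : R) : R :=
  if 0 < x then x ^- k * expR (- x^-1) else 0.

Lemma flat_exp_ge0 k x : 0 <= flat_exp k x.
Proof.
rewrite /flat_exp; case: ifPn => // x0.
by rewrite mulr_ge0 ?expR_ge0 // invr_ge0 exprn_ge0 // ltW.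
Qed.

(** The series of exp(1/x) dominates its term of degree k + 2; two powers of x remain, which forces
    a zero derivative at 0. *)
Lemma flat_exp_le_square k x : `|flat_exp k x| <= (k.+2)`!%:R * x ^+ 2.
Proof.
rewrite ger0_norm ?flat_exp_ge0 // /flat_exp; case: ifPn => x0; last first.
  by rewrite mulr_ge0 // sqr_ge0.
have y0 : 0 <= x^-1 by rewrite invr_ge0 ltW.
have H : x^-1 ^+ k.+2 / (k.+2)`!%:R <= expR x^-1.
  by apply: le_trans (expR_ge1Dxn k.+1 y0); rewrite lerDr.
have f0 : 0 < (k.+2)`!%:R :> R by rewrite ltr0n fact_gt0.
rewrite expRN ler_pdivrMr ?expR_gt0 // -exprVn.
rewrite ler_pdivrMr // in H.
have := ler_wpM2r (sqr_ge0 x) H.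
have -> : x^-1 ^+ k.+2 * x ^+ 2 = x^-1 ^+ k.
  by rewrite -addn2 exprD -mulrA -exprMn mulVf ?gt_eqF // expr1n mulr1.
by move=> HH; rewrite [leRHS]mulrC mulrA.
Qed.

Lemma flat_exp_derive k (x : R) :
  is_derive x 1 (flat_exp k) (flat_exp k.+2 x - k%:R * flat_exp k.+1 x).
Proof.
have [x0|x0|->] := ltgtP x 0.
- have -> : flat_exp k.+2 x - k%:R * flat_exp k.+1 x = 0.
    by rewrite /flat_exp ltNge (ltW x0) /= mulr0 subr0.
  apply: (@near_eq_is_derive _ _ _ (cst 0)).
  near=> y; rewrite /flat_exp /=; case: ifPn => // y0.
  have : y < 0 by near: y; exact: lt_nbhsl.
  by move=> /(lt_trans y0); rewrite ltxx.
- have xk : x ^+ k != 0 by rewrite expf_neq0 // gt_eqF.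
  have xn : x != 0 by rewrite gt_eqF.
  have d1 : is_derive x 1 (fun y : R => - y^-1) (x ^- 2).
    apply: is_derive_eq; first by apply: is_deriveN; exact: is_deriveV.
    by rewrite /GRing.scale/= mulr1 opprK.
  have d2 : is_derive x 1 (expR \o (fun y : R => - y^-1)) (expR (- x^-1) * x ^- 2).
    exact: is_derive1_comp.
  have d3 : is_derive x 1 (fun y : R => (y ^+ k)^-1)
      (- (x ^+ k) ^- 2 *: (k%:R * x ^+ k.-1)).
    by apply: is_deriveV => //; exact: is_derive_exprn.
  have d4 := is_deriveM d3 d2.
  apply: is_derive_eq; first apply: near_eq_is_derive d4.
    near=> y; rewrite /flat_exp.
    suff -> : 0 < y by [].
    by near: y; exact: lt_nbhsr.
  rewrite /flat_exp x0 /GRing.scale/=.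
  case: k xk d3 d4 => [|k] xk d3 d4; first by rewrite /= !expr0 expr1; field.
  rewrite /= !exprS expr0; field; rewrite xn /=.
  by rewrite andbT expf_neq0.
- rewrite {2 3}/flat_exp ltxx mulr0 subr0.
  apply: (@is_derive0_square _ (k.+2)`!%:R); first by rewrite /flat_exp ltxx.
  exact: flat_exp_le_square.
Unshelve. all: by end_near.
Qed.

Lemma smooth1_flat_exp k : smooth1 (flat_exp k).
Proof.
move=> n; elim: n k => [|n IH] k;
  (split; first by apply: is_derive_continuous; exact: flat_exp_derive) => //.
move=> _; exists (fun x => flat_exp k.+2 x - k%:R * flat_exp k.+1 x).
  exact: flat_exp_derive.
by apply: CnB => //; exact: CnZ.
Qed.

Lemma smooth1_comp (F f : R -> R) : smooth1 F -> smooth1 f -> smooth1 (fun x => F (f x)).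
Proof. by move=> SF Sf k; exact: Cn_comp (SF k) (Sf k). Qed.

(** The integral starts at a - 1 so that every x >= a is interior to an interval of integration; to
    the left of a the integral is 0. *)
Lemma exists_primitive f (a : R) : continuous f -> (forall x, x <= a -> f x = 0) ->
  exists2 F : R -> R, (forall x : R, is_derive x 1 F (f x)) &
    (forall x, x <= a -> F x = 0).
Proof.
move=> cf f0.
pose F (x : R) := \int[@lebesgue_measure R]_(t in `[a - 1, x]) f t.
have F0 x : x <= a -> F x = 0.
  move=> xa; rewrite /F (@eq_Rintegral _ _ _ _ _ (cst 0)).
    by rewrite Rintegral_cst // mul0r.
  move=> t; rewrite inE /= in_itv /= => /andP[_ tx].
  by rewrite f0 // (le_trans tx).
exists F => // x; have [xa|ax] := ltP x a.
  rewrite f0 ?ltW //; apply: (@near_eq_is_derive _ _ _ (cst 0)).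
  by near=> y; rewrite F0 //; apply: ltW; near: y; exact: lt_nbhsl.
have [] := @continuous_FTC1_closed R f (a - 1) x (x + 1) _ _ _ (cf x).
- by rewrite ltrDl.
- apply: continuous_compact_integrable; first exact: segment_compact.
  exact: continuous_subspaceT.
- by rewrite (lt_le_trans _ ax) // ltrBlDr ltrDl.
move=> dF <-; rewrite derive1E; exact: derivableP.
Unshelve. all: by end_near.
Qed.

(** The normalized primitive of the bump exp(-1/x) exp(-1/(1 - x)) on ]0, 1[. *)
Lemma exists_smooth_step : exists S : R -> R,
  [/\ smooth1 S, forall x, x <= 0 -> S x = 0, forall x, 1 <= x -> S x = 1,
      forall x, 0 <= S x <= 1 & forall x y, x <= y -> S x <= S y].
Proof.
pose b (x : R) := flat_exp 0 x * flat_exp 0 (1 - x).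
have Sb : smooth1 b.
  move=> k; apply: CnM; first exact: smooth1_flat_exp.
  apply: smooth1_comp => {}k; first exact: smooth1_flat_exp.
  by apply: CnB; [exact: Cn_cst|exact: smooth1_id].
have b0 x : x <= 0 -> b x = 0.
  by move=> x0; rewrite /b /flat_exp ltNge x0 mul0r.
have b1 x : 1 <= x -> b x = 0.
  by move=> x1; rewrite /b {2}/flat_exp subr_gt0 ltNge x1 mulr0.
have bge x : 0 <= b x by rewrite mulr_ge0 ?flat_exp_ge0.
have [F dF F0] := exists_primitive (Cn_continuous (Sb 0%N)) b0.
have Fnd := derive_ge0_nondecreasing dF bge.
have F1 x : 1 <= x -> F x = F 1.
  move=> x1; have [c /andP[c1 _]] := derive_mean_value x1 dF.
  by rewrite b1 // mul0r => /eqP; rewrite subr_eq0 => /eqP.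
have Fp : 0 < F 1.
  (* The bump is positive on [1/3, 2/3], which makes the normalizing constant [F 1] positive. *)
  have h : (3^-1 : R) <= 2 / 3 by lra.
  have [c /andP[c0 c1] E] := derive_mean_value h dF.
  have bc : 0 < b c.
    have c0' : 0 < c by apply: lt_le_trans c0; rewrite invr_gt0.
    have c1' : 0 < 1 - c by rewrite subr_gt0 (le_lt_trans c1) // ltr_pdivrMr // mul1r ltr_nat.
    rewrite /b /flat_exp c0' c1'.
    by rewrite !expr0 invr1 !mul1r mulr_gt0 ?expR_gt0.
  have lt : F 3^-1 < F (2 / 3) by rewrite -subr_gt0 E mulr_gt0 //; lra.
  have h3 : F 0 <= F 3^-1 by apply: Fnd; lra.
  have h4 : F (2 / 3) <= F 1 by apply: Fnd; lra.
  by rewrite -(F0 0) //; lra.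
exists (fun x => (F 1)^-1 * F x); split.
- by move=> k; apply: CnZ; exact: (smooth1_primitive dF Sb).
- by move=> x /F0 ->; rewrite mulr0.
- by move=> x /F1 ->; rewrite mulVf ?gt_eqF.
- move=> x; rewrite mulrC divr_ge0 ?(ltW Fp) //=; last first.
    by have [/F0 -> //|/ltW x0] := leP x 0; rewrite -(F0 0) // Fnd.
  rewrite ler_pdivrMr // mul1r.
  by have [/F1 -> //|/ltW x1] := leP 1 x; rewrite Fnd.
- by move=> x y xy; rewrite ler_wpM2l ?Fnd // invr_ge0 ltW.
Qed.

(* A smooth step whose slope nearly attains the optimal value d / (b - a). *)
Lemma exists_linear_step (a b d k : R) : a < b -> 0 < d -> 0 < k ->
  exists H h : R -> R, exists eta : R,
  [/\ 0 < eta, a + eta < b - eta, smooth1 H &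
      forall x : R, is_derive x 1 H (h x)] /\
  [/\ forall x, 0 <= h x <= d * (1 + k) / (b - a),
      forall x, ~~ (a + eta <= x <= b - eta) -> h x = 0,
      forall x, x <= a + eta -> H x = 0 & forall x, b - eta <= x -> H x = d].
Proof.
move=> ab d0 k0; have [S [SS S0 S1 S01 Snd]] := exists_smooth_step.
have ba : 0 < b - a by rewrite subr_gt0.
have k1 : 0 < 1 + k by lra.
(* With this [e] the plateau where [p] is 1 has length (b - a) / (1 + k). The mass of [p] is at
   least that, so the normalized slope is at most d (1 + k) / (b - a). *)
pose e := (b - a) * k / (4 * (1 + k)).
have e0 : 0 < e by rewrite divr_gt0 ?mulr_gt0.
have eE : (b - a) - 4 * e = (b - a) / (1 + k).
  by rewrite /e; field; rewrite gt_eqF.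
have e4 : 0 < (b - a) - 4 * e by rewrite eE divr_gt0.
pose p x := S ((x - (a + e)) / e) * S ((b - e - x) / e).
have Sp : smooth1 p.
  have aff c (c' : R) : smooth1 (fun x => S ((c * x + c') / e)).
    apply: smooth1_comp => // n.
    apply: CnM; last exact: Cn_cst.
    by apply: CnD; [apply: CnZ; exact: smooth1_id|exact: Cn_cst].
  move=> n; apply: CnM.
  - rewrite (_ : (fun x => _) = (fun x => S ((1 * x + - (a + e)) / e))); first exact: aff.
    by apply/funext => x; rewrite mul1r.
  - rewrite (_ : (fun x => _) = (fun x => S ((-1 * x + (b - e)) / e))); first exact: aff.
    by apply/funext => x; rewrite mulN1r addrC.
have pl x : x <= a + e -> p x = 0.
  by move=> xa; rewrite /p S0 ?mul0r // pmulr_lle0 ?invr_gt0 // subr_le0.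
have pr x : b - e <= x -> p x = 0.
  by move=> xa; rewrite /p mulrC S0 ?mul0r // pmulr_lle0 ?invr_gt0 // subr_le0.
have p01 x : 0 <= p x <= 1.
  rewrite /p; have /andP[u0 u1] := S01 ((x - (a + e)) / e).
  have /andP[v0 v1] := S01 ((b - e - x) / e).
  by rewrite mulr_ge0 //= mulr_ile1.
have pm x : a + 2 * e <= x <= b - 2 * e -> p x = 1.
  by move=> /andP[xa xb]; rewrite /p !S1 ?mulr1 // ler_pdivlMr // mul1r; lra.
have [P dP P0] := exists_primitive (Cn_continuous (Sp 0%N)) pl.
have pge x : 0 <= p x by case/andP: (p01 x).
have Pnd := derive_ge0_nondecreasing dP pge.
have Pr x : b - e <= x -> P x = P (b - e).
  move=> x1; have [c /andP[c1 _]] := derive_mean_value x1 dP.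
  by rewrite pr // mul0r => /eqP; rewrite subr_eq0 => /eqP.
have PI : (b - a) / (1 + k) <= P (b - e).
  have h : a + 2 * e <= b - 2 * e by lra.
  have [c cab E] := derive_mean_value h dP.
  rewrite pm // mul1r in E.
  have h3 : P (a + e) <= P (a + 2 * e) by apply: Pnd; lra.
  have h4 : P (b - 2 * e) <= P (b - e) by apply: Pnd; lra.
  have h5 : P (a + e) = 0 by rewrite P0.
  by rewrite -eE; lra.
have I0 : 0 < P (b - e) by apply: lt_le_trans PI; rewrite divr_gt0.
exists (fun x => d / P (b - e) * P x), (fun x => d / P (b - e) * p x), e.
have q0 : 0 < d / P (b - e) by rewrite divr_gt0.
have dH (x : R) : is_derive x 1 (fun x : R => d / P (b - e) * P x) (d / P (b - e) * p x).
  by have := dP x => ?; exact: is_deriveZ.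
split; split=> //.
- by lra.
- by move=> n; apply: CnZ; exact: (smooth1_primitive dP Sp).
- move=> x; rewrite mulr_ge0 ?(ltW q0) //=.
  apply: (@le_trans _ _ (d / P (b - e))).
    by rewrite ler_piMr ?(ltW q0) //; case/andP: (p01 x).
  rewrite -mulrA ler_pM2l // -[leRHS]invrK lef_pV2 ?posrE ?invr_gt0 ?divr_gt0 //.
  by rewrite invf_div.
- move=> x; rewrite negb_and -!ltNge => /orP[/ltW/pl|/ltW/pr] ->; exact: mulr0.
- by move=> x /P0 ->; rewrite mulr0.
- by move=> x /Pr ->; rewrite divfK // gt_eqF.
Qed.

End RealSmooth.

(** * Integrability of real-valued combinations *)

Section RealIntegrable.
Context d (T : measurableType d) (R : realType) (m : {measure set T -> \bar R}).
Implicit Types (D : set T) (f g : T -> R).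

Lemma integrableD_EFin D f g : measurable D ->
  m.-integrable D (EFin \o f) -> m.-integrable D (EFin \o g) ->
  m.-integrable D (EFin \o (fun x => f x + g x)).
Proof. by move=> mD fi gi; apply: eq_integrable (integrableD mD fi gi). Qed.

Lemma integrableB_EFin D f g : measurable D ->
  m.-integrable D (EFin \o f) -> m.-integrable D (EFin \o g) ->
  m.-integrable D (EFin \o (fun x => f x - g x)).
Proof. by move=> mD fi gi; apply: eq_integrable (integrableB mD fi gi). Qed.

Lemma integrableZl_EFin D c f : measurable D ->
  m.-integrable D (EFin \o f) -> m.-integrable D (EFin \o (fun x => c * f x)).
Proof. by move=> mD fi; apply: eq_integrable (integrableZl mD c fi). Qed.

End RealIntegrable.

(** * Measurability and integrability in the plane *)

Section PlaneMeasure.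
Variable R : realType.
Local Notation mu := (@lebesgue_measure R).
Local Notation mu2 := (@lebesgue2 R).

Lemma open_box_nbhs (A : set (R * R)) (x : R * R) : open A -> A x ->
  exists2 e : R, 0 < e & forall y : R * R, `|y.1 - x.1| < e -> `|y.2 - x.2| < e -> A y.
Proof.
move=> oA Ax; have := open_nbhs_nbhs (conj oA Ax).
move=> /nbhs_ballP [e e0 eA]; exists e => // y y1 y2; apply: eA.
by split; rewrite /ball /= distrC.
Qed.

(** An open set is the countable union of the boxes with rational corners that it contains, and
    boxes are measurable for the product sigma-algebra. *)
Lemma open_measurable_plane (A : set (R * R)) :
  open A -> measurable (A : set (borel_plane R)).
Proof.
move=> oA.
pose B (q : (rat * rat) * (rat * rat)) : set (borel_plane R) :=
  `]ratr q.1.1, ratr q.1.2[ `*` `]ratr q.2.1, ratr q.2.2[.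
pose F q : set (borel_plane R) := if `[< B q `<=` A >] then B q else set0.
have -> : A = \bigcup_q F q.
  apply/seteqP; split=> [x Ax|x [q _]]; last by rewrite /F; case: asboolP => // + Bx; exact.
  have [e e0 eA] := open_box_nbhs oA Ax.
  have [a aE] : exists q : rat, ratr q \in `]x.1 - e, x.1[ by apply: rat_in_itvoo; lra.
  have [b bE] : exists q : rat, ratr q \in `]x.1, x.1 + e[ by apply: rat_in_itvoo; lra.
  have [c cE] : exists q : rat, ratr q \in `]x.2 - e, x.2[ by apply: rat_in_itvoo; lra.
  have [d dE] : exists q : rat, ratr q \in `]x.2, x.2 + e[ by apply: rat_in_itvoo; lra.
  rewrite !in_itv /= in aE bE cE dE.
  case/andP: aE => a1 a2; case/andP: bE => b1 b2.
  case/andP: cE => c1 c2; case/andP: dE => d1 d2.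
  exists ((a, b), (c, d)) => //; rewrite /F; case: asboolP => [_|].
    by split; rewrite /= in_itv /=; apply/andP.
  case=> y [/=]; rewrite !in_itv /= => /andP[y1 y2] /andP[y3 y4].
  by apply: eA; rewrite ltr_distl ?(lt_trans a1 y1) ?(lt_trans y2 b2) ?(lt_trans c1 y3) ?(lt_trans y4 d2).
apply: countable_bigcupT_measurable; first exact: countableP.
move=> q; rewrite /F; case: asboolP => _; last exact: measurable0.
by apply: measurableX; exact: measurable_itv.
Qed.

Lemma closed_measurable_plane (A : set (R * R)) :
  closed A -> measurable (A : set (borel_plane R)).
Proof.
move=> cA; rewrite -(setCK A); apply: measurableC.
apply: open_measurable_plane. exact: closed_openC.
Qed.

Lemma compact_measurable_plane (A : set (R * R)) :
  compact A -> measurable (A : set (borel_plane R)).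
Proof.
move=> cA; apply: closed_measurable_plane; apply: compact_closed => //.
Qed.

Lemma continuous_measurable_plane (D : set (R * R)) (f : R * R -> R) :
  measurable (D : set (borel_plane R)) -> continuous f ->
  measurable_fun (D : set (borel_plane R)) f.
Proof.
move=> mD cf; apply: measurable_funS (@measurableT _ _) (@subsetT _ _) _.
apply: (measurability _ (measurable_realfun.RGenOInfty.measurableE R)) => _ [_ [a ->] <-].
rewrite setTI; apply: open_measurable_plane.
by apply: open_comp; [move=> x _; exact: cf|exact: interval_open].
Qed.

(** Stated as vanishing outside a square, so that all sections are supported in one fixed segment,
    as the Fubini arguments require. *)
Definition compactly_supported (f : R * R -> R) : Prop :=
  exists2 M : R, 0 < M & forall x, M < `|x.1| \/ M < `|x.2| -> f x = 0.

Definition box (M : R) : set (R * R) := `[- M, M] `*` `[- M, M].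

Lemma box_measurable M : measurable (box M : set (borel_plane R)).
Proof. by apply: measurableX; exact: measurable_itv. Qed.

Lemma box_compact M : compact (box M).
Proof. by apply: compact_setX; exact: segment_compact. Qed.

Lemma box_ltoo M : (mu2 (box M) < +oo)%E.
Proof.
rewrite (_ : mu2 _ = (mu `[(- M)%R, M] * mu `[(- M)%R, M])%E).
  apply: lte_mul_pinfty => //; rewrite ?ge0_fin_numE //= lebesgue_measure_itv /=;
  by case: ifPn => // _; rewrite -EFinD ?ltry.
by apply: product_measure1E; exact: measurable_itv.
Qed.

Lemma boxP M (x : R * R) : box M x <-> `|x.1| <= M /\ `|x.2| <= M.
Proof.
by rewrite /box /= !in_itv /= -!ler_norml.
Qed.

Lemma compact_sub_box (K : set (R * R)) : compact K -> exists2 M, 0 < M & K `<=` box M.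
Proof.
move=> /compact_bounded [M [_ HM]].
exists (`|M| + 1) => [|x Kx]; first by have := normr_ge0 M; lra.
have h : M < `|M| + 1 by have := ler_norm M; lra.
have := HM _ h x Kx => /=; rewrite prod_normE /= ge_max => /andP[? ?].
exact/boxP.
Qed.

Lemma finite_measure_compact (K : set (R * R)) : compact K -> (mu2 K < +oo)%E.
Proof.
move=> cK; have [M _ KM] := compact_sub_box cK.
apply: le_lt_trans (box_ltoo M); apply: le_measure => //; rewrite inE.
  exact: compact_measurable_plane.
exact: box_measurable.
Qed.

Lemma continuous_bounded_on_compact (K : set (R * R)) (f : R * R -> R) :
  compact K -> continuous f -> exists2 C, 0 <= C & forall x, K x -> `|f x| <= C.
Proof.
move=> cK cf.
have /compact_bounded[M [_ HM]] : compact (f @` K).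
  by apply: continuous_compact => //; exact: continuous_subspaceT.
exists (`|M| + 1) => [|x Kx]; first by have := normr_ge0 M; lra.
by apply: HM; [have := ler_norm M; lra|exists x].
Qed.

Lemma bounded_integrable_plane (D : set (R * R)) (f : R * R -> R) (C : R) :
  measurable (D : set (borel_plane R)) -> (mu2 D < +oo)%E ->
  measurable_fun (D : set (borel_plane R)) f ->
  (forall x, D x -> `|f x| <= C) -> mu2.-integrable D (EFin \o f).
Proof.
move=> mD fD mf fC; apply: measurable_bounded_integrable => //.
exists `|C|; split; first exact: normr_real.
by move=> y Cy x Dx; apply: (le_trans (fC x Dx)); apply: (le_trans (ler_norm C)); exact: ltW.
Qed.

Lemma continuous_integrable_compact (K : set (R * R)) (f : R * R -> R) :
  compact K -> continuous f -> mu2.-integrable K (EFin \o f).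
Proof.
move=> cK cf; have [C _ fC] := continuous_bounded_on_compact cK cf.
apply: bounded_integrable_plane fC; first exact: compact_measurable_plane.
  exact: finite_measure_compact.
by apply: continuous_measurable_plane => //; exact: compact_measurable_plane.
Qed.

Lemma compactly_supportedE (f : R * R -> R) : compactly_supported f ->
  exists2 M, 0 < M & f = f \_ (box M).
Proof.
move=> [M M0 fM]; exists M => //; apply/funext => x; rewrite patchE.
case: ifPn => // /negP xM; apply: fM; rewrite !ltNge.
case: (boolP (`|x.1| <= M)) => [h1|_]; last by left.
case: (boolP (`|x.2| <= M)) => [h2|_]; last by right.
by exfalso; apply: xM; rewrite inE; exact/boxP.
Qed.

Lemma compactly_supported_bounded (f : R * R -> R) :
  continuous f -> compactly_supported f -> exists2 C, 0 <= C & forall x, `|f x| <= C.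
Proof.
move=> cf [M M0 fM]; have [C C0 fC] := continuous_bounded_on_compact (@box_compact M) cf.
exists C => // x; have [h1|h1] := leP `|x.1| M; last by rewrite fM ?normr0 //; left.
have [h2|h2] := leP `|x.2| M; last by rewrite fM ?normr0 //; right.
by apply: fC; exact/boxP.
Qed.

Lemma compactly_supported_integrable (f : R * R -> R) :
  continuous f -> compactly_supported f -> mu2.-integrable setT (EFin \o f).
Proof.
move=> cf /compactly_supportedE[M _ ->]; rewrite -restrict_EFin.
apply/integrable_restrict => //; first exact: box_measurable.
rewrite setTI; apply: continuous_integrable_compact => //.
exact: box_compact.
Qed.

End PlaneMeasure.

(** * Integration by parts and test functions *)

Section IntegrationByParts.
Variable R : realType.
Local Notation mu := (@lebesgue_measure R).
Local Notation mu2 := (@lebesgue2 R).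

Lemma integral_derive (f g : R -> R) (a b : R) : a <= b ->
  (forall x : R, is_derive x 1 f (g x)) -> continuous g ->
  (\int[mu]_(x in `[a, b]) (g x)%:E)%E = (f b - f a)%:E.
Proof.
rewrite le_eqVlt => /orP[/eqP<-|ab] fg cg.
  by rewrite set_itv1 integral_set1 subrr.
have cf := is_derive_continuous fg.
rewrite EFinB; apply: continuous_FTC2 => //.
- exact: continuous_subspaceT.
- split; first by move=> x _; exact: (@ex_derive _ _ _ _ _ _ _ (fg x)).
  + by apply: cvg_at_right_filter; exact: cf.
  + by apply: cvg_at_left_filter; exact: cf.
- by move=> x _; rewrite derive1E; exact: (@derive_val _ _ _ _ _ _ _ (fg x)).
Qed.

Lemma is_derive_near0 (V : normedModType R) (f : V -> R) (x v : V) (a : R) :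
  (\near x, f x = 0) -> is_derive x v f a -> a = 0.
Proof.
move=> f0 fa.
have h : is_derive x v f 0 by apply: near_eq_is_derive (is_derive_cst 0 x v); near=> y; apply/esym; near: y.
by rewrite -(@derive_val _ _ _ _ _ _ _ fa) (@derive_val _ _ _ _ _ _ _ h).
Unshelve. all: by end_near.
Qed.

Lemma integral_derive_supported (f g : R -> R) (M : R) :
  (forall x : R, is_derive x 1 f (g x)) -> continuous g ->
  (forall x, M < `|x| -> f x = 0) -> (\int[mu]_x (g x)%:E)%E = 0%E.
Proof.
move=> fg cg f0.
have g0 x : M < `|x| -> g x = 0.
  move=> Mx; apply: (is_derive_near0 _ (fg x)).
  near=> y; apply: f0; near: y; apply: (cvgr_gt `|x|) => //.
  by apply: cvg_norm; exact: cvg_id.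
pose N : R := `|M| + 1.
have MN : M < N by rewrite /N; have := ler_norm M; lra.
have N0 : 0 <= N by rewrite /N; have := normr_ge0 M; lra.
transitivity (\int[mu]_(x in `[(- N)%R, N]) (g x)%:E)%E.
  rewrite [RHS]integral_mkcond; apply: eq_integral => x _; rewrite patchE.
  case: ifPn => // /negP xN; rewrite g0 // ltNge; apply/negP => xM; apply: xN.
  by rewrite inE /= in_itv /= -ler_norml (le_trans xM) // ltW.
rewrite (integral_derive _ fg cg); last by rewrite (le_trans _ N0) // oppr_le0.
by rewrite !f0 ?subrr // ?normrN (lt_le_trans MN) // ler_norm.
Unshelve. all: by end_near.
Qed.

Lemma continuous_section1 (f : R * R -> R) (x : R) :
  continuous f -> continuous (fun y => f (x, y)).
Proof.
move=> cf y; apply: (@continuous_comp _ _ _ (fun y : R => (x, y)) f); last exact: cf.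
exact: (@cvg_pair _ _ _ (nbhs y) (nbhs x) (nbhs y) _ _ _ (fun=> x) id (cvg_cst _) cvg_id).
Qed.

Lemma continuous_section2 (f : R * R -> R) (y : R) :
  continuous f -> continuous (fun x => f (x, y)).
Proof.
move=> cf x; apply: (@continuous_comp _ _ _ (fun x : R => (x, y)) f); last exact: cf.
exact: (@cvg_pair _ _ _ (nbhs x) (nbhs x) (nbhs y) _ _ _ id (fun=> y) cvg_id (cvg_cst _)).
Qed.

Lemma is_derive_section1P (f : R * R -> R) (x y a : R) :
  is_derive (x, y) (basis_vec R ord0) f a <-> is_derive x 1 (fun x => f (x, y)) a.
Proof.
have E : (fun t : R => f (t *: basis_vec R ord0 + (x, y))) =
         (fun t : R => (fun x => f (x, y)) (t *: (1 : R) + x)).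
  apply/funext => t; congr f; rewrite /basis_vec eqxx.
  by congr pair; rewrite /= /GRing.scale/= ?mulr0 ?add0r.
by split=> /is_derive_line h; apply/is_derive_line; move: h; rewrite E.
Qed.

Lemma is_derive_section2P (f : R * R -> R) (x y a : R) :
  is_derive (x, y) (basis_vec R ord_max) f a <-> is_derive y 1 (fun y => f (x, y)) a.
Proof.
have E : (fun t : R => f (t *: basis_vec R ord_max + (x, y))) =
         (fun t : R => (fun y => f (x, y)) (t *: (1 : R) + y)).
  apply/funext => t; congr f; rewrite /basis_vec.
  by congr pair; rewrite /= /GRing.scale/= ?mulr0 ?add0r.
by split=> /is_derive_line h; apply/is_derive_line; move: h; rewrite E.
Qed.

Lemma ord2_cases (i : 'I_2) : i = ord0 \/ i = ord_max.
Proof. by case: i => -[|[|//]] h; [left|right]; exact/val_inj. Qed.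

Lemma compactly_supported_derive (f g : R * R -> R) (i : 'I_2) :
  (forall z : R * R, is_derive z (basis_vec R i) f (g z)) ->
  compactly_supported f -> compactly_supported g.
Proof.
move=> fg [M M0 f0]; exists M => // x xM; apply: (is_derive_near0 _ (fg x)).
case: xM => xM; near=> y; apply: f0; [left|right]; near: y;
  apply: (cvgr_gt _ _ _ xM); apply: cvg_norm; [exact: cvg_fst|exact: cvg_snd].
Unshelve. all: by end_near.
Qed.

(** Fubini, integrating first in the direction of the derivative: each line integral is a difference
    of values at two points outside the support. *)
Lemma integral_partial_eq0 (f g : R * R -> R) (i : 'I_2) :
  (forall z : R * R, is_derive z (basis_vec R i) f (g z)) -> continuous g ->
  compactly_supported f -> (\int[mu2]_x (g x)%:E)%E = 0%E.
Proof.
move=> fg cg sf; have sg := compactly_supported_derive fg sf.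
have ig := compactly_supported_integrable cg sg.
have [M M0 f0] := sf.
case: (ord2_cases i) fg => -> fg.
- rewrite -(integral21_prod_meas1 ig) /fubini_G /=.
  apply: integral0_eq => y _.
  apply: (@integral_derive_supported (fun x => f (x, y)) (fun x => g (x, y)) M).
  + by move=> x; exact/is_derive_section1P.
  + exact: continuous_section2.
  + by move=> x xM; apply: f0; left.
- rewrite -(integral12_prod_meas1 ig) /fubini_F /=.
  apply: integral0_eq => x _.
  apply: (@integral_derive_supported (fun y => f (x, y)) (fun y => g (x, y)) M).
  + by move=> y; exact/is_derive_section2P.
  + exact: continuous_section1.
  + by move=> y yM; apply: f0; right.
Qed.

Lemma compactly_supportedMr (f g : R * R -> R) :
  compactly_supported g -> compactly_supported (fun x => f x * g x).
Proof. by move=> [M M0 g0]; exists M => // x /g0 ->; rewrite mulr0. Qed.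

Lemma compactly_supportedMl (f g : R * R -> R) :
  compactly_supported f -> compactly_supported (fun x => f x * g x).
Proof. by move=> [M M0 g0]; exists M => // x /g0 ->; rewrite mul0r. Qed.

Lemma continuousM2 (f g : R * R -> R) :
  continuous f -> continuous g -> continuous (fun x => f x * g x).
Proof. by move=> cf cg x; apply: cvgM; [exact: cf|exact: cg]. Qed.

Lemma continuousD2 (f g : R * R -> R) :
  continuous f -> continuous g -> continuous (fun x => f x + g x).
Proof. by move=> cf cg x; apply: cvgD; [exact: cf|exact: cg]. Qed.

(** The derivative of f g has integral 0, because f g inherits the compact support of g. *)
Lemma integration_by_parts_plane (f f' g g' : R * R -> R) (i : 'I_2) :
  (forall z : R * R, is_derive z (basis_vec R i) f (f' z)) ->
  (forall z : R * R, is_derive z (basis_vec R i) g (g' z)) ->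
  continuous f -> continuous f' -> continuous g -> continuous g' -> compactly_supported g ->
  \int[mu2]_x (f x * g' x) = - \int[mu2]_x (f' x * g x).
Proof.
move=> df dg cf cf' cg cg' sg; have sg' := compactly_supported_derive dg sg.
have i1 : mu2.-integrable setT (EFin \o (fun x => f x * g' x)).
  apply: compactly_supported_integrable; first exact: continuousM2.
  exact: compactly_supportedMr.
have i2 : mu2.-integrable setT (EFin \o (fun x => f' x * g x)).
  apply: compactly_supported_integrable; first exact: continuousM2.
  exact: compactly_supportedMr.
apply/eqP; rewrite -addr_eq0 -RintegralD //.
rewrite /Rintegral (_ : integral _ _ _ = 0%E) //.
apply: (@integral_partial_eq0 (fun x => f x * g x) _ i).
- by move=> x; rewrite (mulrC (f' x)); exact: is_deriveM.
- by apply: continuousD2; exact: continuousM2.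
- exact: compactly_supportedMr.
Qed.

Lemma enorm_lt1 (x : R * R) : unit_disc x <-> x.1 ^+ 2 + x.2 ^+ 2 < 1.
Proof. by rewrite /unit_disc /= /enorm -[X in _ < X]sqrtr1 ltr_sqrt. Qed.

Lemma continuous_normsq : continuous (fun x : R * R => x.1 ^+ 2 + x.2 ^+ 2).
Proof.
apply: continuousD2 => x; rewrite /GRing.exp /=; apply: cvgM;
  by [exact: cvg_fst|exact: cvg_snd].
Qed.

Lemma unit_disc_open : open (@unit_disc R).
Proof.
rewrite (_ : @unit_disc R = (fun x : R * R => x.1 ^+ 2 + x.2 ^+ 2) @^-1` [set t | t < 1]).
  by apply: open_comp; [move=> x _; exact: continuous_normsq|exact: open_lt].
by apply/seteqP; split => x /enorm_lt1.
Qed.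

Lemma unit_disc_measurable : measurable (@unit_disc R : set (borel_plane R)).
Proof. exact: open_measurable_plane unit_disc_open. Qed.

Lemma unit_disc_box : @unit_disc R `<=` box 1.
Proof.
move=> x /enorm_lt1 xD; apply/boxP.
by split; rewrite -(@ler_pXn2r _ 2) ?nnegrE // -normrX ger0_norm ?sqr_ge0 // expr1n;
  have := sqr_ge0 x.1; have := sqr_ge0 x.2; lra.
Qed.

Lemma unit_disc_ltoo : (mu2 (@unit_disc R) < +oo)%E.
Proof.
apply: le_lt_trans (box_ltoo 1); apply: le_measure; rewrite ?inE.
- exact: unit_disc_measurable.
- exact: box_measurable.
- exact: unit_disc_box.
Qed.

Lemma continuous_integrable_disc (f : R * R -> R) :
  continuous f -> mu2.-integrable (@unit_disc R) (EFin \o f).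
Proof.
move=> cf; apply: (@integrableS _ _ _ mu2 (box 1)) => //.
- exact: box_measurable.
- exact: unit_disc_measurable.
- exact: unit_disc_box.
- by apply: continuous_integrable_compact => //; exact: box_compact.
Qed.

Section TestFunctions.
Variable Omega : set (R * R).
Implicit Types phi : R * R -> R.

Lemma test_function_out phi x : test_function Omega phi -> ~ Omega x -> phi x = 0.
Proof.
move=> [_ _ sO] nx; apply/eqP/negPn/negP => px; apply: nx; apply: sO.
exact: subset_closure.
Qed.

Lemma test_function_compactly_supported phi :
  test_function Omega phi -> compactly_supported phi.
Proof.
move=> [_ /compact_sub_box[M M0 KM] _]; exists M => // x xM.
apply/eqP/negPn/negP => px.
have /boxP[h1 h2] : box M x by apply: KM; exact: subset_closure.
by case: xM; rewrite ltNge ?h1 ?h2.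
Qed.

Lemma test_functionS phi psi : test_function Omega phi -> smooth psi ->
  [set x | psi x != 0] `<=` support_closure phi -> test_function Omega psi.
Proof.
move=> [_ cK KO] Spsi sub.
have KK : support_closure psi `<=` support_closure phi.
  rewrite [X in _ `<=` X]((closure_id _).1 (@closed_closure _ _)).
  exact: closure_subset.
split=> //; last exact: subset_trans KO.
by apply: (subclosed_compact _ cK) => //; exact: closed_closure.
Qed.

Lemma smooth_partial phi i : smooth phi -> smooth (partials [:: i] phi).
Proof.
move=> Sphi s; have := Sphi (rcons s i).
by rewrite /partials -cats1 foldr_cat.
Qed.

Lemma smooth_is_derive phi i (x : R * R) : smooth phi ->
  is_derive x (basis_vec R i) phi (partials [:: i] phi x).
Proof. by move=> Sphi; apply: derivableP; have [_] := Sphi [::]; exact. Qed.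

Lemma smooth_continuous phi : smooth phi -> continuous phi.
Proof. by move=> Sphi; have [] := Sphi [::]. Qed.

Lemma test_function_partial phi i :
  test_function Omega phi -> test_function Omega (partials [:: i] phi).
Proof.
move=> /[dup] Tphi [Sphi _ _]; apply: (test_functionS Tphi); first exact: smooth_partial.
move=> x /= dx; apply: contrapT => nx; move/eqP: dx; apply.
apply: (is_derive_near0 _ (smooth_is_derive i x Sphi)).
have oC : open (~` support_closure phi) by apply: closed_openC; exact: closed_closure.
have := open_nbhs_nbhs (conj oC nx); apply: filterS => y ny.
by apply/eqP/negPn/negP => py; apply: ny; exact: subset_closure.
Qed.

Lemma test_function_comp (F : R -> R) phi : smooth1 F -> F 0 = 0 ->
  test_function Omega phi -> test_function Omega (F \o phi).
Proof.
move=> SF F0 /[dup] Tphi [Sphi _ _]; apply: (test_functionS Tphi).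
  by apply/smoothP => k; apply: Cn_comp; [exact: SF|move/smoothP: Sphi; exact].
move=> x /= Fx; apply: subset_closure => /=; apply: contraNneq Fx => ->.
by rewrite F0.
Qed.

Lemma Rintegral_test phi (u : R * R -> R) : test_function Omega phi ->
  \int[mu2]_(x in Omega) (u x * phi x) = \int[mu2]_x (u x * phi x).
Proof.
move=> Tphi; rewrite Rintegral_mkcond; apply: eq_Rintegral => x _; rewrite patchE.
case: ifPn => // /negP nx; rewrite (test_function_out Tphi) ?mulr0 //.
by move=> Ox; apply: nx; rewrite inE.
Qed.

End TestFunctions.

(** Test functions vanish off the disc, so both integrals extend to the plane, where no boundary
    term occurs. *)
Lemma classical_weak_derivative (f g : R * R -> R) (i : 'I_2) phi :
  (forall z : R * R, is_derive z (basis_vec R i) f (g z)) ->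
  continuous f -> continuous g -> test_function (@unit_disc R) phi ->
  \int[mu2]_(x in @unit_disc R) (f x * partials [:: i] phi x) =
  - \int[mu2]_(x in @unit_disc R) (g x * phi x).
Proof.
move=> fg cf cg /[dup] Tphi [Sphi _ _].
rewrite !(Rintegral_test _ Tphi) (Rintegral_test _ (test_function_partial i Tphi)).
apply: (@integration_by_parts_plane f g phi (partials [:: i] phi) i) => //.
- by move=> z; exact: smooth_is_derive.
- exact: smooth_continuous.
- exact/smooth_continuous/smooth_partial.
- exact: test_function_compactly_supported Tphi.
Qed.

End IntegrationByParts.

(** * The sharp Sobolev inequality by Knothe transport *)

Section SharpSobolev.
Variable R : realType.
Local Notation mu := (@lebesgue_measure R).
Local Notation mu2 := (@lebesgue2 R).

Lemma centered_le (x y : R) : 0 <= x <= 2 * y -> - y <= x - y <= y.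
Proof. by move=> /andP[? ?]; apply/andP; split; lra. Qed.

(* The area of the part of the unit disc to the left of the abscissa - cos t. *)
Definition cap_area (t : R) : R := t - sin t * cos t.

Lemma is_derive_cap_area (t : R) : is_derive t 1 cap_area (2 * sin t ^+ 2).
Proof.
apply: is_derive_eq; rewrite /GRing.scale/=.
have := cos2Dsin2 t; lra.
Qed.

Lemma cap_area_lt (s t : R) : 0 <= s -> t <= pi -> s < t -> cap_area s < cap_area t.
Proof.
move=> s0 tpi st.
have [c] := @MVT R cap_area _ s t st (fun x _ => is_derive_cap_area x)
  (continuous_subspaceT (is_derive_continuous is_derive_cap_area)).
rewrite in_itv /= => /andP[sc ct] E; rewrite -subr_gt0 E mulr_gt0 ?subr_gt0 //.
rewrite mulr_gt0 // exprn_gt0 // sin_gt0_pi // (le_lt_trans s0) //=.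
exact: lt_le_trans tpi.
Qed.

Lemma cap_area0 : cap_area 0 = 0.
Proof. by rewrite /cap_area sin0 mul0r subr0. Qed.

Lemma cap_area_pi : cap_area pi = pi.
Proof. by rewrite /cap_area sinpi mul0r subr0. Qed.

(** [Th] inverts [cap_area], by the intermediate value theorem and strict monotonicity. The end
    points are excluded because the derivative 2 sin^2 vanishes there. *)
Lemma exists_cap_angle : exists Th : R -> R, forall u, 0 < u < pi ->
  [/\ 0 < Th u < pi, cap_area (Th u) = u & is_derive u 1 Th (2 * sin (Th u) ^+ 2)^-1].
Proof.
have ex u : exists t, 0 <= u <= pi -> 0 <= t <= pi /\ cap_area t = u.
  have [/andP[u0 u1]|] := boolP (0 <= u <= pi); last by exists 0.
  have [||t] := @IVT R cap_area 0 pi u (pi_ge0 R).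
  - by apply: continuous_subspaceT; apply: is_derive_continuous; exact: is_derive_cap_area.
  - by rewrite cap_area0 cap_area_pi ge_min u0 /= le_max u1 orbT.
  - by rewrite in_itv /= => t01 tE; exists t.
have [Th ThP] := choice ex.
have inj s t : 0 <= s <= pi -> 0 <= t <= pi -> cap_area s = cap_area t -> s = t.
  move=> /andP[s0 s1] /andP[t0 t1] E; have [st|ts|//] := ltgtP s t.
    by have := cap_area_lt s0 t1 st; rewrite E ltxx.
  by have := cap_area_lt t0 s1 ts; rewrite E ltxx.
exists Th => u /andP[u0 u1].
have [/andP[t0 t1] tE] : 0 <= Th u <= pi /\ cap_area (Th u) = u.
  by apply: ThP; rewrite (ltW u0) (ltW u1).
have t0' : 0 < Th u.
  by rewrite lt_neqAle t0 andbT; apply: contraTneq u0 => E; rewrite -tE -E cap_area0 ltxx.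
have t1' : Th u < pi.
  by rewrite lt_neqAle t1 andbT; apply: contraTneq u1 => E; rewrite -tE E cap_area_pi ltxx.
split; [by rewrite t0' t1'|by []|].
rewrite -{1}tE; apply: (@is_derive_inverse _ cap_area) => //.
- near=> t.
  have s0 : 0 < t by near: t; exact: lt_nbhsr.
  have s1 : t < pi by near: t; exact: lt_nbhsl.
  have c0 : 0 <= cap_area t by rewrite -cap_area0; apply/ltW/cap_area_lt => //; exact: ltW.
  have c1 : cap_area t <= pi by rewrite -cap_area_pi; apply/ltW/cap_area_lt => //; exact: ltW.
  have [h1 h2] : 0 <= Th (cap_area t) <= pi /\ cap_area (Th (cap_area t)) = cap_area t.
    by apply: ThP; rewrite c0 c1.
  by apply: inj; rewrite // (ltW s0) (ltW s1).
- by near=> t; apply: is_derive_continuous; exact: is_derive_cap_area.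
- exact: is_derive_cap_area.
- by rewrite mulf_neq0 // expf_neq0 // gt_eqF // sin_gt0_pi // t0'.
Unshelve. all: by end_near.
Qed.

(** Serves to obtain joint continuity of the partial primitive of g^2 in y, which is constructed one
    section at a time. *)
Lemma lipschitz_section_continuous (W : R -> R -> R) (A B : R) :
  (forall x x' y, `|W x y - W x' y| <= A * `|x - x'|) ->
  (forall x y y', `|W x y - W x y'| <= B * `|y - y'|) ->
  continuous (fun z : R * R => W z.1 z.2).
Proof.
move=> WA WB z; apply/cvgrPdist_le => e e0.
have A0 : 0 <= A.
  have := WA 1 0 0; rewrite subr0 normr1 mulr1; apply: le_trans; exact: normr_ge0.
have B0 : 0 <= B.
  have := WB 0 1 0; rewrite subr0 normr1 mulr1; apply: le_trans; exact: normr_ge0.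
have K0 : 0 < 2 * (A + B + 1) by lra.
have d0 : 0 < e / (2 * (A + B + 1)) by rewrite divr_gt0.
have c1 : (fun t : R * R => t.1) @ z --> z.1 by exact: cvg_fst.
have c2 : (fun t : R * R => t.2) @ z --> z.2 by exact: cvg_snd.
have n1 : \forall t \near z, `|z.1 - t.1| <= e / (2 * (A + B + 1)).
  by move/cvgrPdist_le : c1; apply.
have n2 : \forall t \near z, `|z.2 - t.2| <= e / (2 * (A + B + 1)).
  by move/cvgrPdist_le : c2; apply.
near=> t.
have h1 : `|z.1 - t.1| <= e / (2 * (A + B + 1)) by near: t; exact: n1.
have h2 : `|z.2 - t.2| <= e / (2 * (A + B + 1)) by near: t; exact: n2.
rewrite (_ : _ - _ = (W z.1 z.2 - W t.1 z.2) + (W t.1 z.2 - W t.1 t.2)); last by ring.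
apply: (le_trans (ler_normD _ _)).
have k1 := le_trans (WA z.1 t.1 z.2) (ler_wpM2l A0 h1).
have k2 := le_trans (WB t.1 z.2 t.2) (ler_wpM2l B0 h2).
apply: le_trans (lerD k1 k2) _; rewrite -mulrDl mulrA ler_pdivrMr //.
by rewrite mulrC ler_pM2l //; lra.
Unshelve. all: by end_near.
Qed.

Lemma integral_derive_line (F f : R -> R) (M : R) : 0 <= M ->
  (forall x : R, is_derive x 1 F (f x)) -> continuous f ->
  (forall x, M < `|x| -> f x = 0) ->
  (\int[mu]_x (f x)%:E)%E = (F M - F (- M))%:E.
Proof.
move=> M0 Ff cf f0; rewrite -(integral_derive _ Ff cf); last by lra.
rewrite [RHS]integral_mkcond; apply: eq_integral => x _; rewrite patchE.
case: ifPn => // /negP xN; rewrite f0 // ltNge; apply/negP => xM; apply: xN.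
by rewrite inE /= in_itv /= -ler_norml.
Qed.

Lemma cauchy_schwarz_plane (a b x y : R) : a ^+ 2 + b ^+ 2 <= 1 ->
  - enorm (x, y) <= a * x + b * y.
Proof.
move=> ab; rewrite lerNl; apply: le_trans (ler_norm _) _.
rewrite normrN -sqrtr_sqr /enorm /= ler_sqrt; last by rewrite addr_ge0 ?sqr_ge0.
apply: (@le_trans _ _ ((a ^+ 2 + b ^+ 2) * (x ^+ 2 + y ^+ 2))).
  by rewrite -subr_ge0 (_ : _ - _ = (a * y - b * x) ^+ 2) ?sqr_ge0 //; ring.
by rewrite ler_piMl // addr_ge0 ?sqr_ge0.
Qed.

(** The arithmetic-geometric inequality for the diagonal entries a, b of DT, whose product is
    bounded below by (k c)^2. *)
Lemma amgm_transport (a b c k : R) : 0 <= a -> 0 <= b -> 0 <= k ->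
  (k * c) ^+ 2 <= a * b -> 2 * k * c <= a + b.
Proof.
move=> a0 b0 k0 h; have [c0|c0] := leP 0 (k * c); last by have := addr_ge0 a0 b0; lra.
rewrite leNgt; apply/negP => hlt.
have h2 : 0 < (2 * k * c - (a + b)) * (2 * k * c + (a + b)).
  by apply: mulr_gt0; [rewrite subr_gt0|have := addr_ge0 a0 b0; lra].
by have := sqr_ge0 (a - b); nra.
Qed.

(** The limit k -> 1, e -> 0 of the regularized inequality, with both parameters chosen explicitly
    from the gap 2 pi - N. *)
Lemma regularization_limit (A N : R) : 0 <= A ->
  (forall k e, 0 < k < 1 -> 0 < e -> 2 * k * (pi - e * (2 * A)) <= N) ->
  2 * pi <= N.
Proof.
move=> A0 key.
rewrite leNgt; apply/negP => Npi.
have pp := pi_gt0 R.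
pose d := 2 * pi - N.
have d0 : 0 < d by rewrite /d; lra.
pose c := Num.min 2^-1 (d / (8 * pi)).
have c0 : 0 < c by rewrite lt_min invr_gt0 ltr0n divr_gt0 // mulr_gt0.
have c1 : c <= 2^-1 by rewrite ge_min lexx.
have cd : c * pi <= d / 8.
  have : c <= d / (8 * pi) by rewrite ge_min lexx orbT.
  move=> /(ler_wpM2r (ltW pp)) /le_trans; apply.
  by rewrite -[8 * pi]mulrC invfM mulrA mulrAC divfK ?lexx // gt_eqF.
have e0 : 0 < d / (8 * (A + 1)) by rewrite divr_gt0 // mulr_gt0 //; lra.
have k01 : 0 < 1 - c < 1 by apply/andP; split; lra.
have := key _ _ k01 e0; set x := _ * (2 * A).
have x0 : 0 <= x by rewrite mulr_ge0 ?(ltW e0) // mulr_ge0.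
have x1 : x <= d / 4.
  rewrite /x mulrAC ler_pdivrMr; last by lra.
  by rewrite (_ : d / 4 * _ = d * (2 * (A + 1))) ?ler_wpM2l ?(ltW d0) //; [lra|field].
have cx : 0 <= c * x by rewrite mulr_ge0 // ltW.
have -> : 2 * (1 - c) * (pi - x) = 2 * pi - 2 * (c * pi) - 2 * x + 2 * (c * x) by ring.
by move=> H; rewrite /d in d0 cd x1 *; lra.
Qed.

(* Knothe's map T transports g^2 to the unit disc: T1 depends on x only, T2 is increasing in y,
   and det DT = g^2, so div T >= 2 g by the arithmetic-geometric inequality, while |T| <= 1.
   Hence 2 int g^2 <= int g div T = - int grad g . T <= int |grad g|.
   The parameters k < 1 and e > 0 keep T differentiable where g vanishes. *)
Lemma sobolev_normalized (g g1 g2 : R * R -> R) :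
  (forall z : R * R, is_derive z (basis_vec R ord0) g (g1 z)) ->
  (forall z : R * R, is_derive z (basis_vec R ord_max) g (g2 z)) ->
  continuous g -> continuous g1 -> continuous g2 -> compactly_supported g ->
  (forall z, 0 <= g z) -> \int[mu2]_z (g z ^+ 2) = pi ->
  2 * pi <= \int[mu2]_z enorm (g1 z, g2 z).
Proof.
move=> dg1 dg2 cg cg1 cg2 sg g0 gpi.
have sg1 := compactly_supported_derive dg1 sg.
have sg2 := compactly_supported_derive dg2 sg.
have [C C0 gC] := compactly_supported_bounded cg sg.
have [C1 C10 gC1] := compactly_supported_bounded cg1 sg1.
have [M M0 gM] := sg.
pose q x y := g (x, y) ^+ 2.
have cq x : continuous (q x).
  rewrite (_ : q x = fun y => g (x, y) * g (x, y)) //.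
  by move=> y; have h := @continuous_section1 R g x cg; apply: cvgM; exact: h.
have q0 x y : 0 <= q x y by exact: sqr_ge0.
have qM1 x y : M < `|x| -> q x y = 0 by move=> h; rewrite /q gM ?expr0n //; left.
have qM2 x y : M < `|y| -> q x y = 0 by move=> h; rewrite /q gM ?expr0n //; right.
have qNM x y : y <= - (M + 1) -> q x y = 0.
  by move=> h; rewrite qM2 // ler0_norm; lra.
(* [W x y] is the mass of g^2 on the vertical line through x below the height y. Its total [p] is
   the marginal density, and [P] the distribution function of [p]. *)
have /choice[W WP] : forall x, exists W : R -> R,
    (forall y : R, is_derive y 1 W (q x y)) /\ (forall y, y <= - (M + 1) -> W y = 0).
  by move=> x; have [F F1 F2] := exists_primitive (cq x) (qNM x); exists F.
have dW x (y : R) : is_derive y 1 (W x) (q x y) by case: (WP x).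
have W0 x y : y <= - (M + 1) -> W x y = 0 by case: (WP x) => _; apply.
have N0 : 0 <= M + 1 by lra.
have Wr x y : M + 1 <= y -> W x y = W x (M + 1).
  move=> x1; have [c /andP[c1 _]] := derive_mean_value x1 (dW x).
  rewrite qM2 ?ger0_norm; [|lra|lra].
  by rewrite mul0r => /eqP; rewrite subr_eq0 => /eqP.
have qlip x x' y : `|q x y - q x' y| <= (2 * C * C1) * `|x - x'|.
  apply: (@derive_bounded_lipschitz _ (fun x => q x y) (fun x => 2 * g (x, y) * g1 (x, y))).
    move=> t; have h := (is_derive_section1P g t y _).1 (dg1 _).
    by apply: (is_derive_eq (is_deriveM h h)); rewrite /GRing.scale/=; ring.
  move=> t; rewrite !normrM (ger0_norm (ler0n R 2)) -!mulrA ler_pM2l //.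
  by apply: ler_pM.
have Wlip1 x x' y : `|W x y - W x' y| <= (2 * C * C1 * (2 * (M + 1))) * `|x - x'|.
  (* Outside the strip |y| <= M + 1 the function [W x] is constant in y, which reduces the estimate
     to the strip. *)
  wlog yM : y / `|y| <= M + 1 => [hw|].
    have [|h] := leP `|y| (M + 1); first exact: hw.
    have : `|(M + 1)| <= M + 1 by rewrite ger0_norm.
    have [y0|y0] := leP 0 y.
      move/hw; rewrite -(Wr x y) ?(Wr x') -?(Wr x' y) //; rewrite ger0_norm // in h; exact: ltW.
    move=> _; rewrite !W0 ?subrr ?normr0; last 2 first.
    - by rewrite ltr0_norm // in h; lra.
    - by rewrite ltr0_norm // in h; lra.
    by rewrite !mulr_ge0.
  have dD (t : R) : is_derive t 1 (fun y => W x y - W x' y) (q x t - q x' t).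
    by have := dW x t; have := dW x' t => ? ?; exact: is_deriveB.
  have h := derive_bounded_lipschitz dD (fun t => qlip x x' t) y (- (M + 1)).
  have WN z : W z (- (M + 1)) = 0 by rewrite W0.
  rewrite !WN subrr subr0 in h.
  apply: (le_trans h); rewrite mulrAC ler_wpM2r // ler_wpM2l ?mulr_ge0 //.
  by apply: le_trans (ler_normB _ _) _; rewrite normrN (ger0_norm N0); lra.
have Wlip2 x y y' : `|W x y - W x y'| <= C ^+ 2 * `|y - y'|.
  apply: (@derive_bounded_lipschitz _ _ (q x)) => // t.
  by rewrite /q normrX lerXn2r ?nnegrE.
have cW := lipschitz_section_continuous Wlip1 Wlip2.
have Wnd x := derive_ge0_nondecreasing (dW x) (q0 x).
pose p x := W x (M + 1).
have W0p x y : 0 <= W x y <= p x.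
  apply/andP; split.
    have [h|h] := leP y (- (M + 1)); first by rewrite W0.
    by rewrite -(W0 x (- (M + 1))) // Wnd // ltW.
  have [h|h] := leP (M + 1) y; first by rewrite /p Wr.
  by apply: Wnd; exact: ltW.
have p0 x : 0 <= p x by case/andP: (W0p x (M + 1)).
have cp : continuous p.
  move=> x; exact: (@continuous_section2 R (fun z : R * R => W z.1 z.2) (M + 1) cW x).
have pM x : M < `|x| -> p x = 0.
  move=> h; have h' : - (M + 1) <= M + 1 by lra.
  have [c _] := derive_mean_value h' (dW x).
  by rewrite qM1 // mul0r (W0 x (- (M + 1))) // subr0.
have [P dP P0] : exists2 P : R -> R, (forall x : R, is_derive x 1 P (p x)) &
    (forall x, x <= - (M + 1) -> P x = 0).
  by apply: exists_primitive => // x h; apply: pM; rewrite ler0_norm; lra.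
have Pnd := derive_ge0_nondecreasing dP p0.
have inner x : (\int[mu]_y (q x y)%:E)%E = (p x)%:E.
  rewrite (@integral_derive_line (W x) _ (M + 1)) //; first by rewrite (W0 x (- _)) // subr0.
  by move=> y h; apply: qM2; lra.
have Ppi : P (M + 1) = pi.
  have ig : mu2.-integrable setT (EFin \o (fun z => g z ^+ 2)).
    apply: compactly_supported_integrable; first exact: continuousM2.
    exact: compactly_supportedMr.
  rewrite -gpi /Rintegral -(integral12_prod_meas1 ig) /fubini_F /=.
  under eq_integral => x _ do rewrite (inner x).
  rewrite (@integral_derive_line P _ (M + 1)) ?(P0 (- (M + 1))) ?subr0 //.
  by move=> x h; apply: pM; lra.
have P0pi x : 0 <= P x <= pi.
  apply/andP; split.
    have [h|h] := leP x (- (M + 1)); first by rewrite P0.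
    by rewrite -(P0 (- (M + 1))) // Pnd // ltW.
  rewrite -Ppi; have [h|h] := leP (M + 1) x; last by apply: Pnd; exact: ltW.
  have [c /andP[c1 _]] := derive_mean_value h dP.
  rewrite pM ?ger0_norm; [|lra|lra].
  by rewrite mul0r => /eqP; rewrite subr_eq0 => /eqP ->.
have key k e : 0 < k < 1 -> 0 < e ->
    2 * k * (pi - e * (2 * (M + 1))) <= \int[mu2]_z enorm (g1 z, g2 z).
  move=> /andP[k0 k1] e0; have [Th ThP] := exists_cap_angle.
  (* [P] ranges over [0, pi]; this affine contraction moves it into the open interval ]0, pi[, where
     the cap angle is differentiable. *)
  pose u x := pi * (1 - k) / 2 + k * P x.
  have upi x : 0 < u x < pi.
    have /andP[a1 a2] := P0pi x; have pp := pi_gt0 R.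
    have b1 : 0 < pi * (1 - k) by rewrite mulr_gt0 // subr_gt0.
    have b2 := mulr_ge0 (ltW k0) a1; have b3 := ler_wpM2l (ltW k0) a2.
    by rewrite /u; apply/andP; split; lra.
  have du (x : R) : is_derive x 1 u (k * p x).
    have h : is_derive x 1 (fun x : R => k * P x) (k * p x).
      by have := dP x => ?; exact: is_deriveZ.
    by apply: (is_derive_eq (is_deriveD (is_derive_cst (pi * (1 - k) / 2) x 1) h)); rewrite add0r.
  pose t x := Th (u x).
  have dt (x : R) : is_derive x 1 t ((2 * sin (t x) ^+ 2)^-1 * (k * p x)).
    by have [_ _ h] := ThP _ (upi x); have h' := du x; exact: is_derive1_comp.
  (* [l x] is the half-height of the unit disc at the abscissa [T1 x], and [tau] is the derivative
     of [T1]. *)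
  pose l x := sin (t x).
  have l0 x : 0 < l x by have [h _ _] := ThP _ (upi x); exact: sin_gt0_pi.
  pose T1 x := - cos (t x).
  pose tau x := k * p x / (2 * l x).
  have dT1 (x : R) : is_derive x 1 T1 (tau x).
    have h := dt x; have h' : is_derive x 1 (cos \o t) (- sin (t x) * ((2 * sin (t x) ^+ 2)^-1 * (k * p x))).
      exact: is_derive1_comp.
    apply: (is_derive_eq (is_deriveN h')); rewrite /tau -/(l x).
    by field; rewrite gt_eqF.
  have ct := is_derive_continuous dt.
  have cT1 := is_derive_continuous dT1.
  have cl : continuous l.
    by move=> x; apply: (@continuous_comp _ _ _ t sin); [exact: ct|exact: continuous_sin].
  have ctau : continuous tau.
    move=> x; apply: cvgM; first by apply: cvgM; [exact: cvg_cst|exact: cp].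
    apply: cvgV; first by rewrite mulf_neq0 ?gt_eqF.
    by apply: cvgM; [exact: cvg_cst|exact: cl].
  have pe x : 0 < p x + e by have := p0 x; lra.
  (* [T2] rescales the partial mass [W], which ranges over [0, p], into the vertical chord [- l, l];
     adding [e] avoids a division by 0 where the line carries no mass. *)
  pose m x := 2 * l x / (p x + e).
  have cm : continuous m.
    move=> x; apply: cvgM; first by apply: cvgM; [exact: cvg_cst|exact: cl].
    apply: cvgV; first by rewrite gt_eqF.
    by apply: cvgD; [exact: cp|exact: cvg_cst].
  pose T2 (z : R * R) := m z.1 * W z.1 z.2 - l z.1.
  have c1 (f : R -> R) : continuous f -> continuous (fun z : R * R => f z.1).
    by move=> cf z; apply: (@continuous_comp _ _ _ fst f); [exact: cvg_fst|exact: cf].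
  have cT2 : continuous T2.
    move=> z; apply: cvgB; last exact: (c1 l cl).
    by apply: cvgM; [exact: (c1 m cm)|exact: cW].
  have dT2 (z : R * R) : is_derive z (basis_vec R ord_max) T2 (m z.1 * q z.1 z.2).
    case: z => x y; apply/is_derive_section2P; rewrite /T2 /=; 
    have h : is_derive y 1 (fun y => m x * W x y) (m x * q x y).
      by have := dW x y => ?; exact: is_deriveZ.
    by apply: (is_derive_eq (is_deriveB h (is_derive_cst (l x) y 1))); rewrite subr0.
  have dT1' (z : R * R) : is_derive z (basis_vec R ord0) (fun z => T1 z.1) (tau z.1).
    by case: z => x y; apply/is_derive_section1P; exact: dT1.
  pose h1 z := g z * tau z.1 + T1 z.1 * g1 z.
  pose h2 z := g z * (m z.1 * q z.1 z.2) + T2 z * g2 z.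
  have ch1 : continuous h1.
    by apply: continuousD2; apply: continuousM2 => //; apply: c1.
  have cqq : continuous (fun z : R * R => q z.1 z.2).
    rewrite (_ : (fun z => _) = (fun z => g z * g z)); first exact: continuousM2.
    by apply/funext => -[x y].
  have ch2 : continuous h2.
    apply: continuousD2; apply: continuousM2 => //.
    by apply: continuousM2 => //; apply: c1.
  have dh1 (z : R * R) : is_derive z (basis_vec R ord0) (fun z => g z * T1 z.1) (h1 z).
    by have := dg1 z; have := dT1' z => ? ?; exact: is_deriveM.
  have dh2 (z : R * R) : is_derive z (basis_vec R ord_max) (fun z => g z * T2 z) (h2 z).
    by have := dg2 z; have := dT2 z => ? ?; exact: is_deriveM.
  have s1 : compactly_supported (fun z => g z * T1 z.1) by exact: compactly_supportedMl.
  have s2 : compactly_supported (fun z => g z * T2 z) by exact: compactly_supportedMl.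
  have I1 : \int[mu2]_z h1 z = 0 by rewrite /Rintegral (integral_partial_eq0 dh1).
  have I2 : \int[mu2]_z h2 z = 0 by rewrite /Rintegral (integral_partial_eq0 dh2).
  have i1 := compactly_supported_integrable ch1 (compactly_supported_derive dh1 s1).
  have i2 := compactly_supported_integrable ch2 (compactly_supported_derive dh2 s2).
  (* [e * r] is the error caused by [e]. On a vertical line [r] has integral p / (p + e) <= 1, so
     its plane integral is at most 2 (M + 1), uniformly in [e]. *)
  pose r (z : R * R) := q z.1 z.2 / (p z.1 + e).
  have cr : continuous r.
    apply: continuousM2 => //; apply: (c1 (fun x => (p x + e)^-1)) => x.
    apply: cvgV; first by rewrite gt_eqF.
    by apply: cvgD; [exact: cp|exact: cvg_cst].
  have sq : compactly_supported (fun z : R * R => q z.1 z.2).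
    by exists M => // z [|]; [exact: qM1|exact: qM2].
  have sr : compactly_supported r by exact: compactly_supportedMl.
  have ir := compactly_supported_integrable cr sr.
  have iqq := compactly_supported_integrable cqq sq.
  have inr x : (\int[mu]_y (r (x, y))%:E)%E = ((p x + e)^-1 * p x)%:E.
    have d (y : R) : is_derive y 1 (fun y => (p x + e)^-1 * W x y) (r (x, y)).
      by have := dW x y => ?; rewrite /r /= mulrC; exact: is_deriveZ.
    have o y : M + 1 < `|y| -> r (x, y) = 0.
      by move=> h; rewrite /r /= qM2 ?mul0r //; lra.
    rewrite (integral_derive_line N0 d (@continuous_section1 R r x cr) o).
    by rewrite (W0 x (- (M + 1))) // mulr0 subr0.
  have Ir : \int[mu2]_z r z <= 2 * (M + 1).
    rewrite /Rintegral -(integral12_prod_meas1 ir) /fubini_F /=.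
    under eq_integral => x _ do rewrite inr.
    rewrite /=.
    have -> : (\int[mu]_x ((p x + e)^-1 * p x)%:E)%E =
        (\int[mu]_(x in `[(- (M + 1))%R, (M + 1)%R]) ((p x + e)^-1 * p x)%:E)%E.
      rewrite [RHS]integral_mkcond; apply: eq_integral => x _; rewrite patchE.
      case: ifPn => // /negP xN; rewrite pM ?mulr0 // ltNge; apply/negP => xM; apply: xN.
      by rewrite inE /= in_itv /= -ler_norml; lra.
    have -> : 2 * (M + 1) = \int[mu]_(x in `[(- (M + 1))%R, (M + 1)%R]) 1.
      rewrite Rintegral_cst //= lebesgue_measure_itv /= lte_fin ifT; last lra.
      by rewrite mul1r -EFinB /=; lra.
    apply: (@le_Rintegral _ _ _ mu `[(- (M + 1))%R, (M + 1)%R]) => //.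
    - apply: continuous_compact_integrable; first exact: segment_compact.
      apply: continuous_subspaceT => x; apply: cvgM; last exact: cp.
      apply: cvgV; first by rewrite gt_eqF.
      by apply: cvgD; [exact: cp|exact: cvg_cst].
    - apply: continuous_compact_integrable; first exact: segment_compact.
      by apply: continuous_subspaceT => x; exact: cvg_cst.
    - by move=> x _; rewrite mulrC ler_pdivrMr // mul1r lerDl ltW.
  have Iq : \int[mu2]_z q z.1 z.2 = pi.
    by rewrite -gpi; apply: eq_Rintegral => -[x y] _.
  have cE : continuous (fun z => enorm (g1 z, g2 z)).
    move=> z; apply: (@continuous_comp _ _ _ (fun z => g1 z ^+ 2 + g2 z ^+ 2) Num.sqrt); last exact: sqrt_continuous.
    by apply: continuousD2; exact: continuousM2.
  have sE : compactly_supported (fun z => enorm (g1 z, g2 z)).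
    have [N N0' gN1] := sg1; have [N' N0'' gN2] := sg2.
    exists (Num.max N N'); first by rewrite lt_max N0'.
    move=> z zN; rewrite /enorm /= gN1 ?gN2 ?expr0n /= ?addr0 ?sqrtr0 //.
    - by case: zN; rewrite gt_max => /andP[]; [left|right].
    - by case: zN; rewrite gt_max => /andP[]; [left|right].
  have iE := compactly_supported_integrable cE sE.
  (* [h1 + h2] is the divergence of g T and integrates to 0; [w] bounds it from below pointwise, by
     |T| <= 1 and the arithmetic-geometric inequality. *)
  pose w z := 2 * k * (q z.1 z.2 - e * r z) - enorm (g1 z, g2 z).
  have cw : continuous (fun z : R * R => 2 * k * (q z.1 z.2 - e * r z)).
    move=> z; apply: cvgM; first exact: cvg_cst.
    apply: cvgB; first exact: cqq.
    by apply: cvgM; [exact: cvg_cst|exact: cr].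
  have sw : compactly_supported (fun z : R * R => 2 * k * (q z.1 z.2 - e * r z)).
    exists M => // z zM; have qz : q z.1 z.2 = 0 by case: zM; [exact: qM1|exact: qM2].
    by rewrite /r qz mul0r mulr0 subr0 mulr0.
  have iw0 := compactly_supported_integrable cw sw.
  have iw : mu2.-integrable setT (EFin \o w) by exact: integrableB_EFin.
  have ih : mu2.-integrable setT (EFin \o (fun z => h1 z + h2 z)) by exact: integrableD_EFin.
  have pw z : w z <= h1 z + h2 z.
    case: z => x y; rewrite /w /h1 /h2 /T2 /r /=.
    have /andP[w0 w1] := W0p x y.
    have mW : 0 <= m x * W x y <= 2 * l x.
      have lx := l0 x; have px := pe x.
      have l2 : 0 <= 2 * l x by rewrite mulr_ge0 // ltW.
      have -> : m x * W x y = 2 * l x * W x y / (p x + e) by rewrite /m mulrAC.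
      apply/andP; split; first by rewrite divr_ge0 ?mulr_ge0 // ltW.
      by rewrite ler_pdivrMr // ler_wpM2l //; apply: (le_trans w1); rewrite lerDl ltW.
    have cs : - enorm (g1 (x, y), g2 (x, y)) <=
        T1 x * g1 (x, y) + (m x * W x y - l x) * g2 (x, y).
      apply: cauchy_schwarz_plane; rewrite -(cos2Dsin2 (t x)) /T1 sqrrN lerD2l -/(l x).
      rewrite -(@ler_pXn2r _ 1) ?expr1 ?nnegrE ?sqr_ge0 // -[leRHS]ger0_norm ?sqr_ge0 // -[leLHS]ger0_norm ?sqr_ge0 //.
      rewrite !normrX lerXn2r ?nnegrE // (ger0_norm (ltW (l0 x))) ler_norml.
      exact: centered_le.
    have gs : 2 * k * (q x y - e * (q x y / (p x + e))) <=
        g (x, y) * tau x + g (x, y) * (m x * q x y).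
      rewrite -mulrDr; pose rho := p x / (p x + e).
      have rho0 : 0 <= rho by rewrite divr_ge0 // ltW.
      have rho1 : rho <= 1 by rewrite ler_pdivrMr // mul1r lerDl ltW.
      have -> : 2 * k * (q x y - e * (q x y / (p x + e))) = g (x, y) * (2 * k * (g (x, y) * rho)).
        by rewrite /q /rho; field; rewrite gt_eqF.
      rewrite ler_wpM2l //; apply: amgm_transport.
      - by rewrite divr_ge0 ?mulr_ge0 // ltW.
      - by rewrite mulr_ge0 // divr_ge0 ?mulr_ge0 // ltW.
      - exact: ltW.
      have -> : tau x * (m x * q x y) = k * rho * g (x, y) ^+ 2.
        by rewrite /tau /m /rho /q; field; rewrite !gt_eqF.
      rewrite (_ : _ ^+ 2 = (k * rho) ^+ 2 * g (x, y) ^+ 2); last by ring.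
      apply: ler_wpM2r; first exact: sqr_ge0.
      have kr : 0 <= k * rho by rewrite mulr_ge0 // ltW.
      have kr1 : k * rho <= 1 by apply: mulr_ile1 => //; exact: ltW.
      by rewrite expr2; exact: ler_piMr.
    by lra.
  have := @le_Rintegral _ _ _ mu2 setT w (fun z => h1 z + h2 z) (@measurableT _ _) iw ih (fun z _ => pw z).
  rewrite (RintegralD measurableT i1 i2) I1 I2 addr0 (RintegralB measurableT iw0 iE).
  have ier : mu2.-integrable setT (EFin \o (fun z => e * r z)).
    apply: compactly_supported_integrable; last exact: compactly_supportedMr.
    by move=> z; apply: cvgM; [exact: cvg_cst|exact: cr].
  have iqr : mu2.-integrable setT (EFin \o (fun z : R * R => q z.1 z.2 - e * r z)).
    exact: integrableB_EFin.
  rewrite (RintegralZl _ measurableT iqr) (RintegralB measurableT iqq ier).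
  rewrite (RintegralZl _ measurableT ir) Iq subr_le0.
  apply: le_trans; rewrite ler_pM2l ?mulr_gt0 // lerD2l lerN2.
  by rewrite ler_pM2l.
exact: (regularization_limit N0 key).
Qed.

Lemma sharp_sobolev (g g1 g2 : R * R -> R) :
  (forall z : R * R, is_derive z (basis_vec R ord0) g (g1 z)) ->
  (forall z : R * R, is_derive z (basis_vec R ord_max) g (g2 z)) ->
  continuous g -> continuous g1 -> continuous g2 -> compactly_supported g ->
  (forall z, 0 <= g z) ->
  4 * pi * \int[mu2]_z (g z ^+ 2) <= (\int[mu2]_z enorm (g1 z, g2 z)) ^+ 2.
Proof.
move=> dg1 dg2 cg cg1 cg2 sg g0.
set m := \int[mu2]_z _.
have m0 : 0 <= m by apply: Rintegral_ge0 => z _; exact: sqr_ge0.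
move: m0; rewrite le_eqVlt => /orP[/eqP<-|m0]; first by rewrite mulr0 sqr_ge0.
have pp := pi_gt0 R.
(* Both sides are homogeneous of degree 2 in g, and with this factor [c * g] has squared integral
   pi. *)
pose c := Num.sqrt (pi / m).
have c2 : c ^+ 2 = pi / m by rewrite sqr_sqrtr // divr_ge0 // ltW.
have c0 : 0 <= c by exact: sqrtr_ge0.
have iq : mu2.-integrable setT (EFin \o (fun z => g z ^+ 2)).
  apply: compactly_supported_integrable; first exact: continuousM2.
  exact: compactly_supportedMr.
have sg1 := compactly_supported_derive dg1 sg.
have sg2 := compactly_supported_derive dg2 sg.
have cE : continuous (fun z => enorm (g1 z, g2 z)).
  move=> z; apply: (@continuous_comp _ _ _ (fun z => g1 z ^+ 2 + g2 z ^+ 2) Num.sqrt); last exact: sqrt_continuous.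
  by apply: continuousD2; exact: continuousM2.
have sE : compactly_supported (fun z => enorm (g1 z, g2 z)).
  have [N N0' gN1] := sg1; have [N' N0'' gN2] := sg2.
  exists (Num.max N N'); first by rewrite lt_max N0'.
  move=> z zN; rewrite /enorm /= gN1 ?gN2 ?expr0n /= ?addr0 ?sqrtr0 //.
  - by case: zN; rewrite gt_max => /andP[]; [left|right].
  - by case: zN; rewrite gt_max => /andP[]; [left|right].
have iE := compactly_supported_integrable cE sE.
have cc : continuous (cst c : R * R -> R) by move=> z; exact: cvg_cst.
have := @sobolev_normalized (fun z => c * g z) (fun z => c * g1 z) (fun z => c * g2 z).
have -> : \int[mu2]_z (c * g z) ^+ 2 = pi.
  under eq_Rintegral do rewrite exprMn.
  by rewrite RintegralZl // c2 -/m divfK // gt_eqF.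
have -> : \int[mu2]_z enorm (c * g1 z, c * g2 z) = c * \int[mu2]_z enorm (g1 z, g2 z).
  rewrite -RintegralZl //; apply: eq_Rintegral => z _.
  by rewrite /enorm /= !exprMn -mulrDr sqrtrM ?sqr_ge0 // sqrtr_sqr ger0_norm.
set N := \int[mu2]_z _ => H.
have {}H : 2 * pi <= c * N.
  apply: H => //.
  - exact: continuousM2.
  - exact: continuousM2.
  - exact: continuousM2.
  - exact: compactly_supportedMr.
  - by move=> z; exact: mulr_ge0.
have p2 : 0 <= 2 * pi :> R by rewrite mulr_ge0 // ltW.
have : (2 * pi) ^+ 2 <= (c * N) ^+ 2 by rewrite lerXn2r // nnegrE // (le_trans p2).
rewrite !exprMn c2 => /(ler_wpM2r (ltW m0)).
rewrite (_ : pi / m * N ^+ 2 * m = pi * N ^+ 2); last by field; rewrite gt_eqF.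
move=> H3; rewrite -(ler_pM2l pp); apply: le_trans H3; rewrite le_eqVlt; apply/orP; left; apply/eqP.
by ring.
Qed.

End SharpSobolev.

(** * Square-integrable functions *)

Section SquareIntegrable.
Context d (T : measurableType d) (R : realType) (m : {measure set T -> \bar R}).
Variable D : set T.
Hypothesis mD : measurable D.
Implicit Types f g : T -> R.

Definition L2 f := measurable_fun D f /\ m.-integrable D (EFin \o (fun x => f x ^+ 2)).

Definition norm2 f := Num.sqrt (\int[m]_(x in D) (f x ^+ 2)).

Lemma L2_le f (F : T -> R) : measurable_fun D f -> m.-integrable D (EFin \o F) ->
  (forall x, D x -> f x ^+ 2 <= F x) -> L2 f.
Proof.
move=> mf iF fF; split=> //; apply: le_integrable iF => //.
  by apply/measurable_EFinP; exact: measurable_funX.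
move=> x Dx /=; rewrite lee_fin ger0_norm ?sqr_ge0 //.
by apply: le_trans (fF x Dx) _; exact: ler_norm.
Qed.

Lemma square_lty_L2 f : measurable_fun D f ->
  (\int[m]_(x in D) (f x ^+ 2)%:E < +oo)%E -> L2 f.
Proof.
move=> mf fi; split=> //; apply/integrableP; split.
  by apply/measurable_EFinP; exact: measurable_funX.
apply: le_lt_trans fi; rewrite le_eqVlt; apply/orP; left; apply/eqP.
by apply: eq_integral => x _ /=; rewrite ger0_norm ?sqr_ge0.
Qed.

Lemma L2M_integrable f g : L2 f -> L2 g -> m.-integrable D (EFin \o (fun x => f x * g x)).
Proof.
move=> [mf fi] [mg gi].
apply: le_integrable (integrableD_EFin mD fi gi) => //.
  by apply/measurable_EFinP; exact: measurable_funM.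
move=> x Dx /=; rewrite lee_fin [leRHS]ger0_norm ?addr_ge0 ?sqr_ge0 //.
have h1 := sqr_ge0 (f x + g x); have h2 := sqr_ge0 (f x - g x).
have h3 := sqr_ge0 (f x); have h4 := sqr_ge0 (g x).
by rewrite ler_norml; apply/andP; split; nra.
Qed.

Lemma L2D f g : L2 f -> L2 g -> L2 (fun x => f x + g x).
Proof.
move=> [mf fi] [mg gi].
apply: (@L2_le _ (fun x => 2 * (f x ^+ 2 + g x ^+ 2))).
- exact: measurable_funD.
- by apply: integrableZl_EFin => //; exact: integrableD_EFin.
- by move=> x _; have := sqr_ge0 (f x - g x); nra.
Qed.

Lemma L2Z c f : L2 f -> L2 (fun x => c * f x).
Proof.
move=> [mf fi]; apply: (@L2_le _ (fun x => c ^+ 2 * f x ^+ 2)).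
- by apply: measurable_funM => //; exact: measurable_cst.
- exact: integrableZl_EFin.
- by move=> x _; rewrite exprMn.
Qed.

Lemma L2N f : L2 f -> L2 (fun x => - f x).
Proof.
move=> Lf; rewrite (_ : (fun x => _) = (fun x => -1 * f x)); first exact: L2Z.
by apply/funext => x; rewrite mulN1r.
Qed.

Lemma L2B f g : L2 f -> L2 g -> L2 (fun x => f x - g x).
Proof. by move=> Lf Lg; apply: L2D => //; exact: L2N. Qed.

Lemma integral_square_ge0 f : 0 <= \int[m]_(x in D) (f x ^+ 2).
Proof. by apply: Rintegral_ge0 => x _; exact: sqr_ge0. Qed.

Lemma norm2_ge0 f : 0 <= norm2 f.
Proof. exact: sqrtr_ge0. Qed.

Lemma norm2_square f : norm2 f ^+ 2 = \int[m]_(x in D) (f x ^+ 2).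
Proof. by rewrite sqr_sqrtr // integral_square_ge0. Qed.

Lemma cauchy_schwarz f g : L2 f -> L2 g ->
  (\int[m]_(x in D) (f x * g x)) ^+ 2 <=
  (\int[m]_(x in D) (f x ^+ 2)) * (\int[m]_(x in D) (g x ^+ 2)).
Proof.
move=> Lf Lg; have iFG := L2M_integrable Lf Lg.
have [mf iF] := Lf; have [mg iG] := Lg.
set A := \int[m]_(x in D) (f x ^+ 2); set B := \int[m]_(x in D) (g x ^+ 2).
set C := \int[m]_(x in D) (f x * g x).
have A0 : 0 <= A := integral_square_ge0 f.
have B0 : 0 <= B := integral_square_ge0 g.
have key (s : R) : 0 <= A - 2 * s * C + s ^+ 2 * B.
  have h : 0 <= \int[m]_(x in D) ((f x - s * g x) ^+ 2) by exact: integral_square_ge0.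
  apply: le_trans h _; rewrite le_eqVlt; apply/orP; left; apply/eqP.
  transitivity (\int[m]_(x in D) ((f x ^+ 2 - 2 * s * (f x * g x)) + s ^+ 2 * g x ^+ 2)).
    by apply: eq_Rintegral => x _; ring.
  have i1 := integrableZl_EFin (2 * s) mD iFG.
  have i2 := integrableZl_EFin (s ^+ 2) mD iG.
  have i3 := integrableB_EFin mD iF i1.
  by rewrite (RintegralD mD i3 i2) (RintegralB mD iF i1) (RintegralZl _ mD iFG) (RintegralZl _ mD iG).
have [B00|B00] := eqVneq B 0.
  rewrite B00 mulr0; have [C0|C0] := eqVneq C 0; first by rewrite C0 expr0n.
  (* For [B = 0] the quadratic is affine in [s]; at this value it equals -1. *)
  have := key ((A + 1) / (2 * C)); rewrite B00 mulr0 addr0.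
  rewrite (_ : 2 * _ * C = A + 1); first by lra.
  by field; exact: C0.
have Bp : 0 < B by rewrite lt_neqAle eq_sym B00.
have := key (C / B).
rewrite (_ : _ + _ = A - C ^+ 2 / B); last by field.
by rewrite subr_ge0 ler_pdivrMr.
Qed.

Lemma cauchy_schwarz_norm f g : L2 f -> L2 g ->
  `|\int[m]_(x in D) (f x * g x)| <= norm2 f * norm2 g.
Proof.
move=> Lf Lg; rewrite -(@ler_pXn2r _ 2) ?nnegrE ?mulr_ge0 ?norm2_ge0 //.
rewrite -normrX ger0_norm ?sqr_ge0 // exprMn !norm2_square.
exact: cauchy_schwarz.
Qed.

Lemma norm2D f g : L2 f -> L2 g -> norm2 (fun x => f x + g x) <= norm2 f + norm2 g.
Proof.
move=> Lf Lg; rewrite -(@ler_pXn2r _ 2) ?nnegrE ?addr_ge0 ?norm2_ge0 //.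
have iFG := L2M_integrable Lf Lg.
have [mf iF] := Lf; have [mg iG] := Lg.
have i1 := integrableZl_EFin 2 mD iFG.
rewrite norm2_square.
have -> : \int[m]_(x in D) ((f x + g x) ^+ 2) =
    \int[m]_(x in D) (f x ^+ 2 + 2 * (f x * g x) + g x ^+ 2).
  by apply: eq_Rintegral => x _; ring.
rewrite (RintegralD mD (integrableD_EFin mD iF i1) iG) (RintegralD mD iF i1) (RintegralZl _ mD iFG).
rewrite -!norm2_square.
have := le_trans (ler_norm _) (cauchy_schwarz_norm Lf Lg).
nra.
Qed.

Lemma le_norm2 f g : L2 f -> L2 g -> (forall x, D x -> `|f x| <= `|g x|) ->
  norm2 f <= norm2 g.
Proof.
move=> [_ iF] [_ iG] fg; rewrite ler_sqrt ?integral_square_ge0 //.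
apply: le_Rintegral => // x Dx.
rewrite -[leLHS]ger0_norm ?sqr_ge0 // -[leRHS]ger0_norm ?sqr_ge0 // !normrX.
by rewrite lerXn2r ?nnegrE ?fg.
Qed.

Lemma norm2Z (c : R) f : 0 <= c -> L2 f -> norm2 (fun x => c * f x) = c * norm2 f.
Proof.
move=> c0 [mf iF]; rewrite /norm2 -{2}(ger0_norm c0) -sqrtr_sqr -sqrtrM ?sqr_ge0 //.
by rewrite -(RintegralZl _ mD iF); congr Num.sqrt; apply: eq_Rintegral => x _; rewrite exprMn.
Qed.

Lemma chebyshev_square f (A : set T) (eta : R) : L2 f -> measurable A -> A `<=` D ->
  0 < eta -> (forall x, A x -> eta <= `|f x|) -> (m D < +oo)%E ->
  fine (m A) <= (\int[m]_(x in D) (f x ^+ 2)) / eta ^+ 2.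
Proof.
move=> [mf iF] mA AD eta0 Af fD.
rewrite ler_pdivlMr ?exprn_gt0 // mulrC -Rintegral_cst //.
have iFA : m.-integrable A (EFin \o (fun x => f x ^+ 2)) by exact: integrableS iF.
apply: (@le_trans _ _ (\int[m]_(x in A) (f x ^+ 2))).
  apply: le_Rintegral => //.
    apply: measurable_bounded_integrable => //; last exact: bounded_cst.
    by apply: le_lt_trans fD; apply: le_measure => //; rewrite inE.
  move=> x Ax; rewrite -[leRHS]ger0_norm ?sqr_ge0 // normrX lerXn2r ?nnegrE ?Af //.
  exact: ltW.
rewrite Rintegral_mkcond [leRHS]Rintegral_mkcond.
apply: le_Rintegral => //.
- by rewrite -restrict_EFin; apply/integrable_restrict => //; rewrite setTI.
- by rewrite -restrict_EFin; apply/integrable_restrict => //; rewrite setTI.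
- move=> x _; rewrite !patchE; case: ifPn => xA; case: ifPn => xD //; last exact: sqr_ge0.
  by exfalso; move/negP: xD; apply; rewrite inE; apply: AD; rewrite -inE.
Qed.

End SquareIntegrable.

(** * Integration of radial functions *)

Section RadialIntegration.
Variable R : realType.
Local Notation mu := (@lebesgue_measure R).
Local Notation mu2 := (@lebesgue2 R).

Definition normsq (x : R * R) : R := x.1 ^+ 2 + x.2 ^+ 2.

Lemma normsq_ge0 x : 0 <= normsq x.
Proof. by rewrite addr_ge0 ?sqr_ge0. Qed.

(** Substituting x = - r cos t turns the integrand into r^2 times the derivative of [cap_area],
    whose increment over [0, pi] is pi. *)
Lemma integral_chord (r : R) : 0 < r ->
  (\int[mu]_(x in `[(- r)%R, r]) (2 * Num.sqrt (r ^+ 2 - x ^+ 2))%:E)%E = (pi * r ^+ 2)%:E.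
Proof.
move=> r0; pose F (t : R) := - r * cos t.
have dF (t : R) : is_derive t 1 F (r * sin t).
  have h : is_derive t 1 (fun t : R => - r * cos t) (- r * - sin t) by exact: is_deriveZ.
  by apply: (is_derive_eq h); rewrite mulrNN.
have F'E : derive1 F = fun t => r * sin t.
  by apply/funext => t; rewrite derive1E; exact: (@derive_val _ _ _ _ _ _ _ (dF t)).
have cF' : continuous (fun t : R => r * sin t).
  by move=> t; apply: cvgM; [exact: cvg_cst|exact: continuous_sin].
have cF := is_derive_continuous dF.
have F0 : F 0 = - r by rewrite /F cos0 mulr1.
have Fpi : F pi = r by rewrite /F cospi mulrN1 opprK.
have := @integration_by_substitution_increasing R F (fun x => 2 * Num.sqrt (r ^+ 2 - x ^+ 2)) 0 pi (pi_ge0 R).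
rewrite F0 Fpi F'E => sub.
have h1 : {in `[0, pi] &, {homo F : x y / x < y}}.
  move=> s t; rewrite !in_itv /= => s01 t01 st.
  by rewrite /F !mulNr ltrN2 ltr_pM2l // ltr_cos ?in_itv.
have h2 : {in `]0, pi[, continuous (fun t : R => r * sin t)} by move=> t _; exact: cF'.
have h3 : cvg ((fun t : R => r * sin t) x @[x --> 0^'+]).
  by apply/cvg_ex; exists (r * sin 0); apply: cvg_at_right_filter; exact: cF'.
have h4 : cvg ((fun t : R => r * sin t) x @[x --> (pi : R)^'-]).
  by apply/cvg_ex; exists (r * sin pi); apply: cvg_at_left_filter; exact: cF'.
have h5 : derivable_oo_LRcontinuous F 0 pi.
  split; first by move=> t _; exact: (@ex_derive _ _ _ _ _ _ _ (dF t)).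
  - by apply: cvg_at_right_filter; exact: cF.
  - by apply: cvg_at_left_filter; exact: cF.
have h6 : {within `[(- r), r], continuous (fun x : R => 2 * Num.sqrt (r ^+ 2 - x ^+ 2))}.
  have cs : continuous (fun x : R => Num.sqrt (r ^+ 2 - x ^+ 2)).
    move=> x; apply: (@continuous_comp _ _ _ (fun x : R => r ^+ 2 - x ^+ 2) (@Num.sqrt R));
      last exact: sqrt_continuous.
    by apply: cvgB; [exact: cvg_cst|exact: exprn_continuous].
  by apply: continuous_subspaceT => x; apply: cvgM; [exact: cvg_cst|exact: cs].
rewrite (sub h1 h2 h3 h4 h5 h6).
transitivity (\int[mu]_(x in `[0%R, pi]) (r ^+ 2 * (2 * sin x ^+ 2))%:E)%E.
  apply: eq_integral => t; rewrite inE /= in_itv /= => t01.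
  congr EFin; rewrite /F /= mulrfctE /=.
  have s0 : 0 <= sin t by exact: sin_ge0_pi.
  rewrite (_ : r ^+ 2 - _ = (r * sin t) ^+ 2); last first.
    by have := cos2Dsin2 t; rewrite exprMn sqrrN => h; rewrite exprMn -[X in X - _]mulr1 -h; ring.
  by rewrite sqrtr_sqr ger0_norm ?mulr_ge0 // ?(ltW r0) //; ring.
have d (t : R) : is_derive t 1 (fun t => r ^+ 2 * cap_area t) (r ^+ 2 * (2 * sin t ^+ 2)).
  by have := is_derive_cap_area t => ?; exact: is_deriveZ.
have c : continuous (fun t : R => r ^+ 2 * (2 * sin t ^+ 2)).
  move=> t; apply: cvgM; first exact: cvg_cst.
  apply: cvgM; first exact: cvg_cst.
  by apply: (@continuous_comp _ _ _ sin (fun x : R => x ^+ 2)); [exact: continuous_sin|exact: exprn_continuous].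
by rewrite (integral_derive (pi_ge0 R) d c) cap_area0 cap_area_pi mulr0 subr0 mulrC.
Qed.

(** Vertical sections are chords of half-length sqrt(b - x^2). The square root of a negative number
    is 0 by convention, so the formula also covers empty sections. *)
Lemma disc_area (b : R) : mu2 [set x | normsq x < b] = (pi * Num.max b 0)%:E.
Proof.
have sec x : mu (xsection [set x | normsq x < b] x) = (2 * Num.sqrt (b - x ^+ 2))%:E.
  have -> : xsection [set x | normsq x < b] x = `](- Num.sqrt (b - x ^+ 2)), Num.sqrt (b - x ^+ 2)[%classic.
    apply/seteqP; split=> y /=; rewrite /xsection /= inE /normsq /= in_itv /= -ltr_norml -sqrtr_sqr.
      by move=> h; rewrite ltr_sqrt; [lra|have := sqr_ge0 y; lra].
    have [h|h] := ltP 0 (b - x ^+ 2); first by rewrite ltr_sqrt //; lra.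
    by rewrite [X in _ < X]ler0_sqrtr // ltNge sqrtr_ge0.
  rewrite lebesgue_measure_itv /= lte_fin.
  have := sqrtr_ge0 (b - x ^+ 2); rewrite le_eqVlt => /orP[/eqP<-|h].
    by rewrite oppr0 ltxx mulr0.
  by rewrite ifT; [rewrite -EFinB; congr EFin; ring|lra].
transitivity (\int[mu]_x (2 * Num.sqrt (b - x ^+ 2))%:E)%E.
  transitivity (\int[mu]_x mu (xsection [set x | (normsq x < b)%R] x))%E; first by [].
  by apply: eq_integral => x _; rewrite sec.
have [b0|b0] := leP b 0.
  rewrite mulr0.
  apply: integral0_eq => x _; congr EFin; rewrite ler0_sqrtr ?mulr0 //.
  by have := sqr_ge0 x; lra.
rewrite -{2}(sqr_sqrtr (ltW b0)) -integral_chord ?sqrtr_gt0 //.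
rewrite sqr_sqrtr ?(ltW b0) // [RHS]integral_mkcond; apply: eq_integral => x _.
rewrite patchE; case: ifPn => // /negP xN; congr EFin; rewrite ler0_sqrtr ?mulr0 // leNgt.
apply/negP => h; apply: xN; rewrite inE /= in_itv /= -ler_norml -sqrtr_sqr ler_sqrt ?(ltW b0) //; lra.
Qed.

Lemma unit_disc_normsq : @unit_disc R = [set x | normsq x < 1].
Proof. by apply/seteqP; split => x /enorm_lt1. Qed.

Lemma unit_disc_area : mu2 (@unit_disc R) = pi%:E.
Proof. by rewrite unit_disc_normsq disc_area max_l ?mulr1. Qed.

(** This is the image of planar Lebesgue measure under x |-> |x|^2: in that variable the polar
    Jacobian is the constant pi. *)
Definition half_line_measure : {measure set (measurableTypeR R) -> \bar R} :=
  mscale (NngNum (pi_ge0 R)) (mrestr mu (@measurable_itv R `[0, +oo[)).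

Lemma measurable_normsqR :
  measurable_fun (setT : set (borel_plane R)) (normsq : borel_plane R -> measurableTypeR R).
Proof.
apply: (measurability _ (measurable_realfun.RGenOInfty.measurableE R)) => _ [_ [a ->] <-].
rewrite setTI; apply: open_measurable_plane.
by apply: open_comp; [move=> x _; exact: continuous_normsq|exact: interval_open].
Qed.

Definition normsq_measure : {measure set (measurableTypeR R) -> \bar R} :=
  @measure_function_pushforward__canonical__measure_function_Measure _ _
    (borel_plane R) (measurableTypeR R) R mu2 normsq measurable_normsqR.

(** Both measures give pi max(b, 0) to ]-oo, b[. These half-lines are stable under intersection,
    generate the Borel sets and exhaust the line with finite measure, so the measures coincide. *)
Lemma pushforward_normsq (A : set (measurableTypeR R)) : measurable A ->
  pushforward mu2 normsq A = half_line_measure A.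
Proof.
pose G : set (set (measurableTypeR R)) := [set A | exists x : R, A = `]-oo, x[%classic].
have nG n : G `]-oo, (n%:R : R)[%classic by exists n%:R.
have EG A' : G A' -> pushforward mu2 normsq A' = half_line_measure A'.
  move=> [b ->]; rewrite /half_line_measure /= /mscale /= /mrestr.
  rewrite (_ : pushforward _ _ _ = mu2 [set x | normsq x < b]); last first.
    by rewrite /pushforward; congr (mu2 _); apply/seteqP; split=> x /=; rewrite in_itv.
  rewrite disc_area EFinM; congr (_ * _)%E.
  rewrite (_ : _ `&` _ = `[0, b[%classic); last first.
    apply/seteqP; split=> x /=; rewrite !in_itv /= ?andbT; first by move=> [-> ->].
    by move=> /andP[-> ->].
  rewrite lebesgue_measure_itv /= lte_fin; case: ltP => b0.
    by rewrite ?oppr0 ?sube0 ?adde0 -?EFinB ?subr0.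
  by [].
have mG : @measurable _ (measurableTypeR R) = <<s G >>.
  exact: (measurable_realfun.RGenInftyO.measurableE R).
have h1 : setI_closed G.
  move=> _ _ [x ->] [y ->]; exists (Num.min x y).
  apply/seteqP; split=> z /=; rewrite !in_itv /= lt_min; first by move=> [-> ->].
  by move=> /andP[].
have h2 : \bigcup_n `]-oo, (n%:R : R)[%classic = [set: measurableTypeR R].
  apply/seteqP; split=> // x _; exists (Num.truncn `|x|).+1 => //=; rewrite in_itv /=.
  by apply: le_lt_trans (ler_norm x) _; rewrite truncnS_gt.
have h3 n : (normsq_measure `]-oo, (n%:R : R)[%classic < +oo)%E.
  rewrite (_ : normsq_measure _ = mu2 [set x | (normsq x < n%:R)%R]) ?disc_area ?ltry //.
  have pre : normsq @^-1` `]-oo, (n%:R : R)[ = [set x | normsq x < n%:R].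
    by apply/seteqP; split=> x /=; rewrite in_itv.
  by rewrite -disc_area -pre.
move=> mA; exact: (@measure_unique _ R (measurableTypeR R) G _ mG h1 nG h2 normsq_measure half_line_measure EG h3 A mA).
Qed.

Lemma integral_radial (F : R -> R) : measurable_fun setT F -> (forall s, 0 <= F s) ->
  (\int[mu2]_(x in @unit_disc R) (F (normsq x))%:E)%E =
  (pi%:E * \int[mu]_(s in `[0%R, 1%R[) (F s)%:E)%E.
Proof.
move=> mF F0.
pose I01 : set (measurableTypeR R) := `[0, 1[%classic.
pose m2 := mscale (NngNum (pi_ge0 R)) mu : {measure set (measurableTypeR R) -> \bar R}.
have mD : measurable I01 by exact: measurable_itv.
have mE : measurable_fun I01 (fun s => (F s)%:E).
  by apply/measurable_EFinP; exact: measurable_funS mF.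
have F0' : {in I01, forall y, (0 <= (F y)%:E)%E} by move=> y _; rewrite lee_fin.
have := @ge0_integral_pushforward _ _ (borel_plane R) (measurableTypeR R) R normsq
  measurable_normsqR mu2 I01 (fun s => (F s)%:E) mD mE F0'.
have -> : normsq @^-1` I01 = @unit_disc R.
  rewrite unit_disc_normsq; apply/seteqP; split=> x; rewrite /I01 /= in_itv /=; first by move=> /andP[].
  by move=> ->; rewrite normsq_ge0.
move=> <-.
rewrite -(@ge0_integral_mscale _ _ _ mu _ mD (NngNum (pi_ge0 R))) //; last first.
  by move=> y _; rewrite lee_fin.
have E : (\int[normsq_measure]_(y in I01) (F y)%:E = \int[m2]_(y in I01) (F y)%:E)%E.
  apply: eq_measure_integral => A mA AI; rewrite [LHS]pushforward_normsq //.
  rewrite /half_line_measure /= /mscale /= /mrestr setIidl // => x /AI /=.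
  by rewrite !in_itv /= andbT => /andP[].
exact: E.
Qed.

End RadialIntegration.

(** * Integrals over subsets *)

Section SubsetIntegrals.
Context d (T : measurableType d) (R : realType) (m : {measure set T -> \bar R}).
Variables (A D : set T).
Hypotheses (mA : measurable A) (mD : measurable D) (AD : A `<=` D).

Lemma Rintegral_eq_subset (f : T -> R) : (forall x, D x -> ~ A x -> f x = 0) ->
  \int[m]_(x in D) f x = \int[m]_(x in A) f x.
Proof.
move=> f0; rewrite Rintegral_mkcond [RHS]Rintegral_mkcond; apply: eq_Rintegral => x _.
rewrite !patchE; case: ifPn => xD; case: ifPn => xA //.
  by apply: f0; [rewrite inE in xD|move/negP: xA => h Ax; apply: h; rewrite inE].
by exfalso; move/negP: xD; apply; rewrite inE in xA; rewrite inE; exact: AD.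
Qed.

Lemma Rintegral_subset_le (f : T -> R) : m.-integrable D (EFin \o f) ->
  (forall x, D x -> 0 <= f x) -> \int[m]_(x in A) f x <= \int[m]_(x in D) f x.
Proof.
move=> iD f0; have iA : m.-integrable A (EFin \o f) by exact: integrableS iD.
rewrite Rintegral_mkcond [leRHS]Rintegral_mkcond; apply: le_Rintegral => //.
- by rewrite -restrict_EFin; apply/integrable_restrict => //; rewrite setTI.
- by rewrite -restrict_EFin; apply/integrable_restrict => //; rewrite setTI.
- move=> x _; rewrite !patchE; case: ifPn => xA; case: ifPn => xD //.
    by exfalso; move/negP: xD; apply; rewrite inE; apply: AD; rewrite -inE.
  by apply: f0; rewrite inE in xD.
Qed.

End SubsetIntegrals.

(** * Level sets and the energy of one band *)

Section LevelSets.
Variable R : realType.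
Local Notation mu2 := (@lebesgue2 R).
Local Notation D := (@unit_disc R).
Implicit Types (v phi : R * R -> R) (I : interval R).

(** Indexing by an interval of values lets open bands, closed superlevel sets and single levels
    share the same splitting lemmas. *)
Definition level v I : set (borel_plane R) := D `&` v @^-1` [set` I].

Definition level_area v I : R := fine (mu2 (level v I)).

Lemma level_measurable v I :
  measurable_fun (D : set (borel_plane R)) v -> measurable (level v I).
Proof. by move=> mv; apply: mv; [exact: unit_disc_measurable|exact: measurable_itv]. Qed.

Lemma sub_disc_fin_num (A : set (borel_plane R)) : measurable A -> A `<=` D ->
  mu2 A \is a fin_num.
Proof.
move=> mA AD; rewrite ge0_fin_numE //; apply: le_lt_trans (@unit_disc_ltoo R).
by apply: le_measure; rewrite ?inE //; exact: unit_disc_measurable.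
Qed.

Lemma level_sub v I : level v I `<=` D. Proof. by move=> x []. Qed.

Lemma fine_measure_le_setU (A B C : set (borel_plane R)) :
  measurable A -> measurable B -> measurable C -> B `<=` D -> C `<=` D ->
  A `<=` B `|` C -> fine (mu2 A) <= fine (mu2 B) + fine (mu2 C).
Proof.
move=> mA mB mC BD CD ABC.
have AD : A `<=` D by move=> x /ABC []; [exact: BD|exact: CD].
rewrite -fineD ?sub_disc_fin_num //; apply: fine_le; rewrite ?sub_disc_fin_num //.
  by rewrite fin_numD !sub_disc_fin_num.
apply: le_trans (le_measure mu2 _ _ ABC) _; rewrite ?inE //; first exact: measurableU.
exact: measureU2.
Qed.

Lemma level_area_ge0 v I : 0 <= level_area v I.
Proof. exact/fine_ge0. Qed.

Lemma level_area_le v I J : measurable_fun (D : set (borel_plane R)) v ->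
  {subset I <= J} -> level_area v I <= level_area v J.
Proof.
move=> mv IJ; have mI := level_measurable I mv; have mJ := level_measurable J mv.
apply: fine_le; try by apply: sub_disc_fin_num => //; exact: level_sub.
by apply: le_measure; [rewrite inE|rewrite inE|] => // x [Dx /= vI]; split => //=; exact: IJ.
Qed.

Lemma level_area_split v I J K : measurable_fun (D : set (borel_plane R)) v ->
  (forall x, (x \in I) = (x \in J) || (x \in K)) ->
  (forall x, x \in J -> x \in K -> False) ->
  level_area v I = level_area v J + level_area v K.
Proof.
move=> mv IJK dis.
have mJ := level_measurable J mv; have mK := level_measurable K mv.
rewrite /level_area -fineD ?sub_disc_fin_num //; try exact: level_sub.
congr fine; rewrite -(measureU _ mJ mK).
  congr (mu2 _); apply/seteqP; split=> x.
    by move=> [Dx /=]; rewrite IJK => /orP[h|h]; [left|right].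
  by move=> [[Dx /= h]|[Dx /= h]]; split=> //=; rewrite IJK h ?orbT.
by apply/seteqP; split=> // x [[_ /= h1] [_ /= h2]]; exact: dis h1 h2.
Qed.

Lemma level_Rintegral_split v I J K (f : R * R -> R) :
  measurable_fun (D : set (borel_plane R)) v ->
  (forall x, (x \in I) = (x \in J) || (x \in K)) ->
  (forall x, x \in J -> x \in K -> False) ->
  mu2.-integrable D (EFin \o f) ->
  \int[mu2]_(x in level v I) f x =
  \int[mu2]_(x in level v J) f x + \int[mu2]_(x in level v K) f x.
Proof.
move=> mv IJK dis iD.
have mJ := level_measurable J mv; have mK := level_measurable K mv.
rewrite -Rintegral_setU //.
- congr (Rintegral _ _ _); apply/seteqP; split=> x.
    by move=> [Dx /=]; rewrite IJK => /orP[h|h]; [left|right].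
  by move=> [[Dx /= h]|[Dx /= h]]; split=> //=; rewrite IJK h ?orbT.
- apply: integrableS iD => //; first exact: unit_disc_measurable.
    exact: measurableU.
  by move=> x [[]|[]].
- apply/disj_setPS => x [[_ /= h1] [_ /= h2]]; exact: dis h1 h2.
Qed.

Lemma level_area_le_pi v I : measurable_fun (D : set (borel_plane R)) v ->
  level_area v I <= pi.
Proof.
move=> mv; rewrite -[leRHS]/(fine pi%:E) -unit_disc_area.
have mI := level_measurable I mv; have uD := @unit_disc_measurable R.
by apply: fine_le; rewrite ?sub_disc_fin_num //; try (by apply: le_measure; rewrite ?inE //; exact: level_sub); exact: level_sub.
Qed.

Definition grad_sq phi (x : R * R) : R := \sum_(i < 2) partials [:: i] phi x ^+ 2.

Lemma grad_sqE phi x :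
  grad_sq phi x = partials [:: ord0] phi x ^+ 2 + partials [:: ord_max] phi x ^+ 2.
Proof.
rewrite /grad_sq big_ord_recl big_ord1; congr (_ + partials [:: _] phi x ^+ 2).
exact/val_inj.
Qed.

Lemma continuous_L2 (f : R * R -> R) : continuous f -> L2 mu2 D f.
Proof.
move=> cf; split.
  by apply: continuous_measurable_plane => //; exact: unit_disc_measurable.
apply: continuous_integrable_disc; exact: continuousM2.
Qed.

(** The sharp Sobolev inequality for H(phi): its squared integral is at least d^2 times the area
    above the band. On the gradient side, h |grad phi| is split as (sqrt h |grad phi|) sqrt h for
    Cauchy-Schwarz, and h(phi) is at most c and vanishes off the band. *)
Lemma band_energy phi (H h : R -> R) (lo hi d c : R) :
  test_function D phi -> smooth1 H -> (forall x : R, is_derive x 1 H (h x)) ->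
  (forall x, 0 <= h x <= c) -> (forall x, ~~ (lo <= x <= hi) -> h x = 0) ->
  (forall x, x <= lo -> H x = 0) -> (forall x, hi <= x -> H x = d) -> 0 <= lo -> 0 <= d ->
  4 * pi * (d ^+ 2 * level_area phi `[hi, +oo[) <=
  (\int[mu2]_(x in D) (h (phi x) * grad_sq phi x)) * (c * level_area phi `[lo, hi]).
Proof.
move=> Tphi SH dH h01 h0 Hlo Hhi lo0 d0.
have [Sphi _ _] := Tphi; have uD := @unit_disc_measurable R.
have cphi := smooth_continuous Sphi.
have mphi : measurable_fun (D : set (borel_plane R)) phi.
  exact: continuous_measurable_plane.
have Sh : smooth1 h := smooth1_derive SH dH.
have ch : continuous (fun x => h (phi x)).
  by move=> x; apply: (continuous_comp (cphi x)); exact: (Cn_continuous (Sh 0%N)).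
have cp i : continuous (partials [:: i] phi) by apply/smooth_continuous/smooth_partial.
have hge x : 0 <= h x by case/andP: (h01 x).
have Hge x : 0 <= H x.
  rewrite -(Hlo (Num.min lo x)); last by rewrite ge_min lexx.
  by apply: (derive_ge0_nondecreasing dH hge); rewrite ge_min lexx orbT.
have TH : test_function D (H \o phi) by apply: test_function_comp => //; exact: Hlo.
have [STH _ _] := TH.
have dphi i (z : R * R) : is_derive z (basis_vec R i) (H \o phi) (h (phi z) * partials [:: i] phi z).
  exact: (is_derive_comp_line (dH _) (smooth_is_derive i z Sphi)).
have cd i : continuous (fun z => h (phi z) * partials [:: i] phi z) by exact: continuousM2.
have := sharp_sobolev (dphi ord0) (dphi ord_max) (smooth_continuous STH)
  (cd ord0) (cd ord_max) (test_function_compactly_supported TH) (fun z => Hge (phi z)).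
have cg : continuous (fun x => Num.sqrt (grad_sq phi x)).
  move=> x; apply: (@continuous_comp _ _ _ (grad_sq phi) (@Num.sqrt R)); last exact: sqrt_continuous.
  rewrite (_ : grad_sq phi = (fun x => partials [:: ord0] phi x ^+ 2 + partials [:: ord_max] phi x ^+ 2)).
    by apply: continuousD2; exact: continuousM2.
  by apply/funext => z; exact: grad_sqE.
have cs : continuous (fun x => Num.sqrt (h (phi x))).
  by move=> x; apply: (@continuous_comp _ _ _ (fun x => h (phi x)) (@Num.sqrt R)); [exact: ch|exact: sqrt_continuous].
have gge x : 0 <= grad_sq phi x by rewrite grad_sqE addr_ge0 ?sqr_ge0.
set J := (\int[mu2]_z enorm _).
have JE : J = \int[mu2]_(x in D) (Num.sqrt (h (phi x)) * Num.sqrt (grad_sq phi x) * Num.sqrt (h (phi x))).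
  have E z : enorm (h (phi z) * partials [:: ord0] phi z, h (phi z) * partials [:: ord_max] phi z)
      = Num.sqrt (h (phi z)) * Num.sqrt (grad_sq phi z) * Num.sqrt (h (phi z)).
    rewrite /enorm /= !exprMn -mulrDr -grad_sqE sqrtrM ?sqr_ge0 // sqrtr_sqr ger0_norm //.
    by rewrite mulrAC -expr2 sqr_sqrtr.
  rewrite /J (@Rintegral_eq_subset _ _ _ mu2 D setT) //.
    by apply: eq_Rintegral => z _; rewrite E.
  move=> z _ nDz; rewrite E (test_function_out Tphi nDz) grad_sqE.
  by rewrite !(test_function_out (test_function_partial _ Tphi) nDz) expr0n /= addr0 sqrtr0 mulr0 mul0r.
have L1 : L2 mu2 D (fun x => Num.sqrt (h (phi x)) * Num.sqrt (grad_sq phi x)).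
  by apply: continuous_L2; exact: continuousM2.
have L1' : L2 mu2 D (fun x => Num.sqrt (h (phi x))) by exact: continuous_L2.
have CS : J ^+ 2 <= (\int[mu2]_(x in D) (h (phi x) * grad_sq phi x)) * (\int[mu2]_(x in D) h (phi x)).
  rewrite JE; apply: le_trans (cauchy_schwarz uD L1 L1') _.
  rewrite le_eqVlt; apply/orP; left; apply/eqP; congr (_ * _); apply: eq_Rintegral => x _.
    by rewrite exprMn !sqr_sqrtr.
  by rewrite sqr_sqrtr.
move=> SS; apply: le_trans (le_trans _ SS) (le_trans CS _).
- have p4 : 0 <= 4 * pi :> R by rewrite mulr_ge0 // pi_ge0.
  apply: ler_wpM2l => //.
  have mA := level_measurable `[hi, +oo[ mphi.
  rewrite -(Rintegral_cst _ mA) (@Rintegral_eq_subset _ _ _ mu2 D setT) //; last first.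
    by move=> z _ nDz /=; rewrite (test_function_out Tphi nDz) Hlo // expr0n.
  apply: le_trans (Rintegral_subset_le mA uD (@level_sub _ _) _ _); last 2 first.
  + by apply: continuous_integrable_disc; apply: continuousM2; exact: smooth_continuous STH.
  + by move=> x _; exact: sqr_ge0.
  rewrite le_eqVlt; apply/orP; left; apply/eqP; apply: eq_Rintegral => x; rewrite inE => -[_ /=].
  by rewrite in_itv /= andbT => hx; rewrite Hhi.
- apply: ler_wpM2l; first by apply: Rintegral_ge0 => x _; rewrite mulr_ge0.
  have mA := level_measurable `[lo, hi] mphi.
  rewrite (@Rintegral_eq_subset _ _ _ mu2 (level phi `[lo, hi]) D) //; last 2 first.
  + exact: level_sub.
  + by move=> x Dx nA; apply: h0; apply/negP => hx; apply: nA; split => //=; rewrite in_itv.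
  rewrite -(Rintegral_cst _ mA); apply: le_Rintegral => //.
  + apply: (@integrableS _ _ _ mu2 D) => //; first exact: level_sub.
    exact: continuous_integrable_disc.
  + apply: (@integrableS _ _ _ mu2 D) => //; first exact: level_sub.
    by apply: (continuous_integrable_disc (f := cst c)) => x; exact: cvg_cst.
  + by move=> x _; case/andP: (h01 (phi x)).
Qed.

(** Where v lies in I and phi outside J, the two differ by at least eta; Chebyshev's inequality
    bounds the area of that set. *)
Lemma level_area_close v phi I J (eta : R) :
  measurable_fun (D : set (borel_plane R)) v ->
  measurable_fun (D : set (borel_plane R)) phi ->
  L2 mu2 D (fun x => phi x - v x) -> 0 < eta ->
  (forall s t, s \in I -> t \notin J -> eta <= `|t - s|) ->
  level_area v I <= level_area phi J + (\int[mu2]_(x in D) ((phi x - v x) ^+ 2)) / eta ^+ 2.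
Proof.
move=> mv mphi Ld eta0 IJ; have uD := @unit_disc_measurable R.
have mI := level_measurable I mv; have mJ := level_measurable J mphi.
pose E : set (borel_plane R) := level v I `\` level phi J.
have mE : measurable E by exact: measurableD.
have ED : E `<=` D by move=> x [[]].
have h1 : fine (mu2 E) <= (\int[mu2]_(x in D) ((phi x - v x) ^+ 2)) / eta ^+ 2.
  apply: (chebyshev_square uD Ld mE ED eta0); last exact: unit_disc_ltoo.
  move=> x [[Dx /= xI] nJ]; apply: IJ => //; apply/negP => xJ; apply: nJ; split => //.
apply: le_trans (lerD (lexx _) h1); apply: fine_measure_le_setU => //.
  exact: level_sub.
move=> x xI; case: (pselect (level phi J x)) => [|n]; [by left|by right].
Qed.

End LevelSets.

(** * Bands of small area and induction on the level *)

Section SmallBands.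
Variable R : realType.
Local Notation mu2 := (@lebesgue2 R).
Local Notation D := (@unit_disc R).
Variable v : R * R -> R.
Hypothesis mv : measurable_fun (D : set (borel_plane R)) v.

(** Continuity from above of the measure along level sets that decrease to the empty set. *)
Lemma small_level (I : nat -> interval R) (e : R) : 0 < e ->
  (forall n, {subset I n.+1 <= I n}) -> (forall x, exists n, x \notin I n) ->
  exists n, level_area v (I n) <= e.
Proof.
move=> e0 Isub Iex.
have Imono n p : (n <= p)%N -> {subset I p <= I n}.
  elim: p => [|p IH]; first by rewrite leqn0 => /eqP ->.
  by rewrite leq_eqVlt => /orP[/eqP->//|/IH h] x /Isub; exact: h.
have I0 : \bigcap_n level v (I n) = set0.
  apply/seteqP; split=> // x xI; have [n] := Iex (v x).
  by have [_ /= ->] := xI n Logic.I.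
have := @nonincreasing_cvg_mu _ (borel_plane R) R mu2 (fun n => level v (I n)).
rewrite I0 measure0 => cv.
have {}cv : (fun n => mu2 (level v (I n))) @ \oo --> 0%E.
  apply: cv.
  - by rewrite ltey_eq sub_disc_fin_num //; [exact: level_measurable|exact: level_sub].
  - by move=> n; exact: level_measurable.
  - exact: measurable0.
  - by move=> n p np; apply/subsetPset => x [Dx /= h]; split=> //=; exact: Imono h.
have {}cv : (fun n => level_area v (I n)) @ \oo --> (0 : R) by exact: fine_cvg cv.
have /cvgrPdist_le/(_ e e0) [n _ Hn] := cv.
exists n; have /= := Hn n (leqnn n); rewrite sub0r normrN => h.
by apply: le_trans h; exact: ler_norm.
Qed.

(** The band omits the level s itself, so it shrinks to the empty set even if {v = s} has positive
    area. *)
Lemma small_band_right (s e : R) : 0 < e ->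
  exists2 r, s < r & level_area v `]s, r[ <= e.
Proof.
move=> e0; have [||n Hn] := @small_level (fun n => `]s, s + n.+1%:R^-1[) e e0.
- move=> n x; rewrite !in_itv /= => /andP[-> /=] /lt_le_trans; apply.
  by rewrite lerD2l lef_pV2 ?posrE // ler_nat.
- move=> x; have [xs|sx] := leP x s; first by exists 0%N; rewrite in_itv /= ltNge xs.
  have d0 : 0 < x - s by rewrite subr_gt0.
  have [n _ /(_ n (leqnn n)) /= Hn] := near_infty_natSinv_lt (PosNum d0).
  by exists n; rewrite in_itv /= sx /= -leNgt -lerBrDl; exact: ltW.
by exists (s + n.+1%:R^-1) => //; rewrite ltrDl invr_gt0.
Qed.

Lemma small_band_left (s e : R) : 0 < e ->
  exists2 r, r < s & level_area v `]r, s[ <= e.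
Proof.
move=> e0; have [||n Hn] := @small_level (fun n => `]s - n.+1%:R^-1, s[) e e0.
- move=> n x; rewrite !in_itv /= => /andP[h ->]; rewrite andbT; apply: le_lt_trans h.
  by rewrite lerD2l lerN2 lef_pV2 ?posrE // ler_nat.
- move=> x; have [xs|sx] := leP s x.
    by exists 0%N; rewrite in_itv /= [X in _ && X]ltNge xs andbF.
  have d0 : 0 < s - x by rewrite subr_gt0.
  have [n _ /(_ n (leqnn n)) /= Hn] := near_infty_natSinv_lt (PosNum d0).
  by exists n; rewrite in_itv /= sx andbT -leNgt lerBrDl -lerBrDr; exact: ltW.
by exists (s - n.+1%:R^-1) => //; rewrite ltrBlDr ltrDl invr_gt0.
Qed.

(** The supremum of the levels where P holds satisfies P itself, by the step from the left; the step
    to the right then excludes that it lies below t. *)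
Lemma real_induction (P : R -> Prop) (t : R) : 0 <= t -> P 0 ->
  (forall s, 0 <= s < t -> exists2 r, s < r <= t & (P s -> P r)) ->
  (forall s, 0 < s <= t -> exists2 r, r < s & forall x, 0 <= x -> r < x < s -> P x -> P s) ->
  P t.
Proof.
move=> t0 P0 Pr Pl; pose E : set R := [set s | 0 <= s <= t /\ P s].
have E0 : E 0 by split=> //; rewrite lexx.
have supE : has_sup E by split; [exists 0|exists t => s [/andP[]]].
pose g := sup E.
have g0 : 0 <= g by apply: ub_le_sup => //; case: supE.
have gt' : g <= t by apply: ge_sup; [exists 0|move=> s [/andP[]]].
have Pg : P g.
  have [gE|gp] : g = 0 \/ 0 < g by move: g0; rewrite le_eqVlt => /orP[/eqP<-|]; [left|right].
    by rewrite gE.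
  have [|r rg Hr] := Pl g; first by rewrite gp.
  have d0 : 0 < g - r by rewrite subr_gt0.
  have [x [/andP[x0 xt] Px]] := sup_adherent d0 supE.
  rewrite -/g subKr => rx.
  have : x <= g by apply: ub_le_sup; [case: supE|split; rewrite ?x0].
  by rewrite le_eqVlt => /orP[/eqP<-//|xg]; apply: (Hr x) => //; rewrite rx.
have [gE|gp] : g = t \/ g < t by move: gt'; rewrite le_eqVlt => /orP[/eqP|]; [left|right].
  by rewrite -gE.
have [|r /andP[gr rt] Hr] := Pr g; first by rewrite g0.
have : r <= g.
  apply: ub_le_sup; first by case: supE.
  by split; [rewrite rt andbT (le_trans g0) // ltW|exact: Hr].
by rewrite leNgt gr.
Qed.

(** The length of a band of area at most e depends on its position, hence real induction instead of
    a fixed step. *)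
Lemma band_induction (P : R -> Prop) (t e : R) : 0 < e -> 0 <= t -> P 0 ->
  (forall s s', 0 <= s -> s < s' -> s' <= t -> level_area v `]s, s'[ <= e -> P s -> P s') ->
  P t.
Proof.
move=> e0 t0 P0 step; apply: real_induction => // s /andP[s0 st].
- have [r sr hr] := small_band_right s e0.
  exists (Num.min r t); first by rewrite lt_min sr st /= ge_min lexx orbT.
  move=> Ps; apply: (step _ _ s0 _ _ _ Ps); [by rewrite lt_min sr st|by rewrite ge_min lexx orbT|].
  apply: le_trans hr; apply: (level_area_le mv) => x; rewrite !in_itv /= lt_min.
  by move=> /and3P[-> ->].
- have [r rs hr] := small_band_left s e0; exists r => // x x0 /andP[rx xs] Px.
  apply: (step x _ x0 xs st _ Px); apply: le_trans hr; apply: (level_area_le mv) => y; rewrite !in_itv /=.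
  by move=> /andP[h ->]; rewrite (lt_trans rx h).
Qed.

End SmallBands.

(** * The logarithmic profile with slack *)

Section LogarithmicProfile.
Variables (R : realType) (k c : R).
Hypotheses (k0 : 0 <= k) (c0 : 0 <= c).

Definition log_profile (x : R) : R := (ln pi - ln x) / (4 * pi).

(** The ideal profile with room for multiplicative errors (the factor 1 + k) and additive ones
    (c). *)
Definition slack_profile (x : R) : R := (1 + k) * log_profile x + c.

(** An explicit antiderivative of the square of [slack_profile], as a function of the area x. *)
Definition profile_energy (x : R) : R :=
  ((1 + k) / (4 * pi)) ^+ 2 * (x * (ln pi - ln x) ^+ 2 + 2 * (x * (ln pi - ln x)) + 2 * x)
  + 2 * ((1 + k) / (4 * pi)) * c * (x * (ln pi - ln x) + x) + c ^+ 2 * x.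

Lemma is_derive_profile_energy (x : R) : 0 < x ->
  is_derive x 1 profile_energy (slack_profile x ^+ 2).
Proof.
move=> x0; have dl := is_derive1_ln x0.
pose L (y : R) := ln pi - ln y.
have dL : is_derive x 1 L (- x^-1).
  by apply: (is_derive_eq (is_deriveB (is_derive_cst (ln pi : R) x 1) dl)); rewrite sub0r.
have did : is_derive x 1 (id : R -> R) 1 by exact: is_derive_id.
have d1 : is_derive x 1 (fun y => y * L y) (L x - 1).
  apply: (is_derive_eq (is_deriveM did dL)); rewrite /GRing.scale/=.
  by field; rewrite gt_eqF.
have d2 : is_derive x 1 (fun y => y * L y * L y) (L x ^+ 2 - 2 * L x).
  apply: (is_derive_eq (is_deriveM d1 dL)); rewrite /GRing.scale/=.
  by field; rewrite gt_eqF.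
pose A : R := (1 + k) / (4 * pi).
have d3 : is_derive x 1 (fun y => A ^+ 2 * (y * L y * L y)) (A ^+ 2 * (L x ^+ 2 - 2 * L x)) by exact: is_deriveZ.
have d4 : is_derive x 1 (fun y => (2 * A ^+ 2 + 2 * A * c) * (y * L y)) ((2 * A ^+ 2 + 2 * A * c) * (L x - 1)) by exact: is_deriveZ.
have d5 : is_derive x 1 (fun y : R => (2 * A ^+ 2 + 2 * A * c + c ^+ 2) * y) ((2 * A ^+ 2 + 2 * A * c + c ^+ 2) * 1) by exact: is_deriveZ.
have d6 := is_deriveD (is_deriveD d3 d4) d5.
have E : profile_energy = (fun y => A ^+ 2 * (y * L y * L y)) + (fun y => (2 * A ^+ 2 + 2 * A * c) * (y * L y)) + (fun y : R => (2 * A ^+ 2 + 2 * A * c + c ^+ 2) * y).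
  by apply/funext => y; rewrite !fctE /profile_energy -/A -/(L y); ring.
rewrite E; apply: (is_derive_eq d6).
rewrite /slack_profile /log_profile -/(L x) (_ : (1 + k) * (L x / (4 * pi)) = A * L x).
  by ring.
by rewrite /A; ring.
Qed.

Lemma log_profile_le (x y : R) : 0 < x -> x <= y -> log_profile y <= log_profile x.
Proof.
move=> x0 xy; rewrite ler_pM2r ?invr_gt0 ?mulr_gt0 ?pi_gt0 // lerD2l lerN2.
by rewrite ler_ln ?posrE // (lt_le_trans x0).
Qed.

Lemma log_profile_ge0 (x : R) : 0 < x -> x <= pi -> 0 <= log_profile x.
Proof.
move=> x0 xp; rewrite divr_ge0 ?mulr_ge0 ?pi_ge0 // subr_ge0 ler_ln ?posrE //.
exact: pi_gt0.
Qed.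

Lemma slack_profile_le (x y : R) : 0 < x -> x <= y -> slack_profile y <= slack_profile x.
Proof.
by move=> x0 xy; rewrite lerD2r ler_wpM2l ?log_profile_le // addr_ge0.
Qed.

(** The slack profile decreases with the area, so V, bounded by its value at q, is bounded by it on
    all of [p, q]. *)
Lemma profile_energy_increment (p q V : R) : 0 < p -> p <= q -> 0 <= V ->
  V <= slack_profile q -> V ^+ 2 * (q - p) <= profile_energy q - profile_energy p.
Proof.
move=> p0 pq V0 Vq.
have dP (x : R) : x \in `]p, q[ -> is_derive x 1 profile_energy (slack_profile x ^+ 2).
  by rewrite in_itv /= => /andP[px _]; apply: is_derive_profile_energy; exact: lt_trans px.
have cP : {within `[p, q], continuous profile_energy}.
  apply: derivable_within_continuous => x; rewrite in_itv /= => /andP[px _].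
  by have d := is_derive_profile_energy (lt_le_trans p0 px); exact: (@ex_derive _ _ _ _ _ _ _ d).
have [x] := MVT_segment pq dP cP; rewrite in_itv /= => /andP[px xq] ->.
rewrite ler_wpM2r ?subr_ge0 // lerXn2r ?nnegrE //; last first.
  by apply: (le_trans Vq); apply: slack_profile_le => //; exact: lt_le_trans px.
apply: (le_trans V0); apply: (le_trans Vq); apply: slack_profile_le => //.
exact: lt_le_trans px.
Qed.

(** From ln(1 + x) >= x / (1 + x). It compares the increment b / (4 pi M) used on a band with that
    of the logarithm. *)
Lemma ln_increment (x : R) : 0 <= x -> x <= k -> x <= (1 + k) * ln (1 + x).
Proof.
move=> x0 xk; have x1 : 0 < 1 + x by lra.
have h : ln ((1 + x)^-1) <= - (x / (1 + x)).
  have e : (1 + x)^-1 = 1 + - (x / (1 + x)) by field; rewrite gt_eqF.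
  by rewrite [X in ln X]e; apply: le_ln1Dx; rewrite ltrN2 ltr_pdivrMr // mul1r; lra.
rewrite lnV ?posrE // lerN2 in h.
apply: (@le_trans _ _ ((1 + k) * (x / (1 + x)))); last by rewrite ler_wpM2l // addr_ge0.
by rewrite mulrA ler_pdivlMr // mulrC ler_wpM2r //; lra.
Qed.

End LogarithmicProfile.

(** * Arithmetic of one band *)

Section ProfileArithmetic.
Variable R : realType.

Lemma le_dist (x y e : R) : x + e <= y \/ y + e <= x -> e <= `|y - x|.
Proof.
move=> [h|h]; last rewrite distrC; apply: le_trans (ler_norm _).
  by rewrite lerBrDl.
by rewrite lerBrDl.
Qed.

(** b / (4 pi M) is the ideal increment. The summand k D keeps d positive on a band of zero area and
    leaves the margin tau for the band area of a nearby test function. *)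
Lemma band_constants (k M D b : R) : 0 < M -> 0 < D -> 0 <= b -> 0 < k ->
  exists tau d : R, [/\ 0 < tau, 0 < d, 4 * pi * M * d = b + tau &
    d = b / (4 * pi * M) + k * D].
Proof.
move=> M0 D0 b0 k0; have p4 : 0 < 4 * pi * M by rewrite !mulr_gt0 // pi_gt0.
exists (4 * pi * M * (k * D)), (b / (4 * pi * M) + k * D); split=> //.
- by rewrite !mulr_gt0 // pi_gt0.
- by rewrite ltr_wpDl ?mulr_gt0 // divr_ge0 // ltW.
- by rewrite mulrDr mulrCA divff ?mulr1 // gt_eqF.
Qed.

(** 1 - k accounts for the superlevel area lost when v is replaced by a test function, 1 + k for the
    slope of the smooth step against the linear one; the choice of d cancels everything else. *)
Lemma band_arithmetic (k d D M En a1 a2 b tau : R) : 0 < k -> 0 < d -> 0 < D -> 0 < M ->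
  0 <= En -> (1 - k) * M <= a1 -> a2 <= b + tau -> 4 * pi * M * d = b + tau ->
  4 * pi * (d ^+ 2 * a1) <= En * (d * (1 + k) / D * a2) ->
  (1 - k) / (1 + k) * D <= En.
Proof.
move=> k0 d0 D0 M0 En0 A1 A2 dE BE; have pp := pi_gt0 R.
have k1' : 0 < 1 + k by rewrite addr_gt0.
have c0 : 0 <= d * (1 + k) / D by rewrite divr_ge0 ?(ltW D0) // mulr_ge0 // ltW.
have X1 : 4 * pi * (d ^+ 2 * ((1 - k) * M)) <= En * (d * (1 + k) / D * (4 * pi * M * d)).
  apply: le_trans (le_trans BE _).
    by rewrite ler_pM2l ?mulr_gt0 // ler_pM2l ?exprn_gt0.
  by rewrite ler_wpM2l // ler_wpM2l // dE.
have Y0 : 0 < 4 * pi * M * d ^+ 2 / D by rewrite divr_gt0 // !mulr_gt0 // exprn_gt0.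
rewrite mulrAC ler_pdivrMr // -(ler_pM2l Y0).
apply: le_trans (le_trans X1 _); rewrite le_eqVlt; apply/orP; left; apply/eqP.
  by move: (pi : R) pp => p p0; field; rewrite gt_eqF.
by move: (pi : R) pp => p p0; field; rewrite gt_eqF.
Qed.

(** Ms, Mo and M are the areas of {v >= s}, {v > s} and {v >= s'}. Since b <= k M, the increment b /
    (4 pi M) is at most 1 + k times the rise of the logarithmic profile from Mo to M. The last bound
    evaluates the profile at Mo instead of M; this costs at most (1 + k) k / (4 pi) <= k / (2 pi),
    the origin of the constant (2 pi)^-1. *)
Lemma profile_increment_arithmetic (k t s s' V d b M Ms Mo : R) :
  0 < k -> k < 1 -> s < s' -> s' <= t -> 0 < M -> 0 <= b -> b <= k * M -> Mo = b + M -> Mo <= Ms ->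
  d = b / (4 * pi * M) + k * (s' - s) ->
  V <= (1 + k) * log_profile Ms + k * s ->
  [/\ V + d <= (1 + k) * log_profile M + k * s',
     V <= slack_profile k (k * (t + (2 * pi)^-1)) Ms &
     V + d <= slack_profile k (k * (t + (2 * pi)^-1)) Mo].
Proof.
move=> k0 k1 ss' s't M0 b0 bk MoE MoMs dE Vle; have pp := pi_gt0 R.
have Mo0 : 0 < Mo by rewrite MoE ltr_wpDl.
have Ms0 : 0 < Ms by exact: lt_le_trans MoMs.
have bm : b / M <= k by rewrite ler_pdivrMr.
have bm0 : 0 <= b / M by rewrite divr_ge0 // ltW.
have lnE : ln (1 + b / M) = ln Mo - ln M.
  by rewrite -ln_div ?posrE //; congr ln; rewrite MoE; field; rewrite gt_eqF.
have ln_mo : ln Mo <= ln Ms by rewrite ler_ln ?posrE.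
have p4 : 0 < 4 * pi :> R by rewrite mulr_gt0.
have V2le : V + d <= (1 + k) * log_profile M + k * s'.
  have i1 : b / (4 * pi * M) <= (1 + k) * (log_profile M - log_profile Ms).
    have -> : b / (4 * pi * M) = (b / M) / (4 * pi) by rewrite invfM mulrA mulrAC.
    have -> : (1 + k) * (log_profile M - log_profile Ms) = (1 + k) * (ln Ms - ln M) / (4 * pi).
      by rewrite /log_profile; move: (pi : R) pp => p p0; field; rewrite gt_eqF.
    rewrite ler_pM2r ?invr_gt0 //; apply: le_trans (ln_increment (ltW k0) bm0 bm) _.
    by apply: ler_wpM2l; [rewrite ltW // addr_gt0|rewrite lnE lerD2r].
  rewrite dE; move: i1 Vle; move: (b / _) (log_profile M) (log_profile Ms) => x lm lms i1 Vle; lra.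
split=> //.
  apply: (le_trans Vle); rewrite /slack_profile lerD2l ler_pM2l //.
  by rewrite ler_wpDr // ?invr_ge0 ?mulr_ge0 ?pi_ge0 // (le_trans (ltW ss')).
apply: (le_trans V2le); rewrite /slack_profile.
have i2 : log_profile M - log_profile Mo <= k / (4 * pi).
  have -> : log_profile M - log_profile Mo = ln (1 + b / M) / (4 * pi).
    by rewrite lnE /log_profile -mulrBl; congr (_ / _); ring.
  rewrite ler_pM2r ?invr_gt0 //; apply: le_trans (le_ln1Dx _) bm.
  by apply: lt_le_trans bm0; rewrite ltrN10.
have i3 : (1 + k) * (log_profile M - log_profile Mo) <= k / (2 * pi).
  have -> : k / (2 * pi) = 2 * (k / (4 * pi)).
    by move: (pi : R) pp => p p0; field; rewrite gt_eqF.
  apply: (@le_trans _ _ ((1 + k) * (k / (4 * pi)))).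
    by apply: ler_wpM2l => //; rewrite ltW // addr_gt0.
  by rewrite ler_wpM2r ?divr_ge0 ?(ltW k0) ?(ltW p4) //; lra.
have i4 : k * s' <= k * t by rewrite ler_pM2l.
rewrite mulrDr; move: i3 i4.
move: (log_profile M) (log_profile Mo) (k / _) => lm lmo x; lra.
Qed.

End ProfileArithmetic.

(** * Construction of the profile up to the level t *)

Section Profiles.
Variable R : realType.
Local Notation mu2 := (@lebesgue2 R).
Local Notation D := (@unit_disc R).
Variables (v : R * R -> R) (k t : R).
Hypothesis Lv : L2 mu2 D v.
Hypotheses (k0 : 0 < k) (k1 : k < 1).

Local Notation m s := (level_area v `[s, +oo[).
(** k t covers the terms k (s' - s) accumulated over the bands, and k / (2 pi) the comparison of
    areas within one band. *)
Definition slack : R := k * (t + (2 * pi)^-1).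
Local Notation c := slack.

Hypotheses (t0 : 0 < t) (mt : 0 < m t).

Let mv : measurable_fun (D : set (borel_plane R)) v. Proof. by case: Lv. Qed.

(* F is smooth, is constant equal to V above the level s, and differs from the ideal profile
   x |-> log_profile (m x) only by errors that vanish with k. The Dirichlet bound is required for
   all test functions near v because v itself is only weakly differentiable. *)
Definition good_profile (s : R) : Prop :=
  exists F g : R -> R, exists V C e : R,
  [/\ [/\ smooth1 F, forall x : R, is_derive x 1 F (g x), forall x, 0 <= g x <= C &
          forall x, x <= 0 -> F x = 0],
      [/\ forall x, s <= x -> F x = V, 0 <= V & V <= (1 + k) * log_profile (m s) + k * s],
      0 < e /\ forall phi, test_function D phi ->
        \int[mu2]_(x in D) ((phi x - v x) ^+ 2) <= e ->
        (1 - k) / (1 + k) * s <= \int[mu2]_(x in D) (g (phi x) * grad_sq phi x) &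
      \int[mu2]_(x in level v `]-oo, s[) (F (v x) ^+ 2) <=
        profile_energy k c pi - profile_energy k c (m s)].

Lemma superlevel_gt0 s : s <= t -> 0 < m s.
Proof.
move=> st; apply: (lt_le_trans mt); apply: level_area_le => // x.
by rewrite !in_itv /= !andbT; exact: le_trans.
Qed.

Lemma slack_ge0 : 0 <= c.
Proof.
rewrite /slack mulr_ge0 ?(ltW k0) // addr_ge0 ?(ltW t0) // invr_ge0 mulr_ge0 //.
exact: pi_ge0.
Qed.

Lemma good_profile0 : good_profile 0.
Proof.
have kp0 := k0; have kp1 := k1; have m0 := superlevel_gt0 (ltW t0).
have mpi : m 0 <= pi by exact: level_area_le_pi.
exists (cst 0), (cst 0), 0, 0, 1; split.
- split; [by move=> n; exact: Cn_cst|by move=> x; exact: is_derive_cst| |by []].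
  by move=> x; rewrite lexx.
- split=> //; rewrite mulr0 addr0 mulr_ge0 //; first by rewrite addr_ge0 // ltW.
  exact: log_profile_ge0.
- split=> // phi _ _; rewrite mulr0; apply: Rintegral_ge0 => x _.
  by rewrite mul0r.
- rewrite (_ : Rintegral _ _ _ = 0); last first.
    by rewrite -(Rintegral_set0 mu2 (fun=> 0)) /Rintegral integral_set0 integral0_eq // => x _; rewrite expr0n.
  have := @profile_energy_increment R k c (ltW k0) (m 0) pi 0 m0 mpi (lexx 0).
  rewrite expr0n mul0r; apply.
  by rewrite addr_ge0 ?slack_ge0 // mulr_ge0 ?log_profile_ge0 ?pi_gt0 // addr_ge0 // ltW.
Qed.

Lemma disc_measurable : measurable (D : set (borel_plane R)).
Proof. exact: unit_disc_measurable. Qed.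

Lemma comp_bounded_integrable (F : R -> R) (C : R) :
  continuous F -> (forall x, `|F x| <= C) -> mu2.-integrable D (EFin \o (fun x => F (v x))).
Proof.
move=> cF FC; apply: (bounded_integrable_plane (C := C)) => //.
- exact: unit_disc_measurable.
- exact: unit_disc_ltoo.
- by apply: measurableT_comp => //; exact: continuous_measurable_fun.
Qed.

Lemma continuous_grad_sq (phi : R * R -> R) : smooth phi -> continuous (grad_sq phi).
Proof.
move=> Sphi.
rewrite (_ : grad_sq phi = (fun x => partials [:: ord0] phi x ^+ 2 + partials [:: ord_max] phi x ^+ 2)).
  by apply: continuousD2; apply: continuousM2; exact/smooth_continuous/smooth_partial.
by apply/funext => z; exact: grad_sqE.
Qed.

Lemma test_L2 (phi : R * R -> R) : test_function D phi -> L2 mu2 D phi.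
Proof. by move=> [Sphi _ _]; apply: continuous_L2; exact: smooth_continuous. Qed.

(* One band is added to the profile: on the band, Cauchy-Schwarz and the sharp
   Sobolev inequality bound the weighted Dirichlet energy from below. *)
Lemma band_energy_lower (s s' : R) : 0 <= s -> s < s' -> s' <= t ->
  level_area v `]s, s'[ <= k * m t ->
  exists H h : R -> R, exists d C e : R,
  [/\ [/\ smooth1 H, forall x : R, is_derive x 1 H (h x), forall x, 0 <= h x <= C &
          forall x, x <= s -> H x = 0],
      [/\ forall x, s' <= x -> H x = d, 0 <= d &
          d = level_area v `]s, s'[ / (4 * pi * m s') + k * (s' - s)] &
      0 < e /\ forall phi, test_function D phi ->
        \int[mu2]_(x in D) ((phi x - v x) ^+ 2) <= e ->
        (1 - k) / (1 + k) * (s' - s) <= \int[mu2]_(x in D) (h (phi x) * grad_sq phi x)].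
Proof.
have kp0 := k0; have kp1 := k1; have tp0 := t0.
move=> s0 ss' s't bk; have m'0 := superlevel_gt0 s't.
have pp := pi_gt0 R.
have De : 0 < s' - s by rewrite subr_gt0.
have b0 : 0 <= level_area v `]s, s'[ by exact: level_area_ge0.
have [tau [d [tau0 d0 dE dE']]] := band_constants m'0 De b0 k0.
have [H [h [eta [[eta0 lohi SH dH] [h01 h0 Hlo Hhi]]]]] := exists_linear_step ss' d0 k0.
(* By Chebyshev at distance [eta], this bound lets the band area of phi exceed that of v by at most
   [tau], and its superlevel area fall short by at most [k * m s']. *)
exists H, h, d, (d * (1 + k) / (s' - s)), (eta ^+ 2 * Num.min tau (k * m s')); split.
- by split; [exact: SH|exact: dH|exact: h01|by move=> x xs; apply: Hlo; rewrite (le_trans xs) // lerDl ltW].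
- by split; [by move=> x xs; apply: Hhi; rewrite (le_trans _ xs) // lerBlDr lerDl ltW|exact: ltW|].
have e0 : 0 < eta ^+ 2 by rewrite exprn_gt0.
split; first by apply: mulr_gt0; [exact: e0|rewrite lt_min tau0 (mulr_gt0 kp0 m'0)].
move=> phi Tphi; set I := \int[mu2]_(x in D) _; set En := \int[mu2]_(x in D) _ => Ie.
have [h1 h2] : I / eta ^+ 2 <= tau /\ I / eta ^+ 2 <= k * m s'.
  have : I / eta ^+ 2 <= Num.min tau (k * m s') by rewrite ler_pdivrMr // mulrC.
  by rewrite le_min => /andP[].
have Lphi := test_L2 Tphi; have [mphi _] := Lphi.
have L1 := L2B disc_measurable Lphi Lv; have L2' := L2B disc_measurable Lv Lphi.
have A1 : (1 - k) * m s' <= level_area phi `[s' - eta, +oo[.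
  have := @level_area_close R v phi (`[s', +oo[) (`[s' - eta, +oo[) eta mv mphi L1 eta0.
  rewrite -/I -/(m s') => hh; have {}hh : m s' <= level_area phi `[s' - eta, +oo[ + I / eta ^+ 2.
    apply: hh => x y; rewrite !in_itv /= !andbT -ltNge => xs ys.
    by apply: le_dist; right; rewrite -lerBrDr (le_trans (ltW ys)) // lerD2r.
  by rewrite mulrBl mul1r lerBlDr; apply: (le_trans hh); rewrite lerD2l.
have A2 : level_area phi `[s + eta, s' - eta] <= level_area v `]s, s'[ + tau.
  have := @level_area_close R phi v (`[s + eta, s' - eta]) (`]s, s'[) eta mphi mv L2' eta0.
  have -> : \int[mu2]_(x in D) ((v x - phi x) ^+ 2) = I.
    by apply: eq_Rintegral => x _; rewrite -sqrrN opprB.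
  move=> hh; apply: le_trans (hh _) _; last by rewrite lerD2l.
  move=> x y; rewrite !in_itv /= negb_and -!leNgt => /andP[x1 x2] /orP[ys|ys].
    by apply: le_dist; right; apply: le_trans x1; rewrite lerD2r.
  by apply: le_dist; left; apply: le_trans ys; rewrite -lerBrDr.
have lo0 : 0 <= s + eta by rewrite addr_ge0 // ltW.
have := band_energy Tphi SH dH h01 h0 Hlo Hhi lo0 (ltW d0).
rewrite -/En => BE.
have En0 : 0 <= En.
  apply: Rintegral_ge0 => x _; rewrite mulr_ge0 //; first by case/andP: (h01 (phi x)).
  by apply: sumr_ge0 => i _; exact: sqr_ge0.
exact: (band_arithmetic kp0 d0 De m'0 En0 A1 A2 dE BE).
Qed.

Lemma level_mem (I : interval R) x : x \in level v I -> v x \in I.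
Proof. by rewrite inE => -[_ /=]. Qed.

Local Opaque level_area level Rintegral profile_energy log_profile slack_profile.

(** The step H of the new band is added to F. The Dirichlet bounds add up. The squared integral is
    unchanged below s, equals V^2 times the area on {v = s} and is at most (V + d)^2 times the area
    on the open band; the last two are compared with increments of [profile_energy]. *)
Lemma good_profile_step (s s' : R) : 0 <= s -> s < s' -> s' <= t ->
  level_area v `]s, s'[ <= k * m t -> good_profile s -> good_profile s'.
Proof.
have kp0 := k0; have kp1 := k1; have tp0 := t0.
move=> s0 ss' s't bk.
move=> [F [g [V [C [e [[SF dF g01 Flo] [Fhi V0 Vle] [e0 Fe] Fn]]]]]].
have [H [h [d [C' [e' [[SH dH h01 Hlo] [Hhi d0 dE] [e'0 He]]]]]]] := band_energy_lower s0 ss' s't bk.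
have pp := pi_gt0 R.
have m'0 := superlevel_gt0 s't.
have st : s <= t by exact: le_trans (ltW ss') s't.
have ms0 := superlevel_gt0 st.
have [b bE] : exists b, b = level_area v `]s, s'[ by eexists; exact: erefl.
(* [mo] differs from [m s] by the area of {v = s}, which may be positive. *)
have [mo moD] : exists mo, mo = level_area v `]s, +oo[ by eexists; exact: erefl.
rewrite -bE in bk dE; have b0 : 0 <= b by rewrite bE; exact: level_area_ge0.
have moE : mo = b + m s'.
  rewrite moD bE; apply: level_area_split => // x; rewrite !in_itv /= ?andbT.
    by have [xs|xs] := leP s' x; rewrite ?andbT ?andbF ?orbF ?orbT // (lt_le_trans ss').
  by move=> /andP[_ h1]; rewrite leNgt h1.
have msE : m s = level_area v `[s, s] + mo.
  rewrite moD; apply: level_area_split => // x; rewrite !in_itv /= ?andbT -?eq_le.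
    by rewrite le_eqVlt.
  by move=> /eqP <-; rewrite ltxx.
have bs0 : 0 <= level_area v `[s, s] by exact: level_area_ge0.
have mo0 : 0 < mo by rewrite moE; exact: (ltr_wpDl b0 m'0).
have mspi : m s <= pi by exact: level_area_le_pi.
have mt' : m t <= m s'.
  apply: level_area_le => // x; rewrite !in_itv /= !andbT; exact: le_trans.
have bkm : b <= k * m s' by apply: (le_trans bk); rewrite ler_pM2l.
have moms : mo <= m s by rewrite msE lerDr; exact: bs0.
have [V2le Vslack V2slack] := profile_increment_arithmetic k0 k1 ss' s't m'0 b0 bkm moE moms dE Vle.
have V20 : 0 <= V + d by rewrite addr_ge0.
have gF (x : R) : is_derive x 1 (fun x => F x + H x) (g x + h x).
  by have := dF x; have := dH x => ? ?; exact: is_deriveD.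
have gh01 x : 0 <= g x + h x <= C + C'.
  by have /andP[? ?] := g01 x; have /andP[? ?] := h01 x; rewrite addr_ge0 // lerD.
have FH1 x : x <= s -> F x + H x = F x by move=> xs; rewrite Hlo // addr0.
have FH2 x : s' <= x -> F x + H x = V + d.
  by move=> xs; rewrite Hhi // Fhi // (le_trans _ xs) // ltW.
have gh0 x : 0 <= g x + h x by case/andP: (gh01 x).
have FHmono := derive_ge0_nondecreasing gF gh0.
have FH01 x : 0 <= F x + H x <= V + d.
  apply/andP; split.
    have [xs|xs] := leP x 0; first by rewrite Flo // Hlo ?addr0 // (le_trans xs).
    rewrite -[X in X <= _](_ : F 0 + H 0 = 0); first by apply: FHmono; exact: ltW.
    by rewrite Flo // Hlo // addr0.
  have [xs|xs] := leP s' x; first by rewrite FH2.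
  by rewrite -(FH2 s') //; apply: FHmono; exact: ltW.
exists (fun x => F x + H x), (fun x => g x + h x), (V + d), (C + C'), (Num.min e e'); split.
- split=> //; first by move=> n; apply: CnD; [exact: SF|exact: SH].
  by move=> x xs; rewrite Flo // Hlo ?addr0 // (le_trans xs).
- by split.
- split; first by rewrite lt_min e0.
  move=> phi Tphi; rewrite le_min => /andP[Ie Ie'].
  have [Sphi _ _] := Tphi.
  have cphi := smooth_continuous Sphi.
  have cgr := continuous_grad_sq Sphi.
  have Sg := smooth1_derive SF dF; have Sh := smooth1_derive SH dH.
  have i1 : mu2.-integrable D (EFin \o (fun x => g (phi x) * grad_sq phi x)).
    apply: continuous_integrable_disc; apply: continuousM2 => // x.
    by apply: (continuous_comp (cphi x)); exact: (Cn_continuous (Sg 0%N)).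
  have i2 : mu2.-integrable D (EFin \o (fun x => h (phi x) * grad_sq phi x)).
    apply: continuous_integrable_disc; apply: continuousM2 => // x.
    by apply: (continuous_comp (cphi x)); exact: (Cn_continuous (Sh 0%N)).
  have -> : \int[mu2]_(x in D) ((g (phi x) + h (phi x)) * grad_sq phi x) =
     \int[mu2]_(x in D) (g (phi x) * grad_sq phi x) + \int[mu2]_(x in D) (h (phi x) * grad_sq phi x).
    by rewrite -(RintegralD disc_measurable i1 i2); apply: eq_Rintegral => x _; rewrite mulrDl.
  have a1 := Fe phi Tphi Ie; have a2 := He phi Tphi Ie'.
  by apply: le_trans (lerD a1 a2); rewrite -mulrDr subrKC.
- have cFH : continuous (fun x => F x + H x) by exact: (is_derive_continuous gF).
  have iq : mu2.-integrable D (EFin \o (fun x => (F (v x) + H (v x)) ^+ 2)).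
    apply: (@comp_bounded_integrable (fun x => (F x + H x) ^+ 2) ((V + d) ^+ 2)).
      by move=> x; apply: (@continuous_comp _ _ _ (fun x => F x + H x) (fun x : R => x ^+ 2)); [exact: cFH|exact: exprn_continuous].
    move=> x; rewrite ger0_norm ?sqr_ge0 // lerXn2r ?nnegrE //; by case/andP: (FH01 x).
  have mI I := level_measurable I mv.
  have iqI I : mu2.-integrable (level v I) (EFin \o (fun x => (F (v x) + H (v x)) ^+ 2)).
    by apply: integrableS iq => //; [exact: disc_measurable|exact: level_sub].
  rewrite (level_Rintegral_split (J := `]-oo, s]) (K := `]s, s'[) mv _ _ iq); last 2 first.
  + move=> x; rewrite !in_itv /=; have [xs|xs] := leP x s; last by [].
    by rewrite (le_lt_trans xs ss').
  + by move=> x; rewrite !in_itv /= => xs /andP[sx _]; rewrite leNgt sx in xs.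
  rewrite (level_Rintegral_split (J := `]-oo, s[) (K := `[s, s]) mv _ _ iq); last 2 first.
  + by move=> x; rewrite !in_itv /= -eq_le le_eqVlt orbC (eq_sym x).
  + by move=> x; rewrite !in_itv /= => xs /andP[sx _]; rewrite ltNge sx in xs.
  have I1 : \int[mu2]_(x in level v `]-oo, s[) ((F (v x) + H (v x)) ^+ 2) =
            \int[mu2]_(x in level v `]-oo, s[) (F (v x) ^+ 2).
    apply: eq_Rintegral => x /level_mem; rewrite in_itv /= => xs.
    by rewrite FH1 // ltW.
  have I2 : \int[mu2]_(x in level v `[s, s]) ((F (v x) + H (v x)) ^+ 2) = V ^+ 2 * level_area v `[s, s].
    rewrite -(Rintegral_cst mu2 (mI `[s, s])); apply: eq_Rintegral => x /level_mem.
    by rewrite in_itv /= => /andP[x1 x2]; rewrite FH1 // Fhi.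
  have I3 : \int[mu2]_(x in level v `]s, s'[) ((F (v x) + H (v x)) ^+ 2) <= (V + d) ^+ 2 * b.
    rewrite bE -(Rintegral_cst mu2 (mI `]s, s'[)); apply: le_Rintegral => //.
      apply: (@integrableS _ _ _ mu2 D) => //; [exact: disc_measurable|exact: level_sub|].
      by apply: (continuous_integrable_disc (f := cst ((V + d) ^+ 2))) => x; exact: cvg_cst.
    move=> x _; rewrite lerXn2r ?nnegrE //; by case/andP: (FH01 (v x)).
  have P1 := profile_energy_increment (ltW k0) mo0 (_ : mo <= m s) V0 Vslack.
  have P2 := profile_energy_increment (ltW k0) m'0 (_ : m s' <= mo) V20 V2slack.
  have {}P1 : V ^+ 2 * level_area v `[s, s] <= profile_energy k c (m s) - profile_energy k c mo.
    by have := P1 moms; rewrite {1}msE addrK.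
  have mom' : m s' <= mo by rewrite moE lerDr.
  have {}P2 : (V + d) ^+ 2 * b <= profile_energy k c mo - profile_energy k c (m s').
    by have := P2 mom'; rewrite {1}moE addrK.
  have tele (a1 a2 a3 a4 : R) : a1 - a4 = (a1 - a2) + (a2 - a3) + (a3 - a4) by rewrite !subrKA.
  rewrite I1 I2 (tele _ (profile_energy k c (m s)) (profile_energy k c mo)).
  exact: lerD (lerD Fn P1) (le_trans I3 P2).
Qed.

(** The tolerance [k * m t] on the area of a band is at most [k * m s'] at every level s' <= t, so
    it suits all the steps. *)
Lemma good_profile_top : good_profile t.
Proof.
exact: (band_induction mv (mulr_gt0 k0 mt) (ltW t0) good_profile0 good_profile_step).
Qed.

End Profiles.

(** * The capacity inequality *)

Section CapacityBound.
Variable R : realType.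
Local Notation mu2 := (@lebesgue2 R).
Local Notation D := (@unit_disc R).

(** Used twice: to remove the error of approximating v by test functions, then to let the loss
    parameter tend to 0. *)
Lemma le_of_small_error (x y C : R) :
  (forall k, 0 < k -> k < 1 -> x <= y + k * C) -> x <= y.
Proof.
move=> H; rewrite leNgt; apply/negP => yx.
have d0 : 0 < x - y by rewrite subr_gt0.
have C0 : 0 < 2 * (`|C| + 1) by rewrite mulr_gt0 // ltr_wpDl.
pose k := Num.min 2^-1 ((x - y) / (2 * (`|C| + 1))).
have k0 : 0 < k by rewrite lt_min invr_gt0 ltr0n divr_gt0.
have k1 : k < 1 by rewrite gt_min; apply/orP; left; rewrite invf_lt1 // ltr1n.
have kC : k * (`|C| + 1) <= (x - y) / 2.
  have : k <= (x - y) / (2 * (`|C| + 1)) by rewrite ge_min lexx orbT.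
  rewrite ler_pdivlMr // => h; rewrite ler_pdivlMr //; apply: le_trans h.
  by rewrite mulrAC mulrA (mulrC _ 2) -mulrA mulrCA.
have := H k k0 k1.
have h1 : k * C <= k * `|C| by rewrite ler_wpM2l ?ler_norm // ltW.
move: k0 kC h1; move: (k * C) (`|C|) => X A; lra.
Qed.

(** Linearization of the losses at k = 0: (1 - k)^2 >= 1 - 2 k, while (1 + k)^4 <= 1 + 15 k and (1 +
    k)^2 <= 4 for 0 < k < 1. *)
Lemma small_parameter_arithmetic (k T N J X Y : R) : 0 < k -> k < 1 -> 0 <= T ->
  0 <= N -> 0 <= J -> 0 <= X -> 0 <= Y ->
  (1 - k) ^+ 2 * T <= (1 + k) ^+ 2 * (N * ((1 + k) ^+ 2 * J + k * ((1 + k) * X + k * Y))) ->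
  T <= N * J + k * (2 * T + N * (15 * J + 4 * (2 * X + Y))).
Proof.
move=> k0 k1 T0 N0 J0 X0 Y0 h3.
have k1' : 0 < 1 + k by rewrite addr_gt0.
have q1 : (1 - 2 * k) * T <= (1 - k) ^+ 2 * T by rewrite ler_wpM2r //; nra.
have kk : k ^+ 2 <= k by rewrite expr2 ler_piMl // ltW.
have p2 : (1 + k) ^+ 2 <= 1 + 3 * k by nra.
have p2' : (1 + k) ^+ 2 <= 4 by nra.
have p4 : (1 + k) ^+ 4 <= 1 + 15 * k.
  rewrite (_ : (1 + k) ^+ 4 = (1 + k) ^+ 2 * (1 + k) ^+ 2); last by ring.
  apply: le_trans (ler_pM (sqr_ge0 _) (sqr_ge0 _) p2 p2) _; nra.
have q2 : (1 + k) ^+ 2 * (N * ((1 + k) ^+ 2 * J + k * ((1 + k) * X + k * Y))) <= N * J + k * (N * (15 * J + 4 * (2 * X + Y))).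
  rewrite mulrCA (_ : N * J + _ = N * (J + k * (15 * J + 4 * (2 * X + Y)))); last by ring.
  apply: ler_wpM2l => //; rewrite mulrDr.
  have r1 : (1 + k) ^+ 2 * ((1 + k) ^+ 2 * J) <= (1 + 15 * k) * J.
    by rewrite mulrA -exprD ler_wpM2r.
  have r2 : (1 + k) ^+ 2 * (k * ((1 + k) * X + k * Y)) <= 4 * (k * (2 * X + Y)).
    apply: ler_pM => //; first exact: sqr_ge0.
      by rewrite mulr_ge0 ?(ltW k0) // addr_ge0 // mulr_ge0 // ltW.
    rewrite ler_wpM2l ?(ltW k0) //; apply: lerD.
      by rewrite ler_wpM2r // -[2]/(1 + 1) lerD2l ltW.
    by rewrite ler_piMl // ltW.
  apply: le_trans (lerD r1 r2) _; rewrite le_eqVlt; apply/orP; left; apply/eqP; ring.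
have h4 := le_trans q1 (le_trans h3 q2).
rewrite -lerBlDr; apply: le_trans (_ : (1 - 2 * k) * T - k * (N * (15 * J + 4 * (2 * X + Y))) <= _).
  by rewrite le_eqVlt; apply/orP; left; apply/eqP; ring.
by rewrite lerBlDr.
Qed.

(* The integral over [0, pi] of the square of x |-> log_profile (max x a). *)
Definition log_capacity_energy (a : R) : R :=
  (2 * pi - 2 * (a * (ln pi - ln a)) - 2 * a) / (16 * pi ^+ 2).

(** Isolates the energy of the ideal truncated profile: once the slack is written k b, every other
    term carries a factor k. *)
Lemma profile_energy_limit (k b a : R) : 0 < a ->
  profile_energy k (k * b) pi - profile_energy k (k * b) a + slack_profile k (k * b) a ^+ 2 * a =
  (1 + k) ^+ 2 * log_capacity_energy a + k * ((1 + k) * b * (pi - a) / (2 * pi) + k * b ^+ 2 * pi).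
Proof.
move=> a0; have pp := pi_gt0 R.
rewrite /profile_energy /slack_profile /log_profile /log_capacity_energy subrr.
by move: (pi : R) pp (ln _) (ln a) => p p0 lp la; field; rewrite gt_eqF.
Qed.

Lemma log_capacity_energy_ge0 (a : R) : 0 < a -> a <= pi -> 0 <= log_capacity_energy a.
Proof.
move=> a0 api; have pp := pi_gt0 R; apply: divr_ge0; last by apply: mulr_ge0 => //; exact: sqr_ge0.
have h : ln (pi / a) <= pi / a - 1.
  rewrite {1}(_ : pi / a = 1 + (pi / a - 1)); last by rewrite subrKC.
  by apply: le_ln1Dx; rewrite ltrBDr addNr divr_gt0.
rewrite ln_div ?posrE // in h.
have h2 : a * (ln pi - ln a) <= pi - a.
  by apply: le_trans (ler_wpM2l (ltW a0) h) _; rewrite mulrBr mulr1 mulrCA divff ?mulr1 // gt_eqF.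
by move: h2; move: (a * (ln pi - ln a)) (pi : R) => X p; lra.
Qed.

Variables (v f : R * R -> R) (G : 'I_2 -> R * R -> R) (t : R).
Hypotheses (Lv : L2 mu2 D v) (Lf : L2 mu2 D f) (LG : forall i, L2 mu2 D (G i)).
Hypothesis green : forall psi, test_function D psi ->
  \int[mu2]_(x in D) (f x * psi x) =
  \sum_(i < 2) \int[mu2]_(x in D) (G i x * partials [:: i] psi x).
Hypothesis approx : forall e, 0 < e -> exists phi, [/\ test_function D phi,
  norm2 mu2 D (fun x => phi x - v x) <= e &
  forall i, norm2 mu2 D (fun x => partials [:: i] phi x - G i x) <= e].
Hypotheses (t0 : 0 < t) (at0 : 0 < level_area v `[t, +oo[).

Local Notation a := (level_area v `[t, +oo[).

(** G stands for the weak gradient of v and f for - Delta v. Green's identity is tested with F(phi),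
    phi close to v: its gradient side is close to the weighted Dirichlet energy bounded below by
    [good_profile], its other side is bounded by Cauchy-Schwarz, and the Lipschitz bound on F
    replaces phi by v. The profile is fixed before phi, so the errors may depend on its slope bound
    C. *)
Lemma profile_duality (k : R) : 0 < k -> k < 1 ->
  (1 - k) / (1 + k) * t <= norm2 mu2 D f *
    Num.sqrt (profile_energy k (slack k t) pi - profile_energy k (slack k t) a +
              slack_profile k (slack k t) a ^+ 2 * a).
Proof.
move=> k0 k1; have mD := @unit_disc_measurable R.
have [mv _] := Lv.
have [F [g [V [C [e [[SF dF g01 Flo] [Fhi V0 Vle] [e0 Fe] Fn]]]]]] := good_profile_top Lv k0 k1 t0 at0.
set J := (X in Num.sqrt X).
have gge x : 0 <= g x by case/andP: (g01 x).
have C0 : 0 <= C by have /andP[h1 h2] := g01 0; exact: le_trans h2.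
have Flip := derive_bounded_lipschitz dF (fun x => (_ : `|g x| <= C)).
have {}Flip x y : `|F x - F y| <= C * `|x - y|.
  by apply: Flip => z; rewrite ger0_norm //; case/andP: (g01 z).
have Fmono := derive_ge0_nondecreasing dF gge.
have F01 x : 0 <= F x <= V.
  apply/andP; split.
    have [xs|xs] := leP x 0; first by rewrite Flo.
    by rewrite -(Flo 0) //; apply: Fmono; exact: ltW.
  have [xs|xs] := leP t x; first by rewrite Fhi.
  by rewrite -(Fhi t) //; apply: Fmono; exact: ltW.
have cF := is_derive_continuous dF.
have iF : mu2.-integrable D (EFin \o (fun x => F (v x) ^+ 2)).
  apply: (@comp_bounded_integrable R v Lv (fun x => F x ^+ 2) (V ^+ 2)).
    by move=> x; apply: (@continuous_comp _ _ _ F (fun x : R => x ^+ 2)); [exact: cF|exact: exprn_continuous].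
  move=> x; rewrite ger0_norm ?sqr_ge0 // lerXn2r ?nnegrE //; by case/andP: (F01 x).
have mF : measurable_fun (D : set (borel_plane R)) (fun x => F (v x)).
  by apply: measurableT_comp => //; exact: continuous_measurable_fun.
have LF : L2 mu2 D (fun x => F (v x)) by [].
have Vs : V <= slack_profile k (slack k t) a.
  apply: (le_trans Vle); rewrite /slack_profile lerD2l /slack ler_pM2l // lerDl.
  by rewrite invr_ge0 mulr_ge0 // pi_ge0.
have FJ : norm2 mu2 D (fun x => F (v x)) <= Num.sqrt J.
  rewrite ler_wsqrtr //.
  have -> : \int[mu2]_(x in D) (F (v x) ^+ 2) = \int[mu2]_(x in level v `]-oo, +oo[) (F (v x) ^+ 2).
    by congr (Rintegral _ _ _); apply/seteqP; split=> x; [move=> Dx; split=> //=; rewrite in_itv|case].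
  rewrite (level_Rintegral_split (J := `]-oo, t[) (K := `[t, +oo[) mv _ _ iF); last 2 first.
  - by move=> x; rewrite !in_itv /= andbT; case: ltP.
  - by move=> x; rewrite !in_itv /= andbT ltNge => /negP.
  apply: lerD; first exact: Fn.
  have mt := level_measurable `[t, +oo[ mv.
  have -> : \int[mu2]_(x in level v `[t, +oo[) (F (v x) ^+ 2) = V ^+ 2 * a.
    rewrite -(Rintegral_cst mu2 mt); apply: eq_Rintegral => x /level_mem.
    by rewrite in_itv /= andbT => xt; rewrite Fhi.
  by rewrite ler_wpM2r ?level_area_ge0 // lerXn2r ?nnegrE // (le_trans V0).
have n0 := norm2_ge0 mu2 D f.
pose K := norm2 mu2 D f * C + \sum_(i < 2) (C * (norm2 mu2 D (G i) + 1)).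
apply: (@le_of_small_error _ _ K) => eps eps0 eps1.
(* [sqrt e] brings phi into the range where the Dirichlet bound of the profile holds; [eps] controls
   the other errors. *)
pose e1 := Num.min eps (Num.sqrt e).
have e10 : 0 < e1 by rewrite lt_min eps0 sqrtr_gt0.
have [phi [Tphi hv hG]] := approx e10.
have e1e : e1 <= eps by rewrite ge_min lexx.
have Lphi := test_L2 Tphi; have [Sphi _ _] := Tphi.
have Lpv := L2B mD Lphi Lv.
have Ie : \int[mu2]_(x in D) ((phi x - v x) ^+ 2) <= e.
  rewrite -norm2_square -(sqr_sqrtr (ltW e0)) lerXn2r ?nnegrE ?norm2_ge0 ?sqrtr_ge0 //.
  by apply: (le_trans hv); rewrite ge_min lexx orbT.
have cphi := smooth_continuous Sphi.
have Sg := smooth1_derive SF dF.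
have cg : continuous (fun x => g (phi x)).
  by move=> x; apply: (continuous_comp (cphi x)); exact: (Cn_continuous (Sg 0%N)).
have cp i : continuous (partials [:: i] phi) by apply/smooth_continuous/smooth_partial.
have Lp i : L2 mu2 D (partials [:: i] phi) by exact: continuous_L2.
have Lgp i : L2 mu2 D (fun x => g (phi x) * partials [:: i] phi x).
  by apply: continuous_L2; exact: continuousM2.
have TF : test_function D (F \o phi) by apply: test_function_comp => //; exact: Flo.
have LFp := test_L2 TF.
have dFp i x : partials [:: i] (F \o phi) x = g (phi x) * partials [:: i] phi x.
  have [SFp _ _] := TF.
  have d1 := smooth_is_derive i x SFp.
  have d2 := is_derive_comp_line (dF (phi x)) (smooth_is_derive i x Sphi).
  by have [_ <-] := d1; have [_ <-] := d2.
apply: (le_trans (Fe phi Tphi Ie)).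
(* One factor grad phi is split as G + (grad phi - G): the first part is Green's identity for
   F(phi), the second is small. *)
have E1 : \int[mu2]_(x in D) (g (phi x) * grad_sq phi x) =
    \sum_(i < 2) (\int[mu2]_(x in D) (G i x * (g (phi x) * partials [:: i] phi x)) +
      \int[mu2]_(x in D) ((partials [:: i] phi x - G i x) * (g (phi x) * partials [:: i] phi x))).
  have i1 i := L2M_integrable mD (Lp i) (Lgp i).
  have -> : \int[mu2]_(x in D) (g (phi x) * grad_sq phi x) =
      \int[mu2]_(x in D) (partials [:: ord0] phi x * (g (phi x) * partials [:: ord0] phi x) +
        partials [:: ord_max] phi x * (g (phi x) * partials [:: ord_max] phi x)).
    by apply: eq_Rintegral => x _; rewrite grad_sqE mulrDr; congr (_ + _); rewrite expr2 mulrCA.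
  rewrite (RintegralD mD (i1 _) (i1 _)) big_ord_recl big_ord1.
  have -> : lift ord0 ord0 = ord_max :> 'I_2 by exact/val_inj.
  congr (_ + _); rewrite -RintegralD //; try (by apply: eq_Rintegral => x _; ring);
    by apply: L2M_integrable => //; exact: L2B.
have E2 : \sum_(i < 2) \int[mu2]_(x in D) (G i x * (g (phi x) * partials [:: i] phi x)) =
    \int[mu2]_(x in D) (f x * (F \o phi) x).
  by rewrite green //; apply: eq_bigr => i _; apply: eq_Rintegral => x _; rewrite dFp.
rewrite E1 big_split /= E2.
have Fpv : norm2 mu2 D (F \o phi) <= Num.sqrt J + C * eps.
  have LD : L2 mu2 D (fun x => (F \o phi) x - F (v x)) by exact: L2B.
  have LC := L2Z mD C Lpv.
  have -> : (F \o phi) = (fun x => F (v x) + ((F \o phi) x - F (v x))).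
    by apply/funext => x; rewrite subrKC.
  apply: le_trans (norm2D mD LF LD) _; apply: lerD => //.
  have h : norm2 mu2 D (fun x => (F \o phi) x - F (v x)) <= norm2 mu2 D (fun x => C * (phi x - v x)).
    by apply: le_norm2 => // x _; rewrite normrM (ger0_norm C0); exact: Flip.
  apply: (le_trans h); rewrite norm2Z // ler_wpM2l //.
  exact: le_trans e1e.
have B1 : \int[mu2]_(x in D) (f x * (F \o phi) x) <= norm2 mu2 D f * (Num.sqrt J + C * eps).
  apply: le_trans (le_trans (ler_norm _) (cauchy_schwarz_norm mD Lf LFp)) _.
  by rewrite ler_wpM2l.
have B2 i : \int[mu2]_(x in D) ((partials [:: i] phi x - G i x) * (g (phi x) * partials [:: i] phi x))
    <= eps * (C * (norm2 mu2 D (G i) + 1)).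
  have LB := L2B mD (Lp i) (LG i).
  apply: le_trans (le_trans (ler_norm _) (cauchy_schwarz_norm mD LB (Lgp i))) _.
  have hi := le_trans (hG i) e1e.
  apply: ler_pM; rewrite ?norm2_ge0 //.
  have h : norm2 mu2 D (fun x => g (phi x) * partials [:: i] phi x) <= norm2 mu2 D (fun x => C * partials [:: i] phi x).
    apply: le_norm2 => //; first exact: L2Z.
    move=> x _; rewrite !normrM (ger0_norm C0) ler_wpM2r // ger0_norm //.
    by case/andP: (g01 (phi x)).
  apply: (le_trans h); rewrite norm2Z // ler_wpM2l //.
  have -> : partials [:: i] phi = (fun x => G i x + (partials [:: i] phi x - G i x)).
    by apply/funext => x; rewrite subrKC.
  apply: le_trans (norm2D mD (LG i) LB) _; rewrite lerD2l.
  by apply: (le_trans hi); exact: ltW.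
apply: le_trans (lerD B1 (ler_sum _ (fun i _ => B2 i))) _.
rewrite -mulr_sumr /K le_eqVlt; apply/orP; left; apply/eqP.
by move: (\sum_(i < 2) _) (norm2 _ _ _) (Num.sqrt _) => S n q; ring.
Qed.

(** The square of [profile_duality] in the limit k -> 0, all errors being bounded linearly in k. *)
Lemma biharmonic_capacity :
  t ^+ 2 <= \int[mu2]_(x in D) (f x ^+ 2) * log_capacity_energy a.
Proof.
have [mv _] := Lv.
have api : a <= pi by exact: level_area_le_pi.
rewrite -norm2_square.
have n0 := norm2_ge0 mu2 D f.
have J0 := log_capacity_energy_ge0 at0 api.
pose b := t + (2 * pi)^-1.
have b0 : 0 <= b by rewrite addr_ge0 ?(ltW t0) // invr_ge0 mulr_ge0 // pi_ge0.
pose N := norm2 mu2 D f ^+ 2.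
pose J := log_capacity_energy a.
pose X := b * (pi - a) / (2 * pi); pose Y := b ^+ 2 * pi.
have X0 : 0 <= X by rewrite divr_ge0 ?mulr_ge0 ?subr_ge0 ?pi_ge0.
have Y0 : 0 <= Y by rewrite mulr_ge0 ?sqr_ge0 ?pi_ge0.
apply: (@le_of_small_error _ _ (2 * t ^+ 2 + N * (15 * J + 4 * (2 * X + Y)))) => k k0 k1.
have h := profile_duality k0 k1.
have k1' : 0 < 1 + k by rewrite addr_gt0.
have km : 0 <= 1 - k by rewrite subr_ge0 ltW.
rewrite /slack -/b profile_energy_limit // -/J in h.
have E : (1 + k) ^+ 2 * J + k * ((1 + k) * b * (pi - a) / (2 * pi) + k * b ^+ 2 * pi) =
   (1 + k) ^+ 2 * J + k * ((1 + k) * X + k * Y).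
  by rewrite /X /Y !mulrA.
rewrite E in h.
set Z := (X in Num.sqrt X) in h.
have Z0 : 0 <= Z.
  apply: addr_ge0; first by apply: mulr_ge0 => //; exact: sqr_ge0.
  apply: mulr_ge0; first exact: ltW.
  by apply: addr_ge0; apply: mulr_ge0 => //; exact: ltW.
have h2 : ((1 - k) / (1 + k) * t) ^+ 2 <= N * Z.
  have l0 : 0 <= (1 - k) / (1 + k) * t.
    by apply: mulr_ge0; [apply: divr_ge0 => //|]; exact: ltW.
  rewrite /N -(sqr_sqrtr Z0) -exprMn lerXn2r // nnegrE.
  by apply: mulr_ge0 => //; exact: sqrtr_ge0.
have N0 : 0 <= N by exact: sqr_ge0.
have h3 : (1 - k) ^+ 2 * t ^+ 2 <= (1 + k) ^+ 2 * (N * Z).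
  rewrite -ler_pdivrMl ?exprn_gt0 //; apply: le_trans h2; rewrite le_eqVlt; apply/orP; left; apply/eqP.
  by rewrite !exprMn exprVn mulrA (mulrC _ ((1 - k) ^+ 2)).
rewrite -/N -/J.
apply: small_parameter_arithmetic => //; exact: sqr_ge0.
Qed.

End CapacityBound.

(** * The lower bound for admissible functions *)

Section EnergyLowerBound.
Variable R : realType.
Local Notation mu2 := (@lebesgue2 R).
Local Notation D := (@unit_disc R).

(** Equal to 4 pi times the energy of the ideal profile truncated at the area pi r^2, by
    [log_capacity_energy_radial]. *)
Definition radial_gap (r : R) : R := (1 - r ^+ 2) / 2 + r ^+ 2 * ln r.

Lemma ln_lt_subr1 (x : R) : 0 < x -> x != 1 -> ln x < x - 1.
Proof.
move=> x0 x1; have l0 : ln x != 0.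
  by apply: contra x1 => /eqP h; rewrite -(lnK (x := x)) ?posrE // h expR0.
by have := expR_gt1Dx l0; rewrite lnK ?posrE // ltrBrDl.
Qed.

(** Twice the gap is r^2 times the deficit in ln x <= x - 1 at x = r^-2, strict because r < 1. *)
Lemma radial_gap_gt0 (r : R) : 0 < r -> r < 1 -> 0 < radial_gap r.
Proof.
move=> r0 r1; have q0 : 0 < r ^+ 2 by rewrite exprn_gt0.
have q1 : r ^+ 2 < 1 by rewrite expr_lt1 // ltW.
have h : ln (r ^- 2) < r ^- 2 - 1.
  apply: ln_lt_subr1; first by rewrite invr_gt0.
  by rewrite invr_eq1 lt_eqF.
rewrite lnV ?posrE // lnXn // -(ltr_pM2l q0) mulrBr mulfV ?gt_eqF // mulr1 in h.
by rewrite /radial_gap; move: h; rewrite mulrN mulrnAr -mulr_natl; move: (r ^+ 2 * ln r) => X; lra.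
Qed.

Lemma radial_gap_le (r : R) : 0 < r -> r < 1 -> radial_gap r <= (1 - r ^+ 2) / 2.
Proof.
move=> r0 r1; rewrite /radial_gap gerDl pmulr_rle0 ?exprn_gt0 //.
by rewrite ln_le0 // ltW.
Qed.

Lemma radial_energyE (u0 r : R) :
  radial_energy u0 r = 4 * pi * u0 ^+ 2 / radial_gap r + pi * (1 - r ^+ 2).
Proof. by []. Qed.

Lemma radial_energy_ge0 (u0 r : R) : 0 < r < 1 -> 0 <= radial_energy u0 r.
Proof.
move=> /andP[r0 r1]; have pp := pi_gt0 R.
have q1 : r ^+ 2 < 1 by rewrite expr_lt1 // ltW.
rewrite radial_energyE addr_ge0 // mulr_ge0 ?(ltW pp) ?subr_ge0 ?(ltW q1) //.
  by rewrite mulr_ge0 ?sqr_ge0 // mulr_ge0 // ltW.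
by rewrite invr_ge0 ltW // radial_gap_gt0.
Qed.

Lemma inf_radial_energy_le (u0 r : R) : 0 < r < 1 ->
  inf_radial_energy u0 <= radial_energy u0 r.
Proof.
move=> r01; apply: ge_inf; last by exists r => //; rewrite /= in_itv.
by exists 0; move=> y [s /=]; rewrite in_itv /= => s01 <-; exact: radial_energy_ge0.
Qed.

Lemma weak_derivativeP (s : seq 'I_2) (w : R * R -> R) :
  (exists v, is_weak_derivative D s w v) ->
  is_weak_derivative D s w (weak_derivative D s w).
Proof. by move=> ex; apply: (@xgetPex _ (cst 0) _ ex). Qed.

Lemma loc_integrable_test (u phi : R * R -> R) : loc_integrable D u ->
  test_function D phi -> mu2.-integrable D (EFin \o (fun x => u x * phi x)).
Proof.
move=> [mu_ iu] Tphi; have [Sphi cK KD] := Tphi; set K := support_closure phi in cK KD.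
have mK := compact_measurable_plane cK; have mD := @unit_disc_measurable R.
have cphi := smooth_continuous Sphi.
have [C C0 phiC] := compactly_supported_bounded cphi (test_function_compactly_supported Tphi).
have E : (fun x => u x * phi x) = (fun x => u x * phi x) \_ K.
  apply/funext => x; rewrite patchE; case: ifPn => // /negP nK.
  suff -> : phi x = 0 by rewrite mulr0.
  by apply/eqP/negPn/negP => px; apply: nK; rewrite inE; exact: subset_closure.
rewrite E -restrict_EFin; apply/integrable_restrict => //.
rewrite setIidr //.
have iK := iu K cK KD.
apply: (le_integrable mK _ _ (integrableZl_EFin C mK iK)).
  apply/measurable_EFinP; apply: measurable_funM.
    exact: measurable_funS mu_.
  exact: continuous_measurable_plane.
move=> x Kx /=; rewrite lee_fin !normrM (ger0_norm C0) mulrC ler_wpM2r //.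
Qed.

Lemma square_integrable_L2 (u : R * R -> R) : square_integrable D u -> L2 mu2 D u.
Proof. by move=> [mu_ iu]; apply: square_lty_L2 => //; exact: unit_disc_measurable. Qed.

Lemma integral_partial_test (phi : R * R -> R) i : test_function D phi ->
  \int[mu2]_(x in D) partials [:: i] phi x = 0.
Proof.
move=> Tphi; have [Sphi _ _] := Tphi.
have := @classical_weak_derivative R (cst 1) (cst 0) i phi (fun z => is_derive_cst _ _ _)
  (fun x => cvg_cst _) (fun x => cvg_cst _) Tphi.
under eq_Rintegral do rewrite mul1r.
move=> ->; rewrite (@eq_Rintegral _ _ _ _ _ (cst 0)) ?Rintegral_cst ?mul0r ?oppr0 //.
  exact: unit_disc_measurable.
by move=> x _; rewrite mul0r.
Qed.

Lemma partials_opp (phi : R * R -> R) i x : smooth phi ->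
  partials [:: i] (fun x => - phi x) x = - partials [:: i] phi x.
Proof.
move=> Sphi; have d := smooth_is_derive i x Sphi.
have d' : is_derive x (basis_vec R i) (fun x => - phi x) (- partials [:: i] phi x).
  exact: is_deriveN.
exact: (@derive_val _ _ _ _ _ _ _ d').
Qed.

Lemma test_function_opp (phi : R * R -> R) : test_function D phi ->
  test_function D (fun x => - phi x).
Proof.
move=> Tphi; apply: (@test_function_comp R D (fun y => - y) phi) => //.
  by move=> k; apply: CnN; exact: smooth1_id.
exact: oppr0.
Qed.

(** The second weak derivatives are tested with psi, the first ones with its partials. Both lead to
    integrals against second partials of psi, to which the constant u0 contributes 0. *)
Lemma green_identity (u0 : R) (w : R * R -> R) (psi : R * R -> R) :
  sobolev 2 D w -> sobolev0 D (fun x => w x - u0) -> test_function D psi ->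
  \int[mu2]_(x in D) (weak_laplacian D w x * psi x) =
  \sum_(i < 2) \int[mu2]_(x in D) (- weak_derivative D [:: i] (fun x => w x - u0) x * partials [:: i] psi x).
Proof.
move=> [sw dw] [[_ dv] _] Tpsi; have mD := @unit_disc_measurable R.
have Lw := square_integrable_L2 sw.
have Wii i : is_weak_derivative D [:: i; i] w (weak_derivative D [:: i; i] w).
  by apply: weak_derivativeP; have [g hg _] := dw [:: i; i] isT; exists g.
have Wi i : is_weak_derivative D [:: i] (fun x => w x - u0) (weak_derivative D [:: i] (fun x => w x - u0)).
  by apply: weak_derivativeP; have [g hg _] := dv [:: i] isT; exists g.
have iW i : mu2.-integrable D (EFin \o (fun x => weak_derivative D [:: i; i] w x * psi x)).
  by have [_ h _] := Wii i; exact: loc_integrable_test.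
transitivity (\sum_(i < 2) \int[mu2]_(x in D) (weak_derivative D [:: i; i] w x * psi x)).
  rewrite big_ord_recl big_ord1 -(RintegralD mD (iW _) (iW _)).
  by apply: eq_Rintegral => x _; rewrite /weak_laplacian big_ord_recl big_ord1 mulrDl.
apply: eq_bigr => i _.
have [_ _ /(_ psi Tpsi)] := Wii i; rewrite /= sqrrN expr1n mul1r => <-.
have Tp := test_function_partial i Tpsi.
have Tpp := test_function_partial i Tp.
have [_ l2 /(_ _ Tp)] := Wi i.
rewrite /= expr1 mulN1r => h.
have -> : \int[mu2]_(x in D) (- weak_derivative D [:: i] (fun x => w x - u0) x * partials [:: i] psi x) =
   - \int[mu2]_(x in D) (weak_derivative D [:: i] (fun x => w x - u0) x * partials [:: i] psi x).
  rewrite -[RHS]mulN1r -(RintegralZl (-1) mD (loc_integrable_test l2 Tp)).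
  by apply: eq_Rintegral => x _; rewrite mulN1r mulNr.
rewrite -h.
have i1 := L2M_integrable mD Lw (test_L2 Tpp).
have Lc : L2 mu2 D (cst u0) by apply: continuous_L2 => x; exact: cvg_cst.
have i2 := L2M_integrable mD Lc (test_L2 Tpp).
have [_ ipp] := test_L2 Tpp.
transitivity (\int[mu2]_(x in D) (w x * partials [:: i] (partials [:: i] psi) x -
                                  u0 * partials [:: i] (partials [:: i] psi) x)).
  rewrite (RintegralB mD i1 i2) RintegralZl ?(integral_partial_test i Tp) ?mulr0 ?subr0 //.
  by apply: continuous_integrable_disc; apply: smooth_continuous; case: Tpp.
by apply: eq_Rintegral => x _; rewrite mulrBl.
Qed.

Lemma integral_le_fin (A B : R * R -> R) (e : R) :
  measurable_fun (D : set (borel_plane R)) A -> measurable_fun (D : set (borel_plane R)) B ->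
  (forall x, D x -> 0 <= A x) -> (forall x, D x -> A x <= B x) ->
  (\int[mu2]_(x in D) (B x)%:E <= e%:E)%E ->
  mu2.-integrable D (EFin \o A) /\ \int[mu2]_(x in D) A x <= e.
Proof.
move=> mA mB A0 AB Be; have mD := @unit_disc_measurable R.
have le : (\int[mu2]_(x in D) (A x)%:E <= e%:E)%E.
  apply: le_trans Be.
  have A0' x : D x -> (0 <= (A x)%:E)%E by move=> Dx; rewrite lee_fin A0.
  have AB' x : D x -> ((A x)%:E <= (B x)%:E)%E by move=> Dx; rewrite lee_fin AB.
  have mA' : measurable_fun (D : set (borel_plane R)) (fun x => (A x)%:E) by exact/measurable_EFinP.
  have mB' : measurable_fun (D : set (borel_plane R)) (fun x => (B x)%:E) by exact/measurable_EFinP.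
  by apply: ge0_le_integral.
have iA : mu2.-integrable D (EFin \o A).
  apply/integrableP; split; first exact/measurable_EFinP.
  apply: le_lt_trans (ltry e); apply: le_trans le.
  rewrite le_eqVlt; apply/orP; left; apply/eqP; apply: eq_integral => x; rewrite inE => Dx.
  by rewrite /= ger0_norm ?A0.
split=> //; rewrite -lee_fin /Rintegral fineK //.
exact: integrable_fin_num.
Qed.

(** Square integrability of G comes from the approximation itself: up to sign, G is the gradient of
    a test function minus a remainder with finite squared integral. *)
Lemma sobolev0_approx (u0 : R) (w : R * R -> R) :
  sobolev 2 D w -> sobolev0 D (fun x => w x - u0) ->
  let G i x := - weak_derivative D [:: i] (fun x => w x - u0) x in
  (forall i, L2 mu2 D (G i)) /\
  forall e, 0 < e -> exists phi, [/\ test_function D phi,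
    norm2 mu2 D (fun x => phi x - (u0 - w x)) <= e &
    forall i, norm2 mu2 D (fun x => partials [:: i] phi x - G i x) <= e].
Proof.
move=> [sw _] [[_ dv] [phi [Tphi cv]]] G; have mD := @unit_disc_measurable R.
have [mw _] := sw.
(* Here [v] is w - u0, the opposite of the function in the capacity estimate; the approximating
   sequence is negated accordingly. *)
set v := fun x => w x - u0 in dv cv G *.
have mv : measurable_fun (D : set (borel_plane R)) v.
  by apply: measurable_funB => //; exact: measurable_cst.
have mW i : measurable_fun (D : set (borel_plane R)) (weak_derivative D [:: i] v).
  have [_ [h _] _] : is_weak_derivative D [:: i] v (weak_derivative D [:: i] v).
    by apply: weak_derivativeP; have [g hg _] := dv [:: i] isT; exists g.
  exact: h.
have cphi n : continuous (phi n) by apply: smooth_continuous; case: (Tphi n).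
have cp n i : continuous (partials [:: i] (phi n)).
  by apply: smooth_continuous; apply: smooth_partial; case: (Tphi n).
have m1 n : measurable_fun (D : set (borel_plane R)) (fun x => phi n x - v x).
  by apply: measurable_funB => //; exact: continuous_measurable_plane.
have m2 n i : measurable_fun (D : set (borel_plane R)) (fun x => partials [:: i] (phi n) x - weak_derivative D [:: i] v x).
  by apply: measurable_funB => //; exact: continuous_measurable_plane.
pose B n x := (phi n x - v x) ^+ 2 +
  \sum_(i < 2) (partials [:: i] (phi n) x - weak_derivative D [:: i] v x) ^+ 2.
have mB n : measurable_fun (D : set (borel_plane R)) (B n).
  apply: measurable_funD; first exact: measurable_funX.
  by apply: measurable_sum => i; exact: measurable_funX.
have small e : 0 < e -> exists n, (\int[mu2]_(x in D) (B n x)%:E <= (e ^+ 2)%:E)%E.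
  move=> e0; have e2 : 0 < e ^+ 2 by rewrite exprn_gt0.
  have := cv; move/fine_cvgP => [fin /cvgrPdist_le/(_ _ e2) ev].
  have [n _ Hn] : \forall n \near \oo, (\int[mu2]_(x in D) (B n x)%:E <= (e ^+ 2)%:E)%E.
    near=> n.
    have f1 : (\int[mu2]_(x in D) (B n x)%:E)%E \is a fin_num by near: n; exact: fin.
    have f2 : `|0 - fine (\int[mu2]_(x in D) (B n x)%:E)%E| <= e ^+ 2 by near: n; exact: ev.
    rewrite -(fineK f1) lee_fin; apply: le_trans f2; rewrite sub0r normrN; exact: ler_norm.
  by exists n; exact: (Hn n (leqnn n)).
have key n e : 0 < e -> (\int[mu2]_(x in D) (B n x)%:E <= (e ^+ 2)%:E)%E ->
  (L2 mu2 D (fun x => phi n x - v x) /\ norm2 mu2 D (fun x => phi n x - v x) <= e) /\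
  forall i, L2 mu2 D (fun x => partials [:: i] (phi n) x - weak_derivative D [:: i] v x) /\
    norm2 mu2 D (fun x => partials [:: i] (phi n) x - weak_derivative D [:: i] v x) <= e.
  move=> e0 Be; split.
    have [|||i1 i2] := @integral_le_fin (fun x => (phi n x - v x) ^+ 2) (B n) (e ^+ 2) _ (mB n) _ _ Be.
    - exact: measurable_funX.
    - by move=> x _; exact: sqr_ge0.
    - by move=> x _; rewrite /B lerDl; apply: sumr_ge0 => i _; exact: sqr_ge0.
    split=> //; rewrite -(ger0_norm (ltW e0)) -sqrtr_sqr; exact: ler_wsqrtr.
  move=> i.
  have [|||i1 i2] := @integral_le_fin (fun x => (partials [:: i] (phi n) x - weak_derivative D [:: i] v x) ^+ 2) (B n) (e ^+ 2) _ (mB n) _ _ Be.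
  - exact: measurable_funX.
  - by move=> x _; exact: sqr_ge0.
  - move=> x _; rewrite /B; apply: (@le_trans _ _ (\sum_(i < 2) (partials [:: i] (phi n) x - weak_derivative D [:: i] v x) ^+ 2)).
      by rewrite (bigD1 i) //= lerDl; apply: sumr_ge0 => j _; exact: sqr_ge0.
    by rewrite lerDr; exact: sqr_ge0.
  split=> //; rewrite -(ger0_norm (ltW e0)) -sqrtr_sqr; exact: ler_wsqrtr.
split.
  move=> i; have [n Hn] := small 1 ltr01.
  have [_ /(_ i) [L _]] := key n 1 ltr01 Hn.
  apply: L2N => //.
  rewrite (_ : weak_derivative D [:: i] v = (fun x => partials [:: i] (phi n) x - (partials [:: i] (phi n) x - weak_derivative D [:: i] v x))).
    by apply: L2B => //; exact: continuous_L2.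
  by apply/funext => x; rewrite subKr.
move=> e e0; have [n Hn] := small e e0.
have [[L1 N1] H2] := key n e e0 Hn.
have norm2_opp (F F' : R * R -> R) : (forall x, F' x = - F x) -> norm2 mu2 D F' = norm2 mu2 D F.
  by move=> FF; congr Num.sqrt; apply: eq_Rintegral => x _; rewrite FF sqrrN.
exists (fun x => - phi n x); split; first exact: test_function_opp.
- rewrite (norm2_opp (fun x => phi n x - v x)) // => x; rewrite /v; ring.
- move=> i; have [_ N2] := H2 i.
  rewrite (norm2_opp (fun x => partials [:: i] (phi n) x - weak_derivative D [:: i] v x)) // => x.
  by rewrite partials_opp /G ?opprB ?opprK 1?addrC //; case: (Tphi n).
Unshelve. all: by end_near.
Qed.

Lemma log_capacity_energy_radial (r : R) : 0 < r ->
  log_capacity_energy (pi * r ^+ 2) = radial_gap r / (4 * pi).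
Proof.
move=> r0; have pp := pi_gt0 R; have q0 : 0 < r ^+ 2 by rewrite exprn_gt0.
rewrite /log_capacity_energy /radial_gap lnM ?posrE // lnXn // -mulr_natl.
by move: (pi : R) pp (ln _) (ln r) => p p0 l lr; field; rewrite gt_eqF.
Qed.

(** Writing A = pi r^2 turns the capacity bound into a comparison with the radial energy at r. *)
Lemma h_le_capacity (u0 A N : R) : 0 < u0 -> 0 < A -> A <= pi ->
  u0 ^+ 2 <= N * log_capacity_energy A -> h u0 <= N + (pi - A).
Proof.
move=> u00 a0 api bound; have pp := pi_gt0 R.
have u2 : 0 < u0 ^+ 2 by rewrite exprn_gt0.
have [r [r0 r1 Ar]] : exists r, [/\ 0 < r, r < 1 & A = pi * r ^+ 2].
  exists (Num.sqrt (A / pi)).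
  have Ap : 0 < A / pi by rewrite divr_gt0.
  have AE : A = pi * Num.sqrt (A / pi) ^+ 2.
    by rewrite sqr_sqrtr ?(ltW Ap) // mulrC divfK // gt_eqF.
  split=> //; first by rewrite sqrtr_gt0.
  rewrite -sqrtr1 ltr_sqrt // ltr_pdivrMr // mul1r lt_neqAle api andbT.
  (* The degenerate radius r = 1 is excluded: the capacity energy vanishes at A = pi, whereas u0 >
     0. *)
  apply/eqP => Api; move: bound; rewrite Api /log_capacity_energy subrr mulr0 mulr0 subr0 subrr mul0r mulr0.
  by rewrite leNgt u2.
rewrite Ar log_capacity_energy_radial // in bound.
have gr := radial_gap_gt0 r0 r1.
have r01 : 0 < r < 1 by rewrite r0.
have le1 : h u0 <= radial_energy u0 r.
  by apply: le_trans (inf_radial_energy_le u0 r01); rewrite /h ge_min lexx orbT.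
apply: (le_trans le1); rewrite radial_energyE Ar mulrBr mulr1 lerD2r.
rewrite ler_pdivrMr //; rewrite mulrA ler_pdivlMr ?mulr_gt0 // in bound.
by rewrite mulrC.
Qed.

Lemma energy_ge_h (u0 : R) (w : R * R -> R) : 0 < u0 ->
  admissible D (cst u0) w -> ((h u0)%:E <= energy D w)%E.
Proof.
move=> u00 [Sw S0w]; have mD := @unit_disc_measurable R; have pp := pi_gt0 R.
have [sw dw] := Sw; have Lw := square_integrable_L2 sw; have [mw _] := sw.
have mlev : mu2 [set x | D x /\ 0 < w x] = (level_area w `]0, +oo[)%:E.
  rewrite /level_area fineK; last by apply: sub_disc_fin_num; [exact: level_measurable|exact: level_sub].
  by congr (mu2 _); apply/seteqP; split=> x [Dx /= wx]; split=> //=; move: wx; rewrite in_itv /= andbT.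
pose v x := u0 - w x.
have Lc : L2 mu2 D (cst u0) by apply: continuous_L2 => x; exact: cvg_cst.
have Lv : L2 mu2 D v by exact: L2B.
have [mv _] := Lv.
have levE : level_area w `]-oo, 0] = level_area v `[u0, +oo[.
  congr (fine (mu2 _)); apply/seteqP; split=> x [Dx /=]; rewrite in_itv /= => wx; split=> //=;
    move: wx; rewrite in_itv /= ?andbT /v; lra.
have tot : level_area w `]0, +oo[ = pi - level_area v `[u0, +oo[.
  have full : level_area w `]-oo, +oo[ = pi.
    have lD : level w `]-oo, +oo[ = D.
      by apply/seteqP; split=> x; [case|move=> Dx; split=> //=; rewrite in_itv].
    rewrite /level_area lD unit_disc_area; exact: erefl.
  have E : level_area w `]-oo, +oo[ = level_area w `]-oo, 0] + level_area w `]0, +oo[.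
    apply: (level_area_split mw) => x; rewrite !in_itv /= andbT; first by case: leP.
    by rewrite leNgt => /negP.
  rewrite full levE in E.
  by apply/eqP; rewrite eq_sym subr_eq addrC; apply/eqP.
have hpi : h u0 <= pi by rewrite /h ge_min lexx.
rewrite /energy mlev tot.
have f0 : (0 <= \int[mu2]_(x in D) (weak_laplacian D w x ^+ 2)%:E)%E.
  by apply: integral_ge0 => x _; rewrite lee_fin sqr_ge0.
have a0 := level_area_ge0 v `[u0, +oo[.
have api : level_area v `[u0, +oo[ <= pi by exact: level_area_le_pi.
(* If {w <= 0} is negligible, the area term alone is pi >= h u0. *)
move: a0; rewrite le_eqVlt => /orP[/eqP<-|a0].
  rewrite subr0; apply: (le_trans _ (leeDr _ f0)); rewrite lee_fin; exact: hpi.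
(* At this point the chosen representative of the Laplacian is not known to be square integrable; if
   it is not, the energy is infinite and the bound is trivial. *)
have [fin|] := boolP (\int[mu2]_(x in D) (weak_laplacian D w x ^+ 2)%:E < +oo)%E; last first.
  by rewrite -leNgt leye_eq => /eqP ->; rewrite addye ?leey.
have mf : measurable_fun (D : set (borel_plane R)) (weak_laplacian D w).
  apply: measurable_sum => i.
  have [_ [h _] _] : is_weak_derivative D [:: i; i] w (weak_derivative D [:: i; i] w).
    by apply: weak_derivativeP; have [g hg _] := dw [:: i; i] isT; exists g.
  exact: h.
have Lf : L2 mu2 D (weak_laplacian D w) by exact: square_lty_L2.
have [LG ap] := sobolev0_approx Sw S0w.
have := @biharmonic_capacity R v (weak_laplacian D w) _ u0 Lv Lf LG
  (fun psi Tpsi => green_identity Sw S0w Tpsi) ap u00 a0.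
move=> bound.
have NE : (\int[mu2]_(x in D) (weak_laplacian D w x ^+ 2)%:E)%E =
    (\int[mu2]_(x in D) (weak_laplacian D w x ^+ 2))%:E.
  have [_ iLf] := Lf; have fin2 := integrable_fin_num mD iLf.
  by rewrite /Rintegral (fineK fin2).
rewrite NE -EFinD lee_fin; exact: h_le_capacity u00 a0 api bound.
Qed.

End EnergyLowerBound.

(** * Uniqueness of weak derivatives *)

(** The sets over which f integrates to 0 form a Dynkin system, by additivity over complements and
    countable disjoint unions. *)
Lemma integral_eq0_dynkin d (T : measurableType d) (R : realType)
    (m : {measure set T -> \bar R}) (C : set (set T)) (f : T -> R) :
  @measurable _ T = <<s C >> -> setI_closed C -> m.-integrable setT (EFin \o f) ->
  (\int[m]_x (f x)%:E = 0)%E ->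
  (forall A, C A -> (\int[m]_(x in A) (f x)%:E = 0)%E) ->
  forall A, measurable A -> (\int[m]_(x in A) (f x)%:E = 0)%E.
Proof.
move=> mC CI fi f0 fC A mA.
apply: (dynkin_induction (P := fun A => (\int[m]_(x in A) (f x)%:E = 0)%E) mC) => //.
- move=> S mS S0; have := f0; rewrite -(setUv S) integral_setU //.
    by rewrite S0 add0e.
  - exact: measurableC.
  - by apply: measurable_funS (measurable_int m fi).
  - exact/disj_setPCl.
- move=> F mF tF F0; rewrite integral_bigcup //.
    by rewrite eseries0 // => i _ _; exact: F0.
  by apply: integrableS fi => //; exact: bigcupT_measurable.
- by rewrite -mC.
Qed.

Section Uniqueness.
Context {R : realType}.
Local Notation mu2 := (@lebesgue2 R).
Local Notation D := (@unit_disc R).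

(** A generating class stable under intersection, whose indicators are limits of products of
    one-variable smooth steps. *)
Definition quadrants : set (set (borel_plane R)) :=
  [set A | exists p q : R, A = [set x | x.1 < p /\ x.2 < q]].

Lemma setI_closed_quadrants : setI_closed quadrants.
Proof.
move=> _ _ [p [q ->]] [p' [q' ->]]; exists (Num.min p p'), (Num.min q q').
by apply/seteqP; split => x /=; rewrite !lt_min;
  [move=> [[-> ->] [-> ->]]|move=> [/andP[-> ->] /andP[-> ->]]].
Qed.

(** Both coordinates are measurable for the sigma-algebra generated by quadrants, a half-plane being
    a countable union of quadrants; hence so is the identity into the product. *)
Lemma quadrants_generate : @measurable _ (borel_plane R) = <<s quadrants >>.
Proof.
apply/seteqP; split; last first.
  apply: smallest_sub; first exact: sigma_algebra_measurable.
  move=> _ [p [q ->]]; rewrite (_ : [set _ | _] = `]-oo, p[ `*` `]-oo, q[).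
    by apply: measurableX; exact: measurable_itv.
  by apply/seteqP; split => x /=; rewrite !in_itv.
pose Q := g_sigma_algebraType quadrants.
have mq (p q : R) : @measurable _ Q [set x : R * R | x.1 < p /\ x.2 < q].
  by apply: sub_sigma_algebra; exists p, q.
have m1 : measurable_fun (setT : set Q) (fst : Q -> measurableTypeR R).
  apply: (@measurability _ _ Q (measurableTypeR R) setT fst _ (RGenInftyO.measurableE R)) => _ [_ [p ->] <-].
  rewrite setTI (_ : _ @^-1` _ = \bigcup_n [set x : R * R | x.1 < p /\ x.2 < n%:R]).
    by apply: bigcupT_measurable => n; exact: mq.
  apply/seteqP; split => [x /=|x [n _ [/= xp _]] /=]; rewrite in_itv //=.
  by move=> xp; exists (Num.truncn x.2).+1 => //; split => //; exact: truncnS_gt.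
have m2 : measurable_fun (setT : set Q) (snd : Q -> measurableTypeR R).
  apply: (@measurability _ _ Q (measurableTypeR R) setT snd _ (RGenInftyO.measurableE R)) => _ [_ [p ->] <-].
  rewrite setTI (_ : _ @^-1` _ = \bigcup_n [set x : R * R | x.1 < n%:R /\ x.2 < p]).
    by apply: bigcupT_measurable => n; exact: mq.
  apply/seteqP; split => [x /=|x [n _ [/= xp ?]] /=]; rewrite in_itv //=.
  by move=> xp; exists (Num.truncn x.1).+1 => //; split => //; exact: truncnS_gt.
move=> A mA; have := measurable_fun_pair m1 m2 measurableT mA.
by rewrite setTI; congr (measurable _); apply/seteqP; split => -[].
Qed.


Lemma smooth_cst (c : R) : smooth (cst c : R * R -> R).
Proof. by apply/smoothP => k; exact: Cn_cst. Qed.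

Lemma smoothM (f g : R * R -> R) : smooth f -> smooth g -> smooth (fun x => f x * g x).
Proof.
by move=> /smoothP Cf /smoothP Cg; apply/smoothP => k; apply: CnM; [exact: Cf|exact: Cg].
Qed.

Lemma smooth_comp (F : R -> R) (f : R * R -> R) : smooth1 F -> smooth f -> smooth (F \o f).
Proof.
by move=> SF /smoothP Cf; apply/smoothP => k; apply: Cn_comp; [exact: SF|exact: Cf].
Qed.

Lemma smooth1_affine (a b : R) : smooth1 (fun x => a * (b - x)).
Proof.
move=> k; apply: CnZ; apply: CnB; first exact: Cn_cst.
exact: smooth1_id.
Qed.

Lemma integral_quadrant_eq0 (g : R * R -> R) (B : set (R * R)) :
  mu2.-integrable setT (EFin \o g) ->
  (forall psi, smooth psi -> \int[mu2]_x (g x * psi x) = 0) ->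
  quadrants B -> (\int[mu2]_(x in B) (g x)%:E = 0)%E.
Proof.
move=> ig g0 [p [q ->]]; have mg := measurable_int mu2 ig.
have [S [SS S0 S1 S01 _]] := @exists_smooth_step R.
(* Each factor vanishes off its open half-line and is 1 once n times the distance to the end point
   reaches 1, so [psi n] tends to the indicator everywhere. *)
pose psi n (x : R * R) := S (n%:R * (p - x.1)) * S (n%:R * (q - x.2)).
have Spsi n : smooth (psi n).
  apply: smoothM.
    apply: (@smooth_comp (fun y => S (n%:R * (p - y))) fst).
      apply: (smooth1_comp SS); exact: smooth1_affine.
    by apply/smoothP => k; exact: Cn_coord1.
  apply: (@smooth_comp (fun y => S (n%:R * (q - y))) snd).
    apply: (smooth1_comp SS); exact: smooth1_affine.
  by apply/smoothP => k; exact: Cn_coord2.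
have psi01 n x : 0 <= psi n x <= 1.
  have /andP[a0 a1] := S01 (n%:R * (p - x.1)); have /andP[b0 b1] := S01 (n%:R * (q - x.2)).
  by rewrite /psi mulr_ge0 // mulr_ile1.
set A := [set x | _].
have mA : measurable (A : set (borel_plane R)).
  by rewrite quadrants_generate; apply: sub_sigma_algebra; exists p, q.
have step (c y : R) : y < c -> \forall n \near \oo, S (n%:R * (c - y)) = 1.
  move=> yc; near=> n; apply: S1; rewrite -ler_pdivrMr ?subr_gt0 // mul1r.
  by near: n; exact: nbhs_infty_ger.
have cv x : (fun n => (g x * psi n x)%:E) @ \oo --> (g x * \1_A x)%:E.
  apply: cvg_near_cst; rewrite indicE.
  have [/set_mem [x1 x2]|/negP xA] := boolP (x \in A).
    near=> n; congr (_ * _)%:E; rewrite /psi; have -> : S (n%:R * (p - x.1)) = 1 by near: n; exact: step.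
    by have -> : S (n%:R * (q - x.2)) = 1; [near: n; exact: step|rewrite mulr1].
  near=> n; congr (_ * _)%:E; rewrite /psi.
  have [x1|x1] := ltP x.1 p; last by rewrite S0 ?mul0r // mulr_ge0_le0 // subr_le0.
  have [x2|x2] := ltP x.2 q; last by rewrite [S (_ * (q - _))]S0 ?mulr0 // mulr_ge0_le0 // subr_le0.
  by exfalso; apply: xA; rewrite inE.
have mpsi n : measurable_fun (setT : set (borel_plane R)) (fun x => (g x * psi n x)%:E).
  apply/measurable_EFinP; apply: measurable_funM; first by apply/measurable_EFinP.
  by apply: continuous_measurable_plane => //; exact: smooth_continuous (Spsi n).
have mgA : measurable_fun (setT : set (borel_plane R)) (fun x => (g x * \1_A x)%:E).
  apply/measurable_EFinP; apply: measurable_funM; first by apply/measurable_EFinP.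
  exact: measurable_indic.
have bnd n x : (`|(g x * psi n x)%:E| <= `|(g x)%:E|)%E.
  have /andP[a0 a1] := psi01 n x.
  by rewrite /= lee_fin normrM ler_piMr // ger0_norm.
have aecv : {ae mu2, forall x, setT x -> (fun n => (g x * psi n x)%:E) @ \oo --> (g x * \1_A x)%:E}.
  by apply: aeW => x _; exact: cv.
have aebnd : {ae mu2, forall x n, setT x -> (`|(g x * psi n x)%:E| <= `|(g x)%:E|)%E}.
  by apply: aeW => x n _; exact: bnd.
have [_ _ H] := @dominated_convergence _ _ _ mu2 setT measurableT
  (fun n x => (g x * psi n x)%:E) (fun x => (g x * \1_A x)%:E) (fun x => `|(g x)%:E|%E)
  mpsi mgA aecv (integrable_abse ig) aebnd.
have E0 n : (\int[mu2]_x (g x * psi n x)%:E)%E = 0%E.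
  have ii : mu2.-integrable setT (fun x => (g x * psi n x)%:E).
    by apply: le_integrable (integrable_abse ig) => // x _; rewrite abse_id; exact: bnd.
  have := g0 _ (Spsi n); rewrite /Rintegral => h.
  by rewrite -(fineK (integrable_fin_num measurableT ii)) h.
have : (\int[mu2]_x (g x * \1_A x)%:E)%E = 0%E.
  apply: (cvg_unique _ H) => //; rewrite (_ : (fun n => _) = cst 0%E); first exact: cvg_cst.
  by apply/funext => n /=; rewrite E0.
move=> <-; rewrite [LHS]integral_mkcond; apply: eq_integral => x _.
by rewrite patchE indicE; case: ifPn => _; rewrite ?mulr1 ?mulr0.
Unshelve. all: by end_near. Qed.


Lemma smooth_normsq : smooth (@normsq R).
Proof.
apply/smoothP => k.
by apply: CnD; apply: CnM; solve [exact: Cn_coord1|exact: Cn_coord2].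
Qed.

Lemma radial_test_function (F : R -> R) (b : R) : b < 1 -> smooth1 F ->
  (forall s, b <= s -> F s = 0) -> test_function D (fun x => F (normsq x)).
Proof.
move=> b1 SF F0; have cN := smooth_continuous smooth_normsq.
have cK : closed [set x : R * R | normsq x <= b].
  rewrite (_ : [set x | _] = @normsq R @^-1` [set t | t <= b]) //.
  by apply: preimage_closed; [move=> x _; exact: cN|exact: closed_le].
have KD : [set x : R * R | normsq x <= b] `<=` D.
  by move=> x /= xb; apply/enorm_lt1; exact: le_lt_trans xb b1.
have sK : support_closure (fun x => F (normsq x)) `<=` [set x : R * R | normsq x <= b].
  move/closure_id: cK => ->; apply: closureS => x /= Fx.
  by rewrite leNgt; apply/negP => /ltW /F0 E; rewrite E eqxx in Fx.
split.
- exact: smooth_comp SF smooth_normsq.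
- apply: (subclosed_compact _ (@box_compact R 1)); first exact: closed_closure.
  by apply: subset_trans sK (subset_trans KD (@unit_disc_box R)).
- exact: subset_trans sK KD.
Qed.

Lemma ae_plane_sub (P Q : R * R -> Prop) : (forall x, P x -> Q x) ->
  {ae mu2, forall x, P x} -> {ae mu2, forall x, Q x}.
Proof.
move=> PQ [N [mN N0 sN]]; exists N; split => // x nQ; apply: sN => Px.
by apply: nQ; exact: PQ.
Qed.

Lemma ae_eq0_smooth (g : R * R -> R) : mu2.-integrable setT (EFin \o g) ->
  (forall psi, smooth psi -> \int[mu2]_x (g x * psi x) = 0) ->
  {ae mu2, forall x, g x = 0}.
Proof.
move=> ig g0.
have gT : (\int[mu2]_x (g x)%:E = 0)%E.
  rewrite -(fineK (integrable_fin_num measurableT ig)).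
  have := g0 _ (smooth_cst 1); rewrite /Rintegral.
  by under eq_integral do rewrite mulr1; move=> ->.
have gA := integral_eq0_dynkin quadrants_generate setI_closed_quadrants ig gT
  (fun A => integral_quadrant_eq0 ig g0).
have := @integral_ae_eq _ _ _ mu2 setT measurableT (cst 0%E) (EFin \o g) ig (measurable_cst _).
move=> /(_ _) H; have {}H : ae_eq mu2 setT (EFin \o g) (cst 0%E).
  by apply: H => A _ mA; rewrite integral0; exact: gA.
by apply: ae_plane_sub H => x /(_ I) [].
Qed.

(** g times a cutoff, extended by 0, is integrable on the plane and orthogonal to all smooth
    functions, hence null; the cutoffs exhaust the disc. *)
Lemma du_bois_reymond (g : R * R -> R) : loc_integrable D g ->
  (forall phi, test_function D phi -> \int[mu2]_(x in D) (g x * phi x) = 0) ->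
  {ae mu2, forall x, D x -> g x = 0}.
Proof.
move=> lg g0; have mD := @unit_disc_measurable R.
have [S [SS S0 S1 S01 _]] := @exists_smooth_step R.
(* A cutoff in the variable s = |x|^2: it is 1 for s <= (k - 1) / (k + 1) and 0 for s >= k / (k +
   1). *)
pose F (k : nat) s := S (k%:R - k.+1%:R * s).
have Tchi k : test_function D (fun x => F k (normsq x)).
  have k1 : (0 : R) < k.+1%:R by rewrite ltr0n.
  apply: (@radial_test_function _ (k%:R / k.+1%:R)).
  - by rewrite ltr_pdivrMr // mul1r ltr_nat.
  - apply: (smooth1_comp SS) => n; apply: CnB; first exact: Cn_cst.
    by apply: CnZ; exact: smooth1_id.
  - by move=> s; rewrite ler_pdivrMr // => h; apply: S0; rewrite subr_le0 mulrC.
have ae0 k : {ae mu2, forall x, D x -> g x * F k (normsq x) = 0}.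
  pose G := (fun x => g x * F k (normsq x)) \_ D.
  have iG : mu2.-integrable setT (EFin \o G).
    rewrite -restrict_EFin; apply/integrable_restrict => //.
    by rewrite setTI; exact: loc_integrable_test lg (Tchi k).
  have aeG : {ae mu2, forall x, G x = 0}.
    apply: ae_eq0_smooth iG _ => psi Spsi.
    have Tp : test_function D (fun x => F k (normsq x) * psi x).
      apply: (test_functionS (Tchi k)).
        by have [Schi _ _] := Tchi k; exact: smoothM Schi Spsi.
      move=> x /= px; apply: subset_closure => /=.
      by apply: contraNneq px => ->; rewrite mul0r.
    rewrite -(g0 _ Tp) [RHS]Rintegral_mkcond; apply: eq_Rintegral => x _.
    by rewrite /G !patchE; case: ifPn => _; rewrite ?mulrA ?mul0r.
  by apply: ae_plane_sub aeG => x Gx Dx; move: Gx; rewrite /G patchE mem_set.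
have {}ae0 : {ae mu2, forall x, forall k, D x -> g x * F k (normsq x) = 0}.
  exact/ae_foralln.
apply: ae_plane_sub ae0 => x gF Dx.
have /enorm_lt1 x1 := Dx; rewrite -/(normsq x) in x1.
have x0 : 0 < 1 - normsq x by rewrite subr_gt0.
have [k kx] : exists k : nat, 1 + normsq x <= k%:R * (1 - normsq x).
  exists (Num.truncn ((1 + normsq x) / (1 - normsq x))).+1.
  by rewrite -ler_pdivrMr // ltW // truncnS_gt.
have := gF k Dx; rewrite /F S1 ?mulr1 // -natr1 mulrDl mul1r; lra.
Qed.

(** Serves to identify the representative chosen by [weak_derivative] with the classical derivative
    almost everywhere. *)
Lemma weak_derivative_unique s (u v w : R * R -> R) :
  is_weak_derivative D s u v -> is_weak_derivative D s u w ->
  {ae mu2, forall x, D x -> v x = w x}.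
Proof.
move=> [_ [mv iv] uv] [_ [mw iw] uw]; have mD := @unit_disc_measurable R.
have L : loc_integrable D (fun x => v x - w x).
  split; first exact: measurable_funB.
  move=> K cK KD; apply: integrableB_EFin; [exact: compact_measurable_plane|exact: iv|exact: iw].
have := @du_bois_reymond (fun x => v x - w x) L.
move=> H; have {}H : {ae mu2, forall x, D x -> v x - w x = 0}.
  apply: H => phi Tphi; have := uv _ Tphi; rewrite (uw _ Tphi) => /mulrI E.
  have {}E := E (unitrX _ (unitrN1 _)).
  rewrite (_ : (fun x => _) = (fun x => v x * phi x - w x * phi x)); last first.
    by apply/funext => x; rewrite mulrBl.
  rewrite RintegralB //; [by rewrite E subrr|apply: loc_integrable_test Tphi; split..] => //.
by apply: ae_plane_sub H => x + Dx => /(_ Dx)/eqP; rewrite subr_eq0 => /eqP.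
Qed.

End Uniqueness.

(** * Gluing differentiable functions *)

Section Glue.
Context {R : realType}.

(** At the junction the glued function is f plus a term equal to 0 on the left and to g - f on the
    right; the difference quotients of that term are dominated by those of g - f, whose derivative
    there is 0. *)
Lemma is_derive_glue (f g df dg : R -> R) (a : R) :
  (forall s : R, s <= a -> is_derive s 1 f (df s)) ->
  (forall s : R, a <= s -> is_derive s 1 g (dg s)) ->
  f a = g a -> df a = dg a ->
  forall s : R, is_derive s 1 (fun s => if s <= a then f s else g s)
                        (if s <= a then df s else dg s).
Proof.
move=> fd gd fga dfga s; have [sa|sa|->] := ltgtP s a.
- apply: (near_eq_is_derive _ (fd _ (ltW sa))); near=> y.
  by rewrite ifT //; apply: ltW; near: y; exact: lt_nbhsl.
- apply: (near_eq_is_derive _ (gd _ (ltW sa))); near=> y.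
  by rewrite ifF //; apply/negbTE; rewrite -ltNge; near: y; exact: lt_nbhsr.
have fa := fd a (lexx a); have ga := gd a (lexx a).
have ea : is_derive a 1 (fun y => g y - f y) 0.
  by apply: (is_derive_eq (is_deriveB ga fa)); rewrite dfga subrr.
pose t y := if y <= a then 0 else g y - f y.
have ta : is_derive a 1 t 0.
  have ce : (fun h : R => h^-1 *: (((fun y => g y - f y) \o shift a) (h *: 1) - (g a - f a)))
      @ 0^' --> (0 : R).
    by have [d E] := ea; rewrite -[X in _ --> X]E; exact: d.
  have ct : (fun h : R => h^-1 *: ((t \o shift a) (h *: 1) - t a)) @ 0^' --> (0 : R).
    move/cvgr0Pnorm_le: ce => ce; apply/cvgr0Pnorm_le => e e0.
    apply: filterS (ce e e0) => h; apply: le_trans.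
    rewrite /= !normrZ ler_wpM2l // /t lexx fga !subrr !subr0.
    by case: ifPn => // _; rewrite normr0.
  split; first by apply/cvg_ex; exists 0.
  by apply: cvg_lim.
have := is_deriveD fa ta; rewrite addr0; apply: near_eq_is_derive.
by near=> y; rewrite fctE /t; case: ifPn => _; rewrite ?addr0 // addrCA subrr addr0.
Unshelve. all: by end_near. Qed.

Lemma exists_primitive_right (f : R -> R) (b : R) :
  continuous f -> (forall x, b <= x -> f x = 0) ->
  exists2 F : R -> R, (forall x : R, is_derive x 1 F (f x)) &
    (forall x, b <= x -> F x = 0).
Proof.
move=> cf f0.
have [|x xb|F dF F0] := @exists_primitive R (fun x => - f (- x)) (- b).
- move=> x; apply: cvgN; apply: (@continuous_comp _ _ _ (fun x : R => - x) f); last exact: cf.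
  by apply: cvgN; exact: cvg_id.
- by rewrite f0 ?oppr0 // lerNr.
exists (fun x => F (- x)) => [x|x bx]; last by rewrite F0 // lerN2.
have d : is_derive x 1 (fun x : R => - x) (- 1) by apply: is_deriveN.
have := is_derive_comp_line (dF (- x)) d.
by rewrite opprK mulrN1 opprK.
Qed.

End Glue.

(** * Uniform smooth approximation of Lipschitz functions *)

Section SmoothApproximation.
Context {R : realType}.

(* The sum of smoothed steps b interpolates a at the nodes j * d. *)
Lemma exists_smooth_approximation (a : R -> R) (L d : R) (n : nat) : 0 < d ->
  (forall x y, `|a x - a y| <= L * `|x - y|) ->
  exists2 b : R -> R, smooth1 b &
    forall s, 0 <= s <= n%:R * d -> `|b s - a s| <= 2 * L * d.
Proof.
move=> d0 aL; have L0 : 0 <= L.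
  by have := le_trans (normr_ge0 _) (aL 0 1); rewrite sub0r normrN1 mulr1.
have [S [SS S0 S1 S01 _]] := @exists_smooth_step R.
(* Strengthened for the induction: b stays constant beyond the last node, where the next step
   starts. *)
suff [b [Sb _ bE]] : exists b : R -> R, [/\ smooth1 b,
    forall s, n%:R * d <= s -> b s = a (n%:R * d) &
    forall s, 0 <= s <= n%:R * d -> `|b s - a s| <= 2 * L * d] by exists b.
elim: n => [|n [b [Sb bE b1]]].
  exists (cst (a 0)); split => [k|s|s]; first exact: Cn_cst; rewrite mul0r //.
  by move=> /le_anti <-; rewrite subrr normr0 !mulr_ge0 // ltW.
pose c := a (n.+1%:R * d) - a (n%:R * d).
have nd : n.+1%:R * d = n%:R * d + d by rewrite -natr1 mulrDl mul1r.
exists (fun s => b s + c * S (d^-1 * s - n%:R)); split.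
- move=> k; apply: CnD; first exact: Sb.
  apply: CnZ; apply: (@smooth1_comp _ S (fun s => d^-1 * s - n%:R)) => // {}k.
  by apply: CnB; [apply: CnZ; exact: smooth1_id|exact: Cn_cst].
- move=> s sn; rewrite bE; last by apply: le_trans sn; rewrite nd lerDl ltW.
  have -> : S (d^-1 * s - n%:R) = 1.
    by apply: S1; rewrite lerBrDr mulrC ler_pdivlMr // addrC natr1.
  by rewrite mulr1 /c addrC subrK.
move=> s /andP[s0 sn].
have [h|h] := leP s (n%:R * d).
  rewrite S0 ?mulr0 ?addr0; first by apply: b1; rewrite s0.
  by rewrite subr_le0 mulrC ler_pdivrMr.
rewrite (bE _ (ltW h)) addrAC.
apply: le_trans (ler_normD _ _) _; rewrite normrM.
have h1 : `|a (n%:R * d) - a s| <= L * d.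
  apply: le_trans (aL _ _) _; apply: ler_wpM2l => //.
  by rewrite distrC ger0_norm ?subr_ge0 ?(ltW h) // lerBlDl -nd.
have h2 : `|c| <= L * d.
  by apply: le_trans (aL _ _) _; rewrite nd addrAC subrr add0r ger0_norm // ltW.
have /andP[h3 h4] := S01 (d^-1 * s - n%:R).
rewrite (ger0_norm h3).
have h5 : `|c| * S (d^-1 * s - n%:R) <= L * d.
  by apply: le_trans h2; rewrite ler_piMr.
by lra.
Qed.

End SmoothApproximation.

(** * Weak derivatives of radial functions *)

Section ClassicalDerivatives.
Context {R : realType}.
Local Notation mu2 := (@lebesgue2 R).
Local Notation D := (@unit_disc R).

Lemma continuous_loc_integrable (f : R * R -> R) : continuous f -> loc_integrable D f.
Proof.
move=> cf; split; first exact: continuous_measurable_plane (@unit_disc_measurable R) cf.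
by move=> K cK _; exact: continuous_integrable_compact.
Qed.

Lemma continuous_square_integrable (f : R * R -> R) : continuous f -> square_integrable D f.
Proof.
move=> cf; split; first exact: continuous_measurable_plane (@unit_disc_measurable R) cf.
have [_ ii] := continuous_L2 cf.
have /integrableP[_] := ii; apply: le_lt_trans.
rewrite le_eqVlt; apply/orP; left; apply/eqP; apply: eq_integral => x _.
by rewrite /= ger0_norm ?expr2 // -expr2 sqr_ge0.
Qed.

Lemma is_weak_derivative0 (f : R * R -> R) : continuous f -> is_weak_derivative D [::] f f.
Proof.
move=> cf; have lf := continuous_loc_integrable cf; split => // phi _.
by rewrite expr0 mul1r.
Qed.

Lemma is_weak_derivative1 (f g : R * R -> R) i : continuous f -> continuous g ->
  (forall z : R * R, is_derive z (basis_vec R i) f (g z)) -> is_weak_derivative D [:: i] f g.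
Proof.
move=> cf cg fg; split; [exact: continuous_loc_integrable..|] => phi Tphi.
by rewrite (classical_weak_derivative fg cf cg Tphi) expr1 mulN1r.
Qed.

Lemma is_weak_derivative2 (f g h : R * R -> R) i j :
  continuous f -> continuous g -> continuous h ->
  (forall z : R * R, is_derive z (basis_vec R i) f (g z)) ->
  (forall z : R * R, is_derive z (basis_vec R j) g (h z)) ->
  is_weak_derivative D [:: i; j] f h.
Proof.
move=> cf cg ch fg gh; split; [exact: continuous_loc_integrable..|] => phi Tphi.
have := classical_weak_derivative fg cf cg (test_function_partial j Tphi).
rewrite (classical_weak_derivative gh cg ch Tphi) opprK /= => ->.
by rewrite sqrrN expr1n mul1r.
Qed.

Lemma ae_plane_and (P Q : R * R -> Prop) :
  {ae mu2, forall x, P x} -> {ae mu2, forall x, Q x} -> {ae mu2, forall x, P x /\ Q x}.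
Proof.
move=> aP aQ; have := negligibleU aP aQ; apply: negligibleS => x /= h.
by apply: contrapT => /not_orP[/contrapT p /contrapT q]; apply: h.
Qed.

Definition plane_coord (i : 'I_2) (x : R * R) : R := if i == ord0 then x.1 else x.2.

Lemma continuous_coord i : continuous (plane_coord i).
Proof.
by move=> x; rewrite /plane_coord; case: (i == ord0); [exact: cvg_fst|exact: cvg_snd].
Qed.

Lemma is_derive_coord i j (x : R * R) :
  is_derive x (basis_vec R i) (plane_coord j) (i == j)%:R.
Proof.
have [->|->] := ord2_cases j; [have := is_derive_fst x i|have := is_derive_snd x i];
by have [->|->] := ord2_cases i; rewrite /basis_vec /plane_coord /=.
Qed.

Lemma is_derive_normsq i (x : R * R) :
  is_derive x (basis_vec R i) (@normsq R) (2 * plane_coord i x).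
Proof.
have d1 := is_derive_fst x i; have d2 := is_derive_snd x i.
apply: (is_derive_eq (is_deriveD (is_deriveM d1 d1) (is_deriveM d2 d2))).
rewrite /GRing.scale /=; have [->|->] := ord2_cases i; rewrite /basis_vec /plane_coord /=; ring.
Qed.

Lemma sum_coord_sq (x : R * R) : \sum_(i < 2) plane_coord i x ^+ 2 = normsq x.
Proof. by rewrite big_ord_recl big_ord1. Qed.

Section Radial.
Variables (U U1 U2 : R -> R).
Hypotheses (dU : forall s : R, is_derive s 1 U (U1 s))
  (dU1 : forall s : R, is_derive s 1 U1 (U2 s)) (cU2 : continuous U2).

Let cU := is_derive_continuous dU.
Let cU1 := is_derive_continuous dU1.

Lemma continuous_radial (F : R -> R) : continuous F -> continuous (fun x => F (normsq x)).
Proof.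
move=> cF x; apply: (@continuous_comp _ _ _ (@normsq R) F); last exact: cF.
exact: (smooth_continuous smooth_normsq).
Qed.

Definition radial_partial i x := U1 (normsq x) * (2 * plane_coord i x).

Definition radial_partial2 i j x :=
  4 * U2 (normsq x) * plane_coord i x * plane_coord j x + 2 * (i == j)%:R * U1 (normsq x).

Lemma is_derive_radial i (x : R * R) :
  is_derive x (basis_vec R i) (fun x => U (normsq x)) (radial_partial i x).
Proof. exact: is_derive_comp_line (dU _) (is_derive_normsq i x). Qed.

Lemma is_derive_radial_partial i j (x : R * R) :
  is_derive x (basis_vec R j) (radial_partial i) (radial_partial2 i j x).
Proof.
have d1 := is_derive_comp_line (dU1 (normsq x)) (is_derive_normsq j x).
have d2 := is_deriveM (is_derive_cst (2 : R) x (basis_vec R j)) (is_derive_coord j i x).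
apply: (is_derive_eq (is_deriveM d1 d2)).
rewrite /GRing.scale /radial_partial2 eq_sym !fctE /=; ring.
Qed.

Lemma continuous_radial_partial i : continuous (radial_partial i).
Proof.
apply: continuousM2; first exact: continuous_radial.
by apply: continuousM2; [move=> x; exact: cvg_cst|exact: continuous_coord].
Qed.

Lemma continuous_radial_partial2 i j : continuous (radial_partial2 i j).
Proof.
apply: continuousD2; apply: continuousM2; try by [exact: continuous_coord|exact: continuous_radial|move=> x; exact: cvg_cst].
apply: continuousM2; last exact: continuous_coord.
by apply: continuousM2; [move=> x; exact: cvg_cst|exact: continuous_radial].
Qed.

Lemma radial_weak_partial i :
  is_weak_derivative D [:: i] (fun x => U (normsq x)) (radial_partial i).
Proof.
apply: is_weak_derivative1 => [||x]; [exact: continuous_radial|exact: continuous_radial_partial|].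
exact: is_derive_radial.
Qed.

Lemma radial_weak_partial2 i j :
  is_weak_derivative D [:: i; j] (fun x => U (normsq x)) (radial_partial2 i j).
Proof.
apply: (@is_weak_derivative2 _ (radial_partial i)) => [|||x|x].
- exact: continuous_radial.
- exact: continuous_radial_partial.
- exact: continuous_radial_partial2.
- exact: is_derive_radial.
- exact: is_derive_radial_partial.
Qed.

Lemma radial_sobolev2 : sobolev 2 D (fun x => U (normsq x)).
Proof.
have cu := continuous_radial cU; split; first exact: continuous_square_integrable.
move=> [|i [|j [|//]]] _.
- by exists (fun x => U (normsq x)); [exact: is_weak_derivative0|exact: continuous_square_integrable].
- exists (radial_partial i); first exact: radial_weak_partial.
  by apply: continuous_square_integrable; exact: continuous_radial_partial.
- exists (radial_partial2 i j); first exact: radial_weak_partial2.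
  by apply: continuous_square_integrable; exact: continuous_radial_partial2.
Qed.

(** The planar Laplacian of U(|x|^2) is 4 (s U'' + U') at s = |x|^2; the equality is almost
    everywhere because the weak Laplacian is built from chosen representatives. *)
Lemma radial_weak_laplacian :
  {ae mu2, forall x, D x -> weak_laplacian D (fun x => U (normsq x)) x =
     4 * (normsq x * U2 (normsq x) + U1 (normsq x))}.
Proof.
have h i : {ae mu2, forall x, D x -> weak_derivative D [:: i; i] (fun x => U (normsq x)) x =
    radial_partial2 i i x}.
  apply: weak_derivative_unique (radial_weak_partial2 i i).
  by apply: weak_derivativeP; exists (radial_partial2 i i); exact: radial_weak_partial2.
have := ae_plane_and (h ord0) (h (lift ord0 ord0)); apply: ae_plane_sub => x [h0 h1] Dx.
rewrite /weak_laplacian big_ord_recl big_ord1 h0 // h1 // /radial_partial2 !eqxx mulr1.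
have E : normsq x = plane_coord ord0 x ^+ 2 + plane_coord (lift ord0 ord0) x ^+ 2.
  by rewrite -sum_coord_sq big_ord_recl big_ord1.
rewrite [X in 4 * (X * _ + _)]E; ring.
Qed.

End Radial.
End ClassicalDerivatives.

(** * Radial functions vanishing on the unit circle *)

Section RadialSobolev0.
Context {R : realType}.
Local Notation mu2 := (@lebesgue2 R).
Local Notation D := (@unit_disc R).
Variables (W W1 : R -> R) (L : R).
Hypotheses (dW : forall s : R, is_derive s 1 W (W1 s))
  (W1L : forall x y, `|W1 x - W1 y| <= L * `|x - y|) (W0 : W 1 = 0).

(** 2 L bounds the smoothing error of W1, and L + |W1 0| bounds W1 itself on [0, 1]. *)
Let C := 3 * L + `|W1 0|.

(** The derivative is approximated and cut off, not W itself: since W 1 = 0, the primitive vanishing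
    near 1 is then close to W. On the last layer, of width 2 d, the error of the derivative is only
    bounded by C, which costs a term of order d. *)
Lemma exists_smooth_cutoff_primitive (n : nat) (d := n.+1%:R^-1) :
  exists A a : R -> R,
  [/\ forall s : R, is_derive s 1 A (a s), smooth1 A & smooth1 a] /\
  [/\ forall s, 1 - d <= s -> A s = 0,
      forall s, 0 <= s <= 1 -> `|a s - W1 s| <= C,
      forall s, 0 <= s <= 1 - 2 * d -> `|a s - W1 s| <= C * d &
      forall s, 0 <= s <= 1 -> `|A s - W s| <= 3 * C * d].
Proof.
have n0 : (0 : R) < n.+1%:R by rewrite ltr0n.
have d0 : 0 < d by rewrite invr_gt0.
have d1 : d <= 1 by rewrite invf_le1 // ler1n.
have nd : n.+1%:R * d = 1 by rewrite /d divff // gt_eqF.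
have L0 : 0 <= L.
  by have := le_trans (normr_ge0 _) (W1L 0 1); rewrite sub0r normrN1 mulr1.
have [S [SS S0 S1 S01 _]] := @exists_smooth_step R.
have [b Sb bE] := @exists_smooth_approximation R W1 L d n.+1 d0 W1L.
rewrite nd in bE.
(* The cutoff is 1 for s <= 1 - 2 d and 0 for s >= 1 - d. *)
pose k s := S (n.+1%:R * (1 - s) - 1).
have Sk : smooth1 k.
  apply: (smooth1_comp SS) => m; apply: CnB; last exact: Cn_cst.
  exact: smooth1_affine.
pose a s := b s * k s.
have Sa : smooth1 a by move=> m; apply: CnM; [exact: Sb|exact: Sk].
have a0 s : 1 - d <= s -> a s = 0.
  move=> h; have h' : n.+1%:R * (1 - s) <= n.+1%:R * d by rewrite ler_pM2l //; lra.
  by rewrite /a /k S0 ?mulr0 // subr_le0 -[X in _ <= X]nd.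
have [A dA A0] := @exists_primitive_right R a (1 - d) (Cn_continuous (Sa 0%N)) a0.
have W1b s : 0 <= s <= 1 -> `|W1 s| <= L + `|W1 0|.
  move=> /andP[s0 s1]; have := W1L s 0; rewrite subr0 (ger0_norm s0) => h.
  have h2 : L * s <= L by rewrite ler_piMr.
  have := ler_normD (W1 s - W1 0) (W1 0); rewrite subrK => h3; lra.
have aC s : 0 <= s <= 1 -> `|a s - W1 s| <= C.
  move=> s01; have := S01 (n.+1%:R * (1 - s) - 1); rewrite -/(k s) => /andP[k0 k1].
  have -> : a s - W1 s = k s * (b s - W1 s) - (1 - k s) * W1 s by rewrite /a; ring.
  have k1' : 0 <= 1 - k s by rewrite subr_ge0.
  apply: le_trans (ler_normB _ _) _; rewrite !normrM (ger0_norm k0) (ger0_norm k1').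
  have h1 : k s * `|b s - W1 s| <= 2 * L.
    apply: (@le_trans _ _ (`|b s - W1 s|)); first by rewrite ler_piMl.
    by apply: le_trans (bE s s01) _; rewrite ler_piMr // mulr_ge0.
  have h2 : (1 - k s) * `|W1 s| <= L + `|W1 0|.
    by apply: le_trans (W1b s s01); rewrite ler_piMl // gerBl.
  rewrite /C; lra.
have ad s : 0 <= s <= 1 - 2 * d -> `|a s - W1 s| <= C * d.
  move=> /andP[s0 s1]; have -> : a s = b s.
    have h' : n.+1%:R * (2 * d) <= n.+1%:R * (1 - s) by rewrite ler_pM2l //; lra.
    rewrite /a /k S1 ?mulr1 //; move: h'; rewrite mulrCA nd; lra.
  have h : 0 <= s <= 1 by rewrite s0 /=; lra.
  apply: le_trans (bE s h) _; rewrite ler_wpM2r ?(ltW d0) // /C.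
  by have := normr_ge0 (W1 0); lra.
have C0 : 0 <= C by rewrite /C; have := normr_ge0 (W1 0); lra.
exists A, a; split; first by split => //; exact: smooth1_primitive dA Sa.
split => // s /andP[s0 s1].
have de (x : R) : is_derive x 1 (fun x => A x - W x) (a x - W1 x) by exact: is_deriveB (dA x) (dW x).
have e1 : A 1 - W 1 = 0 by rewrite W0 A0 ?subr0 // gerBl ltW.
have near1 x : 0 <= x -> 1 - 2 * d <= x -> x <= 1 -> `|A x - W x| <= 2 * C * d.
  move=> x0 xd x1; have [c /andP[c1 c2]] := derive_mean_value x1 de; rewrite e1 sub0r => /eqP.
  rewrite eqr_oppLR => /eqP ->; rewrite normrN normrM (ger0_norm (x := 1 - x)) ?subr_ge0 //.
  have -> : 2 * C * d = C * (2 * d) by ring.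
  apply: ler_pM => //; first by rewrite subr_ge0.
    by apply: aC; rewrite (le_trans x0 c1) c2.
  by lra.
have [sd|sd] := leP (1 - 2 * d) s.
  apply: le_trans (near1 _ s0 sd s1) _; rewrite ler_wpM2r ?(ltW d0) //; lra.
have [c /andP[c1 c2]] := derive_mean_value (ltW sd) de => E.
have h0 : 0 <= 1 - 2 * d by rewrite (le_trans s0) // ltW.
have h1 := near1 _ h0 (lexx _) (_ : _ <= 1).
have {}h1 : `|A (1 - 2 * d) - W (1 - 2 * d)| <= 2 * C * d by apply: h1; lra.
have h2 : `|(a c - W1 c) * (1 - 2 * d - s)| <= C * d.
  rewrite normrM; apply: (@le_trans _ _ (`|a c - W1 c|)).
    by rewrite ler_piMr // ger0_norm ?subr_ge0 ?(ltW sd) //; lra.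
  by apply: ad; rewrite (le_trans s0 c1).
rewrite -E in h2.
have -> : A s - W s = (A (1 - 2 * d) - W (1 - 2 * d)) -
  (A (1 - 2 * d) - W (1 - 2 * d) - (A s - W s)) by ring.
apply: le_trans (ler_normB _ _) _.
apply: le_trans (lerD h1 h2) _; lra.
Qed.


Variable W2 : R -> R.
Hypotheses (dW1 : forall s : R, is_derive s 1 W1 (W2 s)) (cW2 : continuous W2).

(** Dominated convergence: the error density, a function of s = |x|^2, is bounded on [0, 1] and
    tends to 0 for s < 1. *)
Lemma radial_sobolev0 : sobolev0 D (fun x => W (normsq x)).
Proof.
have mD := @unit_disc_measurable R; have [sq sW] := radial_sobolev2 dW dW1 cW2.
split; first by split => // s s1; apply: sW; exact: leq_trans s1 _.
have /choice[A /choice[a HA]] := exists_smooth_cutoff_primitive.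
have dA n (s : R) : is_derive s 1 (A n) (a n s) by have [[]] := HA n.
have n0 n : (0 : R) < n.+1%:R^-1 by rewrite invr_gt0 ltr0n.
have n1 n : n.+1%:R^-1 <= 1 :> R by rewrite invf_le1 ?ltr0n // ler1n.
have C0 : 0 <= C by have [_ [_ h _ _]] := HA 0%N; apply: le_trans (normr_ge0 _) (h 0 _); rewrite lexx ler01.
exists (fun n x => A n (normsq x)); split => [n|].
  have [[_ SA _] [A0 _ _ _]] := HA n.
  by apply: (@radial_test_function _ _ (1 - n.+1%:R^-1)) => //; rewrite gtrBl.
(* The factor 4 s is the sum of the squares of the 2 x_i produced by the chain rule. *)
pose F n s := (A n s - W s) ^+ 2 + 4 * s * (a n s - W1 s) ^+ 2.
have cF n : continuous (F n).
  have [[_ _ Sa] _] := HA n.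
  have cA := is_derive_continuous (dA n); have ca : continuous (a n) := Cn_continuous (Sa 0%N).
  have cW := is_derive_continuous dW; have cW1 := is_derive_continuous dW1.
  move=> s; apply: cvgD; first by apply: cvgM; apply: cvgB; by [exact: cA|exact: cW].
  apply: cvgM; first by apply: cvgM; [exact: cvg_cst|exact: cvg_id].
  by apply: cvgM; apply: cvgB; by [exact: ca|exact: cW1].
have wd i : {ae mu2, forall x, D x -> weak_derivative D [:: i] (fun x => W (normsq x)) x =
    radial_partial W1 i x}.
  apply: weak_derivative_unique (radial_weak_partial dW dW1 i).
  by apply: weak_derivativeP; exists (radial_partial W1 i); exact: radial_weak_partial dW dW1 i.
have mwd i : measurable_fun (D : set (borel_plane R)) (weak_derivative D [:: i] (fun x => W (normsq x))).
  have [] := @weak_derivativeP R [:: i] (fun x => W (normsq x)).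
    by exists (radial_partial W1 i); exact: radial_weak_partial dW dW1 i.
  by move=> _ [].
have pA n i x : partials [:: i] (fun x => A n (normsq x)) x = a n (normsq x) * (2 * plane_coord i x).
  exact: (@derive_val _ _ _ _ _ _ _ (is_derive_radial (dA n) i x)).
have E n : (\int[mu2]_(x in D) ((A n (normsq x) - W (normsq x)) ^+ 2 +
        \sum_(i < 2) (partials [:: i] (fun x => A n (normsq x)) x -
                      weak_derivative D [:: i] (fun x => W (normsq x)) x) ^+ 2)%:E =
    \int[mu2]_(x in D) (F n (normsq x))%:E)%E.
  have [[_ SA _] [A0 _ _ _]] := HA n.
  have TA : test_function D (fun x => A n (normsq x)).
    by apply: (@radial_test_function _ _ (1 - n.+1%:R^-1)) => //; rewrite gtrBl.
  apply: ae_eq_integral => //.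
  - apply/measurable_EFinP; apply: measurable_funD.
      apply: measurable_funX; apply: continuous_measurable_plane => // x; apply: cvgB.
        exact: (continuous_radial (is_derive_continuous (dA n))).
      exact: (continuous_radial (is_derive_continuous dW)).
    apply: measurable_sum => i; apply: measurable_funX; apply: measurable_funB => //.
    apply: continuous_measurable_plane => //; apply: smooth_continuous.
    by have [] := test_function_partial i TA.
  - apply/measurable_EFinP; apply: continuous_measurable_plane => //.
    exact: continuous_radial (cF n).
  have := ae_plane_and (wd ord0) (wd (lift ord0 ord0)); apply: ae_plane_sub => x [h0 h1] Dx.
  rewrite big_ord_recl big_ord1 h0 // h1 // !pA /F /radial_partial; congr EFin.
  have Nx : normsq x = plane_coord ord0 x ^+ 2 + plane_coord (lift ord0 ord0) x ^+ 2.
    by rewrite -sum_coord_sq big_ord_recl big_ord1.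
  rewrite [X in 4 * X]Nx; ring.
under eq_fun do rewrite E.
have Dn (x : R * R) : D x -> 0 <= normsq x < 1.
  by move=> /enorm_lt1 h; rewrite normsq_ge0.
pose B := (3 * C) ^+ 2 + 4 * C ^+ 2.
have F0 n s : 0 <= s <= 1 -> 0 <= F n s.
  by move=> /andP[s0 _]; rewrite addr_ge0 ?sqr_ge0 // mulr_ge0 ?sqr_ge0 // mulr_ge0.
have FB n s : 0 <= s <= 1 -> F n s <= B.
  move=> /[dup] s01 /andP[s0 s1]; have [_ [_ h1 _ h2]] := HA n.
  rewrite /F /B lerD //.
    rewrite -[X in X <= _]real_normK ?num_real // ler_sqr ?nnegrE ?mulr_ge0 //.
    by apply: le_trans (h2 s s01) _; rewrite ler_piMr // mulr_ge0.
  apply: ler_pM; rewrite ?sqr_ge0 ?mulr_ge0 //; first by rewrite ler_piMr.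
  by rewrite -[X in X <= _]real_normK ?num_real // ler_sqr ?nnegrE //; exact: h1.
have Fcv s : 0 <= s < 1 -> F ^~ s @ \oo --> 0.
  move=> /andP[s0 s1]; have s2 : 0 < (1 - s) / 2 by rewrite divr_gt0 // subr_gt0.
  (* [F n s] is at most B / (n + 1) as soon as s lies below the last layer. *)
  have Bd : (fun n => B * n.+1%:R^-1) @ \oo --> 0.
    rewrite -[X in _ --> X](mulr0 B); apply: cvgM; first exact: cvg_cst.
    exact: cvg_harmonic.
  apply: (squeeze_cvgr _ (cvg_cst 0) Bd); near=> n.
  have s01 : 0 <= s <= 1 by rewrite s0 ltW.
  rewrite F0 //=; have [_ [_ _ h1 h2]] := HA n.
  have sn : n.+1%:R^-1 < (1 - s) / 2.
    by near: n; exact: (near_infty_natSinv_lt (PosNum s2)).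
  have {}h2 := h2 s s01; have d0 := n0 n; have d1 := n1 n.
  move: (n.+1%:R^-1 : R) h1 h2 sn d0 d1 => d h1 h2 sn d0 d1.
  have {}h1 : `|a n s - W1 s| <= C * d by apply: h1; rewrite s0 /=; lra.
  have dd : d ^+ 2 <= d by rewrite expr2 ler_piMr // ltW.
  have h3 : (A n s - W s) ^+ 2 <= (3 * C) ^+ 2 * d.
    apply: (@le_trans _ _ ((3 * C * d) ^+ 2)).
      rewrite -[X in X <= _]real_normK ?num_real // ler_sqr ?nnegrE ?mulr_ge0 //; exact: ltW.
    by rewrite exprMn ler_wpM2l // sqr_ge0.
  have h4 : (a n s - W1 s) ^+ 2 <= C ^+ 2 * d.
    apply: (@le_trans _ _ ((C * d) ^+ 2)).
      rewrite -[X in X <= _]real_normK ?num_real // ler_sqr ?nnegrE ?mulr_ge0 //; exact: ltW.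
    by rewrite exprMn ler_wpM2l // sqr_ge0.
  have h5 : 4 * s * (a n s - W1 s) ^+ 2 <= 4 * (C ^+ 2 * d).
    rewrite -mulrA ler_wpM2l //; apply: le_trans h4.
    by rewrite ler_piMl ?sqr_ge0 // ltW.
  apply: le_trans (lerD h3 h5) _; rewrite le_eqVlt; apply/orP; left; apply/eqP; rewrite /B; ring.
have mF n : measurable_fun (D : set (borel_plane R)) (fun x => (F n (normsq x))%:E).
  apply/measurable_EFinP; apply: continuous_measurable_plane => //.
  exact: continuous_radial (cF n).
have aecv : {ae mu2, forall x, D x -> (fun n => (F n (normsq x))%:E) @ \oo --> cst 0%E x}.
  by apply: aeW => x Dx; apply: cvg_EFin; [exact: nearW|exact: Fcv (Dn _ Dx)].
have iB : mu2.-integrable D (fun _ => B%:E).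
  by apply: continuous_integrable_disc => x; exact: cvg_cst.
have aebnd : {ae mu2, forall x n, D x -> (`|(F n (normsq x))%:E| <= B%:E)%E}.
  apply: aeW => x n /Dn/andP[h0 /ltW h1].
  by rewrite /= lee_fin ger0_norm ?F0 ?FB ?h0.
have [_ _ H] := @dominated_convergence _ _ _ mu2 D mD
  (fun n x => (F n (normsq x))%:E) (cst 0%E) (fun _ => B%:E)
  mF (measurable_cst _) aecv iB aebnd.
by rewrite integral0 in H.
Unshelve. all: by end_near. Qed.

End RadialSobolev0.

(** * The candidate and its energy *)

Section Candidate.
Context {R : realType}.
Local Notation mu2 := (@lebesgue2 R).
Local Notation mu := (@lebesgue_measure R).
Local Notation D := (@unit_disc R).

(* The candidate as a function of s = |x|^2, up to the factor u0 / (r^2 - 1 - 2 r^2 ln r);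
   in this variable it is of class C^2. *)
Definition profile (r s : R) : R :=
  if s <= r ^+ 2 then ln r * s - r ^+ 2 * ln r
  else - s + r ^+ 2 - 2 * r ^+ 2 * ln r + (r ^+ 2 + s) / 2 * ln s.

Definition profile1 (r s : R) : R :=
  if s <= r ^+ 2 then ln r else - 2^-1 + ln s / 2 + r ^+ 2 / 2 * s^-1.

(** The maximum replaces a case distinction: the expression vanishes for s <= r^2, and its
    continuity is immediate. *)
Definition profile2 (r s : R) : R :=
  let m := Num.max s (r ^+ 2) in m^-1 / 2 - r ^+ 2 / 2 * (m^-1 ^+ 2).

Lemma ln_sq (r : R) : 0 < r -> ln (r ^+ 2) = 2 * ln r.
Proof. by move=> r0; rewrite lnXn // mulr_natl. Qed.

Lemma is_derive_inv (s : R) : s != 0 -> is_derive s 1 (fun x : R => x^-1) (- s^-1 ^+ 2).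
Proof.
move=> s0; apply: (is_derive_eq (is_deriveV s0 (is_derive_id s 1))).
by rewrite /GRing.scale /= mulr1 exprVn.
Qed.

Lemma is_derive_profile (r s : R) : 0 < r -> is_derive s 1 (profile r) (profile1 r s).
Proof.
move=> r0; have a0 : 0 < r ^+ 2 by rewrite exprn_gt0.
move: s; apply: is_derive_glue.
- move=> s _.
  apply: (is_derive_eq (is_deriveB (is_deriveM (is_derive_cst (ln r) s 1) (is_derive_id s 1))
    (is_derive_cst (r ^+ 2 * ln r) s 1))).
  by rewrite /GRing.scale /=; ring.
- move=> s sa; have s0 := lt_le_trans a0 sa.
  have d1 := is_deriveM (is_deriveM (is_deriveD (is_derive_cst (r ^+ 2) s 1) (is_derive_id s 1))
    (is_derive_cst (2^-1 : R) s 1)) (is_derive1_ln s0).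
  have d2 := is_deriveB (is_deriveD (is_deriveN (is_derive_id s 1)) (is_derive_cst (r ^+ 2) s 1))
    (is_derive_cst (2 * r ^+ 2 * ln r) s 1).
  apply: (is_derive_eq (is_deriveD d2 d1)); rewrite /GRing.scale !fctE /=; field.
  by rewrite gt_eqF.
- by rewrite ln_sq //; field.
- by rewrite ln_sq //; field; rewrite gt_eqF.
Qed.

Lemma is_derive_profile1 (r s : R) : 0 < r -> is_derive s 1 (profile1 r) (profile2 r s).
Proof.
move=> r0; have a0 : 0 < r ^+ 2 by rewrite exprn_gt0.
have -> : profile2 r s = if s <= r ^+ 2 then 0 else s^-1 / 2 - r ^+ 2 / 2 * (s^-1 ^+ 2).
  rewrite /profile2; have [sa|sa] := leP s (r ^+ 2) => //.
  by field; rewrite gt_eqF.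
move: s; apply: is_derive_glue.
- move=> s sa; have s0 := lt_le_trans a0 sa; have s1 : s != 0 by rewrite gt_eqF.
  have d1 := is_deriveM (is_derive_cst (r ^+ 2 / 2) s 1) (is_derive_inv s1).
  have d2 := is_deriveD (is_derive_cst (- 2^-1 : R) s 1)
    (is_deriveM (is_derive1_ln s0) (is_derive_cst (2^-1 : R) s 1)).
  by apply: (is_derive_eq (is_deriveD d2 d1)); rewrite /GRing.scale /=; ring.
- by rewrite ln_sq //; field; rewrite gt_eqF.
- by field; rewrite gt_eqF.
Qed.

Lemma continuous_profile2 (r : R) : 0 < r -> continuous (profile2 r).
Proof.
move=> r0; have a0 : 0 < r ^+ 2 by rewrite exprn_gt0.
pose m (s : R) : R := Num.max s (r ^+ 2).
have m0 s : 0 < m s by rewrite lt_max a0 orbT.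
have cm : continuous m.
  by move=> s; apply: (@continuous_max R R id (cst (r ^+ 2)) s); [exact: cvg_id|exact: cvg_cst].
have cV : continuous (fun s => (m s)^-1).
  move=> s; apply: cvgV; last exact: cm.
  by rewrite gt_eqF.
move=> s; apply: cvgB; apply: cvgM; try exact: cvg_cst; first exact: cV.
by apply: cvgM; exact: cV.
Qed.

(** Makes [profile1] Lipschitz, as [radial_sobolev0] requires. *)
Lemma profile2_bounded (r s : R) : 0 < r -> `|profile2 r s| <= r ^- 2.
Proof.
move=> r0; have a0 : 0 < r ^+ 2 by rewrite exprn_gt0.
rewrite /profile2; set m := Num.max _ _.
have ma : r ^+ 2 <= m by rewrite le_max lexx orbT.
have m0 : 0 < m := lt_le_trans a0 ma.
have h1 : m^-1 <= r ^- 2 by rewrite lef_pV2.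
have h0 : 0 < m^-1 by rewrite invr_gt0.
have h2 : 0 <= r ^+ 2 * m^-1 ^+ 2 by rewrite mulr_ge0 ?sqr_ge0 // ltW.
have h3 : r ^+ 2 * m^-1 ^+ 2 <= m^-1.
  by rewrite expr2 mulrA ler_piMl ?(ltW h0) // ler_pdivrMr // mul1r.
rewrite ler_norml; lra.
Qed.

Lemma radial_candidateE (u0 r : R) : 0 < r ->
  radial_candidate u0 r =
  (fun x => u0 / (r ^+ 2 - 1 - 2 * r ^+ 2 * ln r) * profile r (normsq x)).
Proof.
move=> r0; apply/funext => x; rewrite /radial_candidate /profile.
have Nx : enorm x ^+ 2 = normsq x by rewrite sqr_sqrtr // normsq_ge0.
have E0 : 0 <= enorm x by rewrite sqrtr_ge0.
have -> : (enorm x <= r) = (normsq x <= r ^+ 2) by rewrite -Nx ler_sqr ?nnegrE // ltW.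
case: ifPn => h; rewrite Nx; first by rewrite -!mulrA; congr (_ * _); rewrite mulrC.
have x0 : 0 < enorm x.
  rewrite lt_neqAle E0 andbT; apply: contraNneq h => e; rewrite -Nx -e expr0n /=.
  by rewrite sqr_ge0.
have -> : ln (enorm x) = ln (normsq x) / 2 by rewrite -Nx ln_sq //; field.
rewrite -[RHS]mulrA; congr (_ * _); rewrite mulrC; congr (_ * _).
by field.
Qed.


(** Up to a constant factor, the Laplacian of the candidate is the logarithmic profile truncated at
    radius r: harmonic outside, constant inside. *)
Lemma profile_laplacian (r s : R) : 0 < r ->
  4 * (s * profile2 r s + profile1 r s) = 2 * ln (Num.max s (r ^+ 2)).
Proof.
move=> r0; have a0 : 0 < r ^+ 2 by rewrite exprn_gt0.
rewrite /profile2 /profile1; have [sa|sa] := leP s (r ^+ 2).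
  rewrite ln_sq //; field; rewrite gt_eqF //.
by field; rewrite gt_eqF // (lt_trans a0 sa).
Qed.

Lemma integral_ln_max_sq (r c : R) : 0 < r -> r < 1 ->
  (\int[mu]_(s in `[0%R, 1%R[) ((2 * c * ln (Num.max s (r ^+ 2))) ^+ 2)%:E =
   (16 * c ^+ 2 * radial_gap r)%:E)%E.
Proof.
move=> r0 r1; have a0 : 0 < r ^+ 2 by rewrite exprn_gt0.
have a1 : r ^+ 2 < 1 by rewrite expr_lt1 // ltW.
set a := r ^+ 2 in a0 a1 *.
pose q (s : R) := 2 * c * ln (Num.max s a).
have cq : continuous q.
  move=> s; apply: cvgM; first exact: cvg_cst.
  apply: (@continuous_comp _ _ _ (fun s : R => Num.max s a) (@ln R)).
    by apply: (@continuous_max R R id (cst a) s); [exact: cvg_id|exact: cvg_cst].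
  by apply: continuous_ln; rewrite lt_max a0 orbT.
have cqq : continuous (fun s => q s ^+ 2) by move=> s; apply: cvgM; exact: cq.
(* An explicit primitive; the constant in the inner branch makes the two branches agree at [a]. *)
pose Q (s : R) := if s <= a then 4 * c ^+ 2 * (ln a ^+ 2 * s + (2 * a - 2 * a * ln a))
  else 4 * c ^+ 2 * (s * ln s ^+ 2 - 2 * s * ln s + 2 * s).
have dQ (s : R) : is_derive s 1 Q (q s ^+ 2).
  have -> : q s ^+ 2 = if s <= a then 4 * c ^+ 2 * ln a ^+ 2 else 4 * c ^+ 2 * ln s ^+ 2.
    by rewrite /q; case: leP => _; ring.
  move: s; apply: is_derive_glue.
  - move=> s _.
    have d := is_deriveM (is_derive_cst (4 * c ^+ 2) s 1)
      (is_deriveD (is_deriveM (is_derive_cst (ln a ^+ 2) s 1) (is_derive_id s 1))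
        (is_derive_cst (2 * a - 2 * a * ln a) s 1)).
    by apply: (is_derive_eq d); rewrite /GRing.scale /=; ring.
  - move=> s sa; have s0 := lt_le_trans a0 sa.
    have dl := is_derive1_ln s0; have di := is_derive_id s (1 : R).
    have d2 := is_deriveM (is_derive_cst (2 : R) s 1) di.
    have d := is_deriveM (is_derive_cst (4 * c ^+ 2) s 1)
      (is_deriveD (is_deriveB (is_deriveM di (is_deriveM dl dl)) (is_deriveM d2 dl)) d2).
    apply: (is_derive_eq d); rewrite /GRing.scale !fctE /=; field.
    by rewrite gt_eqF.
  - by ring.
  - by [].
rewrite integral_itv_bndo_bndc; last first.
  apply/measurable_EFinP; apply: measurable_funTS; exact: continuous_measurable_fun.
rewrite (integral_derive ler01 dQ cqq) /Q leNgt a1 /= (ltW a0) ln1 /radial_gap; congr EFin.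
by rewrite /a ln_sq //; field.
Qed.

Lemma weak_laplacian_measurable (u : R * R -> R) : sobolev 2 D u ->
  measurable_fun (D : set (borel_plane R)) (weak_laplacian D u).
Proof.
move=> [_ du]; apply: measurable_sum => i.
have [] := @weak_derivativeP R [:: i; i] u; last by move=> _ [].
by have [v ? _] := du [:: i; i] isT; exists v.
Qed.

Section Energy.
Variables (u0 r : R).
Hypotheses (u00 : 0 < u0) (r0 : 0 < r) (r1 : r < 1).

Let c := u0 / (r ^+ 2 - 1 - 2 * r ^+ 2 * ln r).

Let cE : c = - (u0 / (2 * radial_gap r)).
Proof.
have g0 := radial_gap_gt0 r0 r1.
have -> : c = u0 / - (2 * radial_gap r).
  by rewrite /c; congr (_ / _); rewrite /radial_gap; field.
by rewrite invrN mulrN.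
Qed.

Let c0 : c < 0.
Proof. by rewrite cE oppr_lt0 divr_gt0 // mulr_gt0 // radial_gap_gt0. Qed.

Let dU (s : R) : is_derive s 1 (fun s => c * profile r s) (c * profile1 r s).
Proof. exact: is_deriveZ (is_derive_profile s r0). Qed.

Let dU1 (s : R) : is_derive s 1 (fun s => c * profile1 r s) (c * profile2 r s).
Proof. exact: is_deriveZ (is_derive_profile1 s r0). Qed.

Let cU2 : continuous (fun s => c * profile2 r s).
Proof. by move=> s; apply: cvgM; [exact: cvg_cst|exact: continuous_profile2]. Qed.

Lemma radial_candidate_admissible : admissible D (cst u0) (radial_candidate u0 r).
Proof.
rewrite radial_candidateE // -/c; split; first exact: radial_sobolev2 dU dU1 cU2.
have dW (s : R) : is_derive s 1 (fun s => c * profile r s - u0) (c * profile1 r s).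
  by apply: (is_derive_eq (is_deriveB (dU s) (is_derive_cst u0 s 1))); rewrite subr0.
apply: (@radial_sobolev0 _ (fun s => c * profile r s - u0) _ (`|c| * r ^- 2) dW _ _ _ dU1 cU2).
- apply: derive_bounded_lipschitz dU1 _ => s.
  by rewrite normrM ler_wpM2l // profile2_bounded.
- rewrite /profile leNgt expr_lt1 // ?(ltW r0) // r1 /= ln1 mulr0 addr0 /c.
  have -> : - 1 + r ^+ 2 - 2 * r ^+ 2 * ln r = r ^+ 2 - 1 - 2 * r ^+ 2 * ln r by ring.
  rewrite divfK ?subrr //.
  have g0 := radial_gap_gt0 r0 r1.
  have -> : r ^+ 2 - 1 - 2 * r ^+ 2 * ln r = - (2 * radial_gap r) by rewrite /radial_gap; field.
  by rewrite oppr_eq0 mulf_neq0 // gt_eqF.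
Qed.

Lemma integral_candidate_laplacian :
  (\int[mu2]_(x in D) (weak_laplacian D (radial_candidate u0 r) x ^+ 2)%:E =
   (4 * pi * u0 ^+ 2 / radial_gap r)%:E)%E.
Proof.
have mD := @unit_disc_measurable R; have g0 := radial_gap_gt0 r0 r1.
have a0 : 0 < r ^+ 2 by rewrite exprn_gt0.
pose F s := (2 * c * ln (Num.max s (r ^+ 2))) ^+ 2.
have cF : continuous F.
  have cq : continuous (fun s : R => 2 * c * ln (Num.max s (r ^+ 2))).
    move=> s; apply: cvgM; first exact: cvg_cst.
    apply: (@continuous_comp _ _ _ (fun s : R => Num.max s (r ^+ 2)) (@ln R)).
      by apply: (@continuous_max R R id (cst (r ^+ 2)) s); [exact: cvg_id|exact: cvg_cst].
    by apply: continuous_ln; rewrite lt_max a0 orbT.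
  by move=> s; apply: cvgM; exact: cq.
have [S2 _] := radial_candidate_admissible.
have -> : (\int[mu2]_(x in D) (weak_laplacian D (radial_candidate u0 r) x ^+ 2)%:E =
  \int[mu2]_(x in D) (F (normsq x))%:E)%E.
  apply: ae_eq_integral => //.
  - by apply/measurable_EFinP; apply: measurable_funX; exact: weak_laplacian_measurable S2.
  - apply/measurable_EFinP; apply: continuous_measurable_plane => //.
    exact: continuous_radial cF.
  have := radial_weak_laplacian dU dU1 cU2; rewrite radial_candidateE // -/c.
  apply: ae_plane_sub => x + Dx => -> //; congr (_ ^+ 2)%:E.
  by rewrite mulrCA -mulrDr mulrCA profile_laplacian // mulrA [c * 2]mulrC.
rewrite integral_radial; [|exact: continuous_measurable_fun|by move=> s; rewrite sqr_ge0].
rewrite integral_ln_max_sq // -EFinM cE sqrrN; congr EFin.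
move: (radial_gap r) g0 (pi : R) => g g0 p; field.
by rewrite gt_eqF.
Qed.

(** For |x| < r the candidate is c ln r (|x|^2 - r^2) with c and ln r negative, hence nonpositive.
    One inequality suffices, as the energy is bounded from below by [energy_ge_h]. *)
Lemma candidate_support_le :
  (mu2 [set x | D x /\ (0 < radial_candidate u0 r x)%R] <= (pi * (1 - r ^+ 2))%:E)%E.
Proof.
have mD := @unit_disc_measurable R.
have a0 : 0 < r ^+ 2 by rewrite exprn_gt0.
have a1 : r ^+ 2 < 1 by rewrite expr_lt1 // ltW.
have cu : continuous (radial_candidate u0 r).
  rewrite radial_candidateE //; apply: (@continuous_radial _ (fun s => c * profile r s)).
  exact: is_derive_continuous dU.
pose E : set (borel_plane R) := [set x | normsq x < r ^+ 2].
have oE : open E.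
  apply: (@open_comp _ _ (@normsq R) [set t | t < r ^+ 2]); last exact: open_lt.
  by move=> x _; exact: (smooth_continuous smooth_normsq).
have mE : measurable E by exact: open_measurable_plane.
have DE : mu2 (D `\` E) = (pi * (1 - r ^+ 2))%:E.
  rewrite measureD //; last exact: unit_disc_ltoo.
  rewrite setIidr; last by move=> x /= xa; apply/enorm_lt1; exact: lt_trans xa a1.
  transitivity (pi%:E - (pi * Num.max (r ^+ 2) 0)%:E)%E.
    by congr (_ - _)%E; [exact: unit_disc_area|exact: disc_area].
  by rewrite max_l ?(ltW a0) // -EFinB mulrBr mulr1.
rewrite -DE; apply: le_measure; rewrite ?inE.
- apply: measurableI => //; apply: open_measurable_plane.
  apply: (@open_comp _ _ (radial_candidate u0 r) [set t | 0 < t]); last exact: open_gt.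
  by move=> x _; exact: cu.
- exact: measurableD.
move=> x [Dx]; rewrite radial_candidateE // -/c => ux; split => // xE.
move: ux; rewrite /profile ltW //= -[r ^+ 2 * _]mulrC -mulrBr; apply/negP; rewrite -leNgt.
rewrite nmulr_rle0 //; apply: mulr_le0; first by rewrite ln_le0 // ltW.
by rewrite subr_le0 ltW.
Qed.

Lemma energy_candidate_le : (energy D (radial_candidate u0 r) <= (radial_energy u0 r)%:E)%E.
Proof.
rewrite /energy integral_candidate_laplacian radial_energyE EFinD leeD2l //.
exact: candidate_support_le.
Qed.

End Energy.
End Candidate.

(** * Existence of minimizers *)

Section Minimizers.
Context {R : realType}.
Local Notation mu2 := (@lebesgue2 R).
Local Notation D := (@unit_disc R).
Variables (u0 : R).
Hypothesis u00 : 0 < u0.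

Lemma minimizer_energy_le (u : R * R -> R) : admissible D (cst u0) u ->
  (energy D u <= (h u0)%:E)%E ->
  minimizer D (cst u0) u /\ energy D u = (h u0)%:E.
Proof.
move=> Au uh; have hu w : admissible D (cst u0) w -> ((h u0)%:E <= energy D w)%E.
  exact: energy_ge_h.
have E : energy D u = (h u0)%:E by apply: le_anti; rewrite uh hu.
split => //; split => //; apply: le_anti; apply/andP; split.
  by rewrite E; apply: le_ereal_inf_tmp => _ [w Aw <-]; exact: hu.
by apply: ereal_inf_lbound; exists u.
Qed.

Lemma const_admissible : admissible D (cst u0) (cst u0).
Proof.
have d (c s : R) : is_derive s 1 (cst c : R -> R) 0 by exact: is_derive_cst.
have cc : continuous (fun _ : R => 0 : R) by move=> x; exact: cvg_cst.
split; first exact: (radial_sobolev2 (d u0) (d 0) cc).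
rewrite (_ : (fun x => _) = (fun x => cst (0 : R) (normsq x))); last first.
  by apply/funext => x; rewrite /= subrr.
apply: (radial_sobolev0 (L := 0) (d 0) _ _ (d 0) cc) => // x y.
by rewrite subrr normr0 mul0r.
Qed.

Lemma energy_const : energy D (cst u0) = pi%:E.
Proof.
have d (c s : R) : is_derive s 1 (cst c : R -> R) 0 by exact: is_derive_cst.
have cc : continuous (fun _ : R => 0 : R) by move=> x; exact: cvg_cst.
have mD := @unit_disc_measurable R; have [S2 _] := const_admissible.
rewrite /energy (_ : [set x | _] = D); last first.
  by apply/seteqP; split => x [].
rewrite [X in (X + _)%E](_ : _ = 0%E) ?add0e; first exact: unit_disc_area.
rewrite -(integral0 mu2 D); apply: ae_eq_integral => //.
  apply/measurable_EFinP; apply: measurable_funX; exact: weak_laplacian_measurable S2.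
have := radial_weak_laplacian (d u0) (d 0) cc; apply: ae_plane_sub => x + Dx => -> //.
by rewrite mulr0 addr0 mulr0 expr0n.
Qed.

Lemma continuous_radial_energy (r : R) : 0 < r -> r < 1 -> {for r, continuous (radial_energy u0)}.
Proof.
move=> r0 r1; have c2 : {for r, continuous (fun r : R => r ^+ 2)} by exact: exprn_continuous.
have cg : {for r, continuous (@radial_gap R)}.
  apply: cvgD; apply: cvgM; try exact: cvg_cst; try exact: c2; last exact: continuous_ln.
  by apply: cvgB; [exact: cvg_cst|exact: c2].
apply: cvgD; apply: cvgM; try exact: cvg_cst; last by apply: cvgB; [exact: cvg_cst|exact: c2].
by apply: cvgV; [rewrite gt_eqF // radial_gap_gt0|exact: cg].
Qed.

(** An energy of at most pi gives 4 u0^2 <= r^2 [radial_gap r], hence 8 u0^2 <= r^2 (1 - r^2); then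
    r^2 <= r and 1 - r^2 <= 2 (1 - r) yield the two bounds. *)
Lemma radial_energy_le_pi (r : R) : 0 < r < 1 -> radial_energy u0 r <= pi ->
  8 * u0 ^+ 2 <= r /\ r <= 1 - 4 * u0 ^+ 2.
Proof.
move=> /andP[r0 r1]; rewrite radial_energyE => le_pi.
have g0 := radial_gap_gt0 r0 r1; have g1 := radial_gap_le r0 r1.
have pp := pi_gt0 R; have q0 : 0 < u0 ^+ 2 by rewrite exprn_gt0.
have a0 : 0 < r ^+ 2 by rewrite exprn_gt0.
have a1 : r ^+ 2 < 1 by rewrite expr_lt1 // ltW.
have h1 : 4 * u0 ^+ 2 / radial_gap r <= r ^+ 2.
  rewrite -(ler_pM2l pp); move: le_pi.
  rewrite (_ : pi * (4 * u0 ^+ 2 / radial_gap r) = 4 * pi * u0 ^+ 2 / radial_gap r); last first.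
    by rewrite [4 * pi]mulrC -!mulrA.
  by rewrite mulrBr mulr1; move: (pi : R) (pi * _) (_ / _) => p x y; lra.
move: h1; rewrite ler_pdivrMr // => h1.
have h2 : 8 * u0 ^+ 2 <= r ^+ 2 * (1 - r ^+ 2).
  have : r ^+ 2 * radial_gap r <= r ^+ 2 * ((1 - r ^+ 2) / 2) by rewrite ler_pM2l.
  lra.
have h3 : r ^+ 2 <= r by rewrite expr2 ler_piMr // ltW.
split.
  apply: le_trans h2 (le_trans _ h3); rewrite ler_piMr ?(ltW a0) //; lra.
have h4 : r ^+ 2 * (1 - r ^+ 2) <= 1 - r ^+ 2 by rewrite ler_piMl ?(ltW a1) // subr_ge0 ltW.
have : 0 <= (1 - r) ^+ 2 by rewrite sqr_ge0.
rewrite sqrrB expr1n mul1r -mulr_natl; lra.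
Qed.

(** All radii of energy at most pi lie in the compact interval [8 u0^2, 1 - 4 u0^2] inside ]0, 1[,
    where the continuous energy attains its minimum; a radius of energy below pi shows that the
    interval is not empty. *)
Lemma exists_optimal_radius : h u0 < pi ->
  exists r : R, 0 < r < 1 /\ radial_energy u0 r = inf_radial_energy u0.
Proof.
rewrite /h gt_min ltxx /= => inf_lt.
have q0 : 0 < u0 ^+ 2 by rewrite exprn_gt0.
have hi : has_inf [set radial_energy u0 r | r in `]0, 1[].
  split; first by exists (radial_energy u0 2^-1), 2^-1 => //=; rewrite in_itv /=; apply/andP; split; lra.
  by exists 0 => y [s /=]; rewrite in_itv /= => s01 <-; exact: radial_energy_ge0.
have e0 : 0 < pi - inf_radial_energy u0 by rewrite subr_gt0.
have [_ [r /= rI <-]] := inf_adherent e0 hi.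
rewrite -/(inf_radial_energy u0) addrC subrK => r_lt.
have r01 : 0 < r < 1 by move: rI; rewrite in_itv.
have [ra rb] := radial_energy_le_pi r01 (ltW r_lt).
set a := 8 * u0 ^+ 2 in ra; set b := 1 - 4 * u0 ^+ 2 in rb.
have a0 : 0 < a by rewrite /a mulr_gt0.
have b1 : b < 1 by rewrite /b gtrBl mulr_gt0.
have cE : {within `[a, b], continuous (radial_energy u0)}.
  apply: continuous_in_subspaceT => s; rewrite inE /= in_itv /= => /andP[sa sb].
  by apply: continuous_radial_energy; [exact: lt_le_trans a0 sa|exact: le_lt_trans sb b1].
have [c] := EVT_min (le_trans ra rb) cE; rewrite in_itv /= => /andP[ca cb] cmin.
have c01 : 0 < c < 1 by rewrite (lt_le_trans a0 ca) (le_lt_trans cb b1).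
have cr : radial_energy u0 c <= radial_energy u0 r by apply: cmin; rewrite in_itv /= ra rb.
exists c; split => //; apply: le_anti; rewrite inf_radial_energy_le // andbT.
apply: lb_le_inf; first by case: hi.
move=> _ [s /= sI <-]; have s01 : 0 < s < 1 by move: sI; rewrite in_itv.
have [sp|sp] := leP (radial_energy u0 s) pi.
  by have [sa sb] := radial_energy_le_pi s01 sp; apply: cmin; rewrite in_itv /= sa sb.
by rewrite (le_trans cr) // ltW // (lt_trans r_lt).
Qed.

End Minimizers.

Theorem lemma10p7 (R : realType) (u0 : R) (u0_gt0 : 0 < u0) :
  (h u0 < pi ->
     (exists r : R, 0 < r < 1 /\ radial_energy u0 r = inf_radial_energy u0) /\
     (forall r : R, 0 < r < 1 -> radial_energy u0 r = inf_radial_energy u0 ->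
        minimizer (@unit_disc R) (cst u0) (radial_candidate u0 r) /\
        energy (@unit_disc R) (radial_candidate u0 r) = (h u0)%:E)) /\
  (h u0 = pi ->
     exists c : R, minimizer (@unit_disc R) (cst u0) (cst c)).
Proof.
split => [h_lt|hE].
  split; first exact: exists_optimal_radius.
  move=> r /andP[r0 r1] rE; apply: minimizer_energy_le => //.
    exact: radial_candidate_admissible.
  have -> : h u0 = radial_energy u0 r.
    by move: h_lt; rewrite rE /h gt_min ltxx /= => /ltW/min_idPr.
  exact: energy_candidate_le.
(* The constant is the boundary value; its energy is the area pi of the whole disc. *)
exists u0; apply: (minimizer_energy_le u0_gt0 (const_admissible u0) _).1.
by rewrite energy_const // hE.
Qed.
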